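(* Let $H$, $V$, the skew-adjoint operator $P:V\to H$, and $\mathcal{P}$ be as in the context. Suppose $(A,B,Q)\in\mathcal{P}$ and $f\in H^1(\mathbb{R},H)$ is causal. Denote by $u\in C^1(\mathbb{R},H)\cap C^0(\mathbb{R},V)$ the causal strong solution of $Au'+Pu+Bu+R[u]=f$. Assume that $\delta A,\delta B\in\mathcal{B}(H)$, $\delta A$ is self-adjoint, and $\delta Q\in L^1(\mathbb{R},\mathcal{B}_{\rm symm}(H))\cap C^0(\mathbb{R}_+,\mathcal{B}(H))$ is bounded with $\delta Q(t)=0$ for $t<0$. Define for $h\in\mathbb{R}$ $$A_h=A+h\,\delta A,\qquad B_h=B+h\,\delta B,\qquad Q_h=Q+h\,\delta Q .$$ For sufficiently small $h$, $(A_h,B_h,Q_h)\in\mathcal{P}$, so that the equation $A_hu_h'+Pu_h+B_hu_h+R_h[u_h]=f$ (with $R_h$ the convolution operator with kernel $Q_h$) has a unique causal strong solution $u_h\in C^1(\mathbb{R},H)\cap C^0(\mathbb{R},V)$. Denote by $\delta u\in C^0(\mathbb{R},H)$ the causal weak solution of $$A\,\delta u'+P\,\delta u+B\,\delta u+R[\delta u]=-\delta A\,u'-\delta B\,u-\delta R[u],$$ in which $R$, respectively $\delta R$, is the convolution operator with kernel $Q$, respectively $\delta Q$. Then for any choice of $T_0\le T\in\mathbb{R}$, $$\lim_{h\to0}\left\|\frac{u_h-u}{h}-\delta u\right\|_{L^\infty([T_0,T],H)}=0 .$$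
   Context: $H$ is a separable real Hilbert space with inner product $\langle\cdot,\cdot\rangle$ and norm $\|\cdot\|$. $V\subset H$ is a dense subspace, itself a separable Hilbert space with norm $\|\cdot\|_V$ defining a stronger topology than that induced by $H$. $P$ is a skew-adjoint operator on $H$ with domain $V$, whose graph norm is equivalent to $\|\cdot\|_V$. $\mathcal{B}(H)$ is the space of bounded linear operators on $H$ with the operator norm, $\mathcal{B}_{\rm symm}(H)$ its subspace of self-adjoint operators. $\mathbb{R}_+=[0,\infty)$. $\mathcal{P}$ is the union over all $0<C_*\le C^*$, $0\le C_B$, $0\le C_Q$ of the sets of triples $(A,B,Q)$ with $A\in\mathcal{B}_{\rm symm}(H)$, $C_*I\le A\le C^*I$; $B\in\mathcal{B}(H)$, $\|B\|_{\mathcal{B}(H)}\le C_B$; and $Q\in L^1(\mathbb{R},\mathcal{B}_{\rm symm}(H))\cap C^0(\mathbb{R}_+,\mathcal{B}(H))$, $Q(t)=0$ for $t<0$, $\|Q\|_{L^1(\mathbb{R},\mathcal{B}(H))}+\|Q\|_{L^\infty(\mathbb{R},\mathcal{B}(H))}\le C_Q$. $L^2_+(\mathbb{R},H)=\{v\in L^2_{\rm loc}(\mathbb{R},H): v\in L^2((-\infty,T],H)\text{ for each }T\in\mathbb{R}\}$. The convolution operator with kernel $Q$ is $R[u](t)=\int Q(t-s)u(s)\,ds$ on $L^2_+(\mathbb{R},H)$; its formal adjoint is $R^*[\phi](t)=\int Q(s-t)\phi(s)\,ds$. A function of $t$ is causal if its support is contained in $[T,\infty)$ for some $T\in\mathbb{R}$.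 A weak solution of $Au'+Pu+Bu+R[u]=f$ is a $u\in L^2_+(\mathbb{R},H)$ such that for all $\phi\in C_0^\infty(\mathbb{R},V)$, $$\int\langle u(t),(A\phi'+P\phi-B^*\phi-R^*[\phi])(t)\rangle\,dt=-\int\langle f(t),\phi(t)\rangle\,dt .$$ A strong solution is a $u\in C^1(\mathbb{R},H)\cap C^0(\mathbb{R},V)\cap L^2_+(\mathbb{R},H)$ satisfying the equation pointwise in $t$. For coefficients in $\mathcal{P}$ and causal $f\in L^2_{\rm loc}(\mathbb{R},H)$ there is exactly one causal weak solution; it is in $C^0(\mathbb{R},H)$, and it is a strong solution if in addition $f\in H^1_{\rm loc}(\mathbb{R},H)$. *)

(* Defs.v *)
From HB Require Import structures.
From mathcomp Require Import all_boot all_order all_algebra.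
From mathcomp Require Import all_classical all_reals all_analysis.

Set Implicit Arguments.
Unset Strict Implicit.
Unset Printing Implicit Defensive.

Import Order.TTheory GRing.Theory Num.Theory.
Import numFieldNormedType.Exports.

Local Open Scope classical_set_scope.
Local Open Scope ring_scope.

Definition separable (T : topologicalType) : Prop :=
  exists2 D : set T, countable D & dense D.

HB.mixin Record CompleteNormedModule_isHilbert (R : realType) H
    & CompleteNormedModule R H := {
  dotp : H -> H -> R ;
  dotpC : forall x y, dotp x y = dotp y x ;
  dotpDl : forall x y z, dotp (x + y) z = dotp x z + dotp y z ;
  dotpZl : forall (a : R) x y, dotp (a *: x) y = a * dotp x y ;
  dotp_norm : forall x, dotp x x = `|x| ^+ 2
}.

#[short(type="hilbertType")]
HB.structure Definition Hilbert (R : realType) :=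
  { H of CompleteNormedModule_isHilbert R H & CompleteNormedModule R H }.

Record bop (R : realType) (H : normedModType R) := Bop {
  bop_fun :> H -> H ;
  bop_linear : linear bop_fun ;
  bop_bounded : exists M : R, forall x, `|bop_fun x| <= M * `|x| }.

HB.instance Definition _ (R : realType) (H : normedModType R) (T : bop H) :=
  GRing.isLinear.Build R H H *:%R (bop_fun T) (bop_linear T).

HB.instance Definition _ (R : realType) (H : normedModType R) :=
  gen_eqMixin (bop H).
HB.instance Definition _ (R : realType) (H : normedModType R) :=
  gen_choiceMixin (bop H).

Section BoundedOperators.
Variables (R : realType) (H : normedModType R).
Implicit Types (S T U : bop H) (x y : H).

Definition opnorm T : R := sup [set `|T x| | x in [set x | `|x| <= 1]].

Lemma bopP S T : (forall x, S x = T x) -> S = T.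
Proof.
case: S T => [S lS bS] [T lT bT] /= /funext eqST; move: lS bS lT bT.
rewrite eqST => *; congr Bop; exact: Prop_irrelevance.
Qed.

Fact bop0_linear : linear (fun _ : H => 0 : H).
Proof. by move=> a x y; rewrite scaler0 addr0. Qed.
Fact bop0_bounded : exists M : R, forall x : H, `|0 : H| <= M * `|x|.
Proof. by exists 0 => x; rewrite normr0 mul0r. Qed.
Definition bop0 := Bop bop0_linear bop0_bounded.

Fact bopN_linear T : linear (fun x => - T x).
Proof. by move=> a x y; rewrite linearP opprD scalerN. Qed.
Fact bopN_bounded T : exists M : R, forall x, `|- T x| <= M * `|x|.
Proof. by case: (bop_bounded T) => M MT; exists M => x; rewrite normrN. Qed.
Definition bopN T := Bop (bopN_linear T) (bopN_bounded T).

Fact bopD_linear S T : linear (fun x => S x + T x).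
Proof. by move=> a x y; rewrite !linearP scalerDr addrACA. Qed.
Fact bopD_bounded S T : exists M : R, forall x, `|S x + T x| <= M * `|x|.
Proof.
case: (bop_bounded S) (bop_bounded T) => [M MS] [N NT]; exists (M + N) => x.
by rewrite mulrDl (le_trans (ler_normD _ _))// lerD.
Qed.
Definition bopD S T := Bop (bopD_linear S T) (bopD_bounded S T).

Fact bopZ_linear (a : R) T : linear (fun x => a *: T x).
Proof. by move=> b x y; rewrite linearP scalerDr !scalerA mulrC. Qed.
Fact bopZ_bounded (a : R) T : exists M : R, forall x, `|a *: T x| <= M * `|x|.
Proof.
case: (bop_bounded T) => M MT; exists (`|a| * M) => x.
by rewrite normrZ -mulrA ler_wpM2l.
Qed.
Definition bopZ a T := Bop (bopZ_linear a T) (bopZ_bounded a T).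

Fact bopDA : associative bopD.
Proof. by move=> S T U; apply: bopP => x /=; rewrite addrA. Qed.
Fact bopDC : commutative bopD.
Proof. by move=> S T; apply: bopP => x /=; rewrite addrC. Qed.
Fact bop0D : left_id bop0 bopD.
Proof. by move=> T; apply: bopP => x /=; rewrite add0r. Qed.
Fact bopND : left_inverse bop0 bopN bopD.
Proof. by move=> T; apply: bopP => x /=; rewrite addNr. Qed.

HB.instance Definition _ :=
  GRing.isZmodule.Build (bop H) bopDA bopDC bop0D bopND.

Fact bopZA a b T : bopZ a (bopZ b T) = bopZ (a * b) T.
Proof. by apply: bopP => x /=; rewrite scalerA. Qed.
Fact bop1Z : left_id 1 bopZ.
Proof. by move=> T; apply: bopP => x /=; rewrite scale1r. Qed.
Fact bopZDr : right_distributive bopZ +%R.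
Proof. by move=> a S T; apply: bopP => x /=; rewrite scalerDr. Qed.
Fact bopZDl T : {morph bopZ^~ T : a b / a + b}.
Proof. by move=> a b; apply: bopP => x /=; rewrite scalerDl. Qed.

HB.instance Definition _ :=
  GRing.Zmodule_isLmodule.Build R (bop H) bopZA bop1Z bopZDr bopZDl.

Lemma opnorm_has_sup T : has_sup [set `|T x| | x in [set x | `|x| <= 1]].
Proof.
split; first by exists `|T 0|, 0 => //=; rewrite normr0.
case: (bop_bounded T) => M MT; exists `|M| => _ [x /= x1 <-].
rewrite (le_trans (MT x))// (le_trans (ler_wpM2r _ (ler_norm M)))//.
by rewrite ler_piMr.
Qed.

Lemma opnorm_ub T x : `|x| <= 1 -> `|T x| <= opnorm T.
Proof.
by move=> x1; apply: (ub_le_sup (opnorm_has_sup T).2); exists x.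
Qed.

Lemma opnorm_le T M : (forall x, `|x| <= 1 -> `|T x| <= M) -> opnorm T <= M.
Proof.
move=> TM; apply: (ge_sup (opnorm_has_sup T).1) => _ [x /= x1 <-].
exact: TM.
Qed.

Fact opnormD S T : opnorm (S + T) <= opnorm S + opnorm T.
Proof.
apply: opnorm_le => x x1 /=.
by rewrite (le_trans (ler_normD _ _))// lerD// opnorm_ub.
Qed.

Fact opnormZ (a : R) T : opnorm (a *: T) = `|a| * opnorm T.
Proof.
apply/le_anti/andP; split.
  by apply: opnorm_le => x x1 /=; rewrite normrZ ler_wpM2l// opnorm_ub.
have [->|a0] := eqVneq a 0.
  rewrite normr0 mul0r (le_trans _ (@opnorm_ub _ 0 _)) ?normr0//.
rewrite -ler_pdivlMl ?normr_gt0//; apply: opnorm_le => x x1.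
rewrite ler_pdivlMl ?normr_gt0// -normrZ.
exact: (@opnorm_ub (a *: T)).
Qed.

Fact opnorm_eq0 T : opnorm T = 0 -> T = 0.
Proof.
move=> T0; apply: bopP => x /=; apply/eqP; rewrite -normr_le0.
have [->|x0] := eqVneq x 0; first by rewrite linear0 normr0.
have := @opnorm_ub T (`|x|^-1 *: x).
rewrite linearZ /= !normrZ normfV normr_id mulVf ?normr_eq0// T0 => /(_ (lexx _)).
by rewrite pmulr_rle0// invr_gt0 normr_gt0.
Qed.

HB.instance Definition _ :=
  Lmodule_isNormed.Build R (bop H) opnormD opnormZ opnorm_eq0.

End BoundedOperators.

Section VectorIntegration.
Variables (R : realType) (E : normedModType R).
Local Notation mu := (@lebesgue_measure R).
Implicit Types f g s : measurableTypeR R -> E.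

Definition simple_fun s : Prop :=
  finite_set (range s) /\ forall x, measurable (s @^-1` [set x]).

Definition simple_integrable s : Prop :=
  simple_fun s /\ forall x, x != 0 -> (mu (s @^-1` [set x]) < +oo)%E.

(* The level set of [0] may have infinite measure, but it is weighted by [0]. *)
Definition simple_integral s : E :=
  \sum_(x \in range s) fine (mu (s @^-1` [set x])) *: x.

(* The limit is required at every point: elements of the Lebesgue spaces are
   handled through their Borel representatives. *)
Definition strongly_measurable f : Prop :=
  exists2 s_ : nat -> measurableTypeR R -> E,
    forall n, simple_fun (s_ n) & forall t, s_ n t @[n --> \oo] --> f t.

Definition has_bochner_integral f (w : E) : Prop :=
  strongly_measurable f /\
  exists s_ : nat -> measurableTypeR R -> E,
    [/\ forall n, simple_integrable (s_ n),
        (\int[mu]_t `|f t - s_ n t|%:E)%E @[n --> \oo] --> 0%E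
      & simple_integral (s_ n) @[n --> \oo] --> w].

(* Equal to [0] when [f] is not Bochner integrable. *)
Definition bochner f : E := xget 0 [set w | has_bochner_integral f w].

Definition vLnorm (p : \bar R) f : \bar R := 'N[mu]_p[(fun t => `|f t|%:E)].

Definition Linfty_norm (D : set (measurableTypeR R)) f : \bar R :=
  vLnorm +oo%E (patch (cst 0) D f).

Definition Lp (p : \bar R) f : Prop :=
  strongly_measurable f /\ (vLnorm p f < +oo)%E.

Definition L2plus f : Prop :=
  strongly_measurable f /\
  forall T : R, (\int[mu]_(t in `]-oo, T]) (`|f t| ^+ 2)%:E < +oo)%E.

Definition causal f : Prop :=
  exists T : R, {ae mu, forall t, t < T -> f t = 0}.

End VectorIntegration.

Section VectorCalculus.
Variables (R : realType) (E : normedModType R).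
Local Notation mu := (@lebesgue_measure R).
Implicit Types f : R -> E.

Definition C1 f : Prop :=
  (forall t, derivable f t 1) /\ continuous (derive1 f).

Definition test_fun f : Prop :=
  (forall n t, derivable (derive1n n f) t 1) /\
  exists M : R, forall t, M < `|t| -> f t = 0.

End VectorCalculus.

Definition weak_derivative (R : realType) (E : normedModType R)
    (f g : R -> E) : Prop :=
  forall psi : R -> R, test_fun psi ->
    bochner (fun t => derive1 psi t *: f t) = - bochner (fun t => psi t *: g t).

(* A class in H^1 has exactly one continuous representative, and pointwise
   statements about the class refer to it; hence the continuity requirement. *)
Definition H1 (R : realType) (E : normedModType R) (f : R -> E) : Prop :=
  [/\ continuous f, Lp 2%:E f &
      exists2 g : R -> E, Lp 2%:E g & weak_derivative f g].

Section Operators.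
Variables (R : realType) (H : hilbertType R).
Implicit Types A B : bop H.

Definition selfadjoint A : Prop := forall x y, dotp (A x) y = dotp x (A y).

Definition adjoint B (y : H) : H :=
  xget 0 [set z | forall x, dotp (B x) y = dotp x z].

(* [P] is an unbounded operator on [H] whose domain is the range of [j]. The
   left-hand side says that [y] lies in the domain of the adjoint of [P] and is
   mapped to [z] by it, the right-hand side says the same of [- P]. *)
Definition skew_adjoint (V : hilbertType R) (j P : V -> H) : Prop :=
  forall y z : H,
    (forall v, dotp (P v) y = dotp (j v) z) <->
    (exists2 w, y = j w & z = - P w).

Definition convolution (Q : R -> bop H) (u : R -> H) (t : R) : H :=
  bochner (fun s => Q (t - s) (u s)).

Definition convolution_adj (Q : R -> bop H) (phi : R -> H) (t : R) : H :=
  bochner (fun s => Q (s - t) (phi s)).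

Definition L1_symm (Q : R -> bop H) : Prop :=
  Lp 1%:E Q /\ forall t, selfadjoint (Q t).

Definition coefficients A B (Q : R -> bop H) : Prop :=
  exists Clow Cup CB CQ : R,
    [/\ 0 < Clow, Clow <= Cup, 0 <= CB & 0 <= CQ] /\
    [/\ selfadjoint A,
        forall x, Clow * dotp x x <= dotp (A x) x <= Cup * dotp x x
      & `|B| <= CB] /\
    [/\ L1_symm Q, {within `[0, +oo[, continuous Q},
        forall t : R, t < 0 -> Q t = 0
      & (vLnorm 1%:E Q + vLnorm +oo%E Q <= CQ%:E)%E].

End Operators.

Section Solutions.
Variables (R : realType) (H V : hilbertType R) (j P : V -> H).
Local Notation mu := (@lebesgue_measure R).

Definition weak_solution (A B : bop H) (Q : R -> bop H) (f u : R -> H) : Prop :=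
  L2plus u /\
  forall phi : R -> V, test_fun phi ->
    \int[mu]_t dotp (u t) (A (j (derive1 phi t)) + P (phi t)
                           - adjoint B (j (phi t))
                           - convolution_adj Q (j \o phi) t)
    = - \int[mu]_t dotp (f t) (j (phi t)).

Definition strong_solution (A B : bop H) (Q : R -> bop H) (f u : R -> H) :
    Prop :=
  [/\ C1 u, L2plus u &
      exists v : R -> V,
        [/\ continuous v, forall t, u t = j (v t) &
            forall t, A (derive1 u t) + P (v t) + B (u t) + convolution Q u t = f t]].

End Solutions.

(* Main.v *)
(* Let I be the primitive vanishing at -oo and R the convolution with Q. A steep
   exponential weight absorbs the memory term, so the energy <A u, u> bounds a
   causal solution uniformly by the L^1 norm of its data. For data I I g a
   solution is a limit of Picard solutions of the equations in which P is
   replaced by its Yosida approximations. For f in H^1, f' is approximated in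
   L^1 by functions I I g; the corresponding solutions converge locally
   uniformly to some W, and since I commutes with the equation, I W solves it
   with data f. Comparing perturbed and unperturbed solutions with the same
   regular data shows that u_h' tends to u' locally uniformly.

   Now w_h = (u_h - u) / h is a strong solution of the unperturbed equation with
   data -(dA u_h' + dB u_h + dR u_h), which tend to the data of du. Testing the
   weak formulation with t |-> m (r - t) v makes the mollification of du a strong
   solution with mollified data, and the energy estimate applies to its
   difference with w_h. *)
From HB Require Import structures.
Require Import Defs.
From mathcomp Require Import all_boot all_order all_algebra.
From mathcomp Require Import all_classical all_reals all_analysis.
From mathcomp Require Import measurable_realfun.
From mathcomp Require Import ring lra.

Set Implicit Arguments.
Unset Strict Implicit.
Unset Printing Implicit Defensive.

Import Order.TTheory GRing.Theory Num.Theory.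
Import numFieldNormedType.Exports.

Local Open Scope classical_set_scope.
Local Open Scope ring_scope.

(** * Hilbert spaces and bounded operators *)

(** Differentiating in the coefficients costs one time derivative: the data of the difference
    quotient contain [u_h'], while the energy estimate bounds a solution only by its own data. As
    [f'] is merely square integrable, this gives no rate in [h], and a density argument must supply
    the convergence of [u_h']. It works because coercivity constant and operator bounds can be
    chosen once for all small [h], so that one smooth approximation serves all of them.

    In the data [I I g] each integration has its task: the bound on the derivative obtained from [g]
    keeps the Yosida terms bounded, and the outer primitive turns a uniform limit into a derivative.

    [P u] is rarely computed from a lift to [V]. It is the value prescribed by the equation, and a
    relation closed under limits states that this value is correct.

    Bochner integrals are handled by pairing with vectors, which reduces linearity, Fubini and the
    fundamental theorem to real integrals. Mollifiers live on [[0, eps]], so that mollification is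
    one more convolution with a causal kernel. *)

Section Sequences.
Variables (R : realType) (E : normedModType R).

Lemma cvg_seqP (u : nat -> E) (l : E) :
  u @ \oo --> l <->
  forall e : R, 0 < e -> exists N : nat, forall n, (N <= n)%N -> `|u n - l| <= e.
Proof.
split=> [/cvgrPdist_le ul e /ul[N _ NP]|ul].
  by exists N => n Nn; rewrite distrC; exact: NP.
apply/cvgrPdist_le => e /ul[N NP].
by exists N => // n /= Nn; rewrite distrC NP.
Qed.

End Sequences.

Lemma cauchy_seq_cvg (R : realType) (E : completeNormedModType R) (u : nat -> E) :
  (forall e : R, 0 < e -> exists N : nat, forall n m,
     (N <= n)%N -> (N <= m)%N -> `|u n - u m| <= e) ->
  exists l : E, u @ \oo --> l.
Proof.
move=> cu; suff : cvg (u @ \oo) by move=> ?; exists (lim (u @ \oo)).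
apply/cauchy_cvgP/cauchy_exP => e e0.
have e2 : 0 < e / 2 by rewrite divr_gt0.
have [N NP] := cu _ e2.
exists (u N), N => // n /= Nn.
rewrite -ball_normE /= (le_lt_trans (NP _ _ _ _))//.
by rewrite ltr_pdivrMr// ltr_pMr// ltr1n.
Qed.

Section InnerProduct.
Variables (R : realType) (H : hilbertType R).
Implicit Types (x y z : H) (a : R).

Lemma dotpDr x y z : dotp x (y + z) = dotp x y + dotp x z.
Proof. by rewrite dotpC dotpDl !(dotpC x). Qed.

Lemma dotpZr a x y : dotp x (a *: y) = a * dotp x y.
Proof. by rewrite dotpC dotpZl dotpC. Qed.

Lemma dotpNl x y : dotp (- x) y = - dotp x y.
Proof. by rewrite -scaleN1r dotpZl mulN1r. Qed.

Lemma dotpNr x y : dotp x (- y) = - dotp x y.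
Proof. by rewrite dotpC dotpNl dotpC. Qed.

Lemma dotpBl x y z : dotp (x - y) z = dotp x z - dotp y z.
Proof. by rewrite dotpDl dotpNl. Qed.

Lemma dotpBr x y z : dotp x (y - z) = dotp x y - dotp x z.
Proof. by rewrite dotpDr dotpNr. Qed.

Lemma dotp0l x : dotp 0 x = 0.
Proof. by rewrite -(scale0r (0 : H)) dotpZl mul0r. Qed.

Lemma dotp0r x : dotp x 0 = 0.
Proof. by rewrite dotpC dotp0l. Qed.

Lemma dotp_ge0 x : 0 <= dotp x x.
Proof. by rewrite dotp_norm sqr_ge0. Qed.

Lemma dotp_eq0 x : dotp x x = 0 -> x = 0.
Proof. by rewrite dotp_norm => /eqP; rewrite sqrf_eq0 normr_eq0 => /eqP. Qed.

Lemma dotp_inj x y : (forall z, dotp x z = dotp y z) -> x = y.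
Proof.
move=> xy; apply/subr0_eq/dotp_eq0.
by rewrite dotpBl xy subrr.
Qed.

Lemma cauchy_schwarz x y : `|dotp x y| <= `|x| * `|y|.
Proof.
have [->|y0] := eqVneq y 0; first by rewrite dotp0r !normr0 mulr0.
have yy : 0 < dotp y y by rewrite dotp_norm exprn_gt0// normr_gt0.
(* The squared norm of this vector is [|y|^2 (|x|^2 |y|^2 - <x, y>^2)]. *)
have := dotp_ge0 (dotp y y *: x - dotp x y *: y).
rewrite dotpBl !dotpBr !dotpZl !dotpZr (dotpC y x) => h.
have {}h : 0 <= dotp y y * (dotp x x * dotp y y - dotp x y ^+ 2) by nra.
rewrite pmulr_rge0// subr_ge0 in h.
rewrite -(@ler_pXn2r _ 2)// ?nnegrE ?mulr_ge0//.
by rewrite exprMn -!dotp_norm -normrX ger0_norm ?sqr_ge0.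
Qed.

Lemma dotp_le x y : dotp x y <= `|x| * `|y|.
Proof. exact: le_trans (ler_norm _) (cauchy_schwarz x y). Qed.

(** Take [y = x]. Norm bounds for Bochner integrals are reduced to scalar integrals in this way. *)
Lemma norm_le_dotp x (M : R) : 0 <= M ->
  (forall y, dotp x y <= M * `|y|) -> `|x| <= M.
Proof.
move=> M0 /(_ x); rewrite dotp_norm expr2.
have [->|x0] := eqVneq x 0; first by rewrite normr0.
by rewrite ler_pM2r// normr_gt0.
Qed.

Lemma cvg_dotp (T : Type) (F : set_system T) {FF : Filter F} (f g : T -> H) x y :
  f @ F --> x -> g @ F --> y -> dotp (f t) (g t) @[t --> F] --> dotp x y.
Proof.
move=> fx gy.
have e t : dotp (f t) (g t) = dotp x y + (dotp (f t - x) (g t) + dotp x (g t - y)).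
  by rewrite dotpBl dotpBr; ring.
under eq_fun do rewrite e.
have aux (u v : T -> R) (a b c : R) : u @ F --> a -> v @ F --> b -> a + b = c ->
    u t + v t @[t --> F] --> c by move=> ua vb <-; exact: cvgD.
have auxM (u v : T -> R) (a b c : R) : u @ F --> a -> v @ F --> b -> a * b = c ->
    u t * v t @[t --> F] --> c by move=> ua vb <-; exact: cvgM.
have aux0 (h : T -> H) (z : H) : h @ F --> z -> `|h t - z| @[t --> F] --> 0.
  move=> hz; apply/norm_cvg0P; rewrite -(subrr z).
  by apply: cvgB => //; exact: cvg_cst.
apply: (aux _ _ _ _ _ (cvg_cst _) _ (addr0 _)).
apply: (aux _ _ _ _ _ _ _ (addr0 0)).
  apply/norm_cvg0P.
  apply: (@squeeze_cvgr _ _ _ _ (fun=> 0) (fun t => `|f t - x| * `|g t|)).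
  - by apply: nearW => t; rewrite normr_ge0 cauchy_schwarz.
  - exact: cvg_cst.
  - exact: (auxM _ _ _ _ _ (aux0 _ _ fx) (cvg_norm gy) (mul0r _)).
apply/norm_cvg0P.
apply: (@squeeze_cvgr _ _ _ _ (fun=> 0) (fun t => `|x| * `|g t - y|)).
- by apply: nearW => t; rewrite normr_ge0 cauchy_schwarz.
- exact: cvg_cst.
- exact: (auxM _ _ _ _ _ (cvg_cst _) (aux0 _ _ gy) (mulr0 _)).
Qed.

Lemma continuous_dotp (T : topologicalType) (f g : T -> H) :
  continuous f -> continuous g -> continuous (fun t => dotp (f t) (g t)).
Proof. by move=> cf cg t; apply: cvg_dotp; [exact: cf|exact: cg]. Qed.

End InnerProduct.

Section BoundedOperatorBound.
Variables (R : realType) (H : normedModType R).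

Lemma bop_le (T : bop H) (x : H) : `|T x| <= `|T| * `|x|.
Proof.
have [->|x0] := eqVneq x 0; first by rewrite linear0 !normr0 mulr0.
have := @opnorm_ub _ _ T (`|x|^-1 *: x).
rewrite linearZ /= !normrZ normfV normr_id mulVf ?normr_eq0// => /(_ (lexx _)).
by rewrite mulrC ler_pdivrMr ?normr_gt0.
Qed.

Lemma cvg_bop (T : Type) (F : set_system T) {FF : Filter F}
    (f : T -> bop H) (g : T -> H) (B : bop H) (y : H) :
  f @ F --> B -> g @ F --> y -> (f t) (g t) @[t --> F] --> B y.
Proof.
move=> fB gy; apply/cvgrPdist_le => e e0.
have K : (1 + `|y|) + `|B| > 0 by rewrite !ltr_wpDr.
near=> t.
have -> : B y - f t (g t) = B (y - g t) + (B - f t) (g t).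
  by rewrite linearB /= subrKA.
rewrite (le_trans (ler_normD _ _))//.
have h : `|y - g t| <= e / (1 + `|y| + `|B|).
  near: t; apply: (cvgr_dist_le _ _ gy); exact: divr_gt0.
have h1 : `|y - g t| <= 1 by near: t; exact: (cvgr_dist_le _ _ gy).
have h2 : `|B - f t| <= e / (1 + `|y| + `|B|).
  near: t; apply: (cvgr_dist_le _ _ fB); exact: divr_gt0.
have h3 : `|g t| <= 1 + `|y|.
  by rewrite -[g t](subKr y) (le_trans (ler_normB _ _))// addrC lerD.
rewrite (@le_trans _ _ (`|B| * (e / (1 + `|y| + `|B|)) +
   (e / (1 + `|y| + `|B|)) * (1 + `|y|)))//.
  apply: lerD; rewrite (le_trans (bop_le _ _))//; first exact: ler_wpM2l.
  exact: ler_pM.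
by rewrite mulrC -mulrDr [`|B| + _]addrC divfK// gt_eqF.
Unshelve. all: by end_near. Qed.

End BoundedOperatorBound.

(** * Riesz representation and surjectivity of operators bounded below *)

Section Riesz.
Variables (R : realType) (H V : hilbertType R) (T : {linear V -> H}).
Variables (c C : R) (c0 : 0 < c).
Hypothesis T_bounds : forall v, c * `|v| <= `|T v| <= C * `|v|.

Lemma parallelogram (x y : H) :
  `|x - y| ^+ 2 = 2 * `|x| ^+ 2 + 2 * `|y| ^+ 2 - `|x + y| ^+ 2.
Proof.
by rewrite -!dotp_norm !(dotpBl, dotpDl, dotpBr, dotpDr) (dotpC y x); ring.
Qed.

(* The representing vector minimizes [|T v|^2 - 2 l v]. *)
Lemma riesz (l : V -> R) (M : R) :
  (forall a v w, l (a *: v + w) = a * l v + l w) ->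
  (forall v, `|l v| <= M * `|v|) ->
  exists v, forall w, dotp (T v) (T w) = l w.
Proof.
move=> lin lM.
have lD v w : l (v + w) = l v + l w by rewrite -[v]scale1r lin !scale1r mul1r.
have l0 : l 0 = 0.
  by have := lM 0; rewrite normr0 mulr0 normr_le0 => /eqP.
have lZ a v : l (a *: v) = a * l v by rewrite -[a *: v]addr0 lin l0 addr0.
pose J v := `|T v| ^+ 2 - 2 * l v.
(* Since [|v| <= |T v| / c], [J v] is at least [|T v|^2 - 2 (M / c) |T v|]; complete the square. *)
have Jlb v : - (M / c) ^+ 2 <= J v.
  have Tc : `|v| <= `|T v| / c.
    by rewrite ler_pdivlMr// mulrC; case/andP: (T_bounds v).
  have [v0|v0] := eqVneq v 0.
    by rewrite /J v0 linear0 normr0 expr0n l0 mulr0 subr0/= oppr_le0 sqr_ge0.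
  have M0 : 0 <= M.
    by have := le_trans (normr_ge0 _) (lM v); rewrite pmulr_lge0// normr_gt0.
  have lv : l v <= M / c * `|T v|.
    rewrite (le_trans (ler_norm _))// (le_trans (lM v))//.
    by rewrite -mulrA ler_wpM2l// mulrC.
  rewrite /J; have := sqr_ge0 (`|T v| - M / c); rewrite sqrrB.
  nra.
pose S := range J.
have Sinf : has_inf S.
  by split; [exists (J 0), 0|exists (- (M / c) ^+ 2) => _ [v _ <-]].
pose d := inf S.
have Jd v : d <= J v by apply: (ge_inf Sinf.2); exists v.
have near_inf n : exists v, J v < d + n.+1%:R^-1.
  have n0 : 0 < n.+1%:R^-1 :> R by [].
  have [_ [v _ <-] Jv] := inf_adherent n0 Sinf.
  by exists v.
pose v_ n := projT1 (cid (near_inf n)).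
have Jv n : J (v_ n) < d + n.+1%:R^-1 by rewrite /v_; case: cid.
(* By the parallelogram identity [|T (v - w)|^2 = 2 J v + 2 J w - 4 J ((v + w) / 2)], so minimizing
   sequences are Cauchy. *)
have quasi v w : `|T (v - w)| ^+ 2 <= 2 * (J v - d) + 2 * (J w - d).
  have := Jd (2^-1 *: (v + w)).
  rewrite linearB /= parallelogram -linearD /J linearZ/= normrZ lZ lD exprMn.
  rewrite normfV ger0_norm//; have -> : (2^-1 : R) ^+ 2 = 4^-1 by field.
  lra.
have inv_small (e : R) : 0 < e -> exists N : nat, forall n, (N <= n)%N -> n.+1%:R^-1 <= e.
  move=> e0; have [N NP] := (cvg_seqP _ _).1 (@cvg_harmonic R) e e0.
  by exists N => n /NP; rewrite subr0 /harmonic/= ger0_norm.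
have [v vP] : exists v : V, v_ @ \oo --> v.
  apply: cauchy_seq_cvg => e e0.
  have ce : 0 < (c * e) ^+ 2 / 4 by rewrite divr_gt0// exprn_gt0// mulr_gt0.
  have [N NP] := inv_small _ ce; exists N => n m Nn Nm.
  rewrite -(ler_pM2l c0); have /andP[+ _] := T_bounds (v_ n - v_ m).
  move=> /le_trans; apply.
  rewrite -(@ler_pXn2r _ 2)// ?nnegrE ?mulr_ge0 ?(ltW e0) ?(ltW c0)//.
  rewrite (le_trans (quasi _ _))//.
  move: (NP _ Nn) (NP _ Nm) (Jv n) (Jv m) => /=.
  move: (J _) (J _) (n.+1%:R^-1) (m.+1%:R^-1) ((c * e) ^+ 2) => ? ? ? ? ?; lra.
have Tv : T (v_ n) @[n --> \oo] --> T v.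
  apply/cvg_seqP => e e0.
  have C0 : 0 < `|C| + 1 by rewrite ltr_wpDl.
  have [N NP] := (cvg_seqP _ _).1 vP (e / (`|C| + 1)) (divr_gt0 e0 C0).
  exists N => n /NP; rewrite ler_pdivlMr// -linearB /= => h.
  have /andP[_ /le_trans->//] := T_bounds (v_ n - v).
  apply: le_trans h; rewrite mulrC ler_wpM2l//.
  by rewrite (le_trans (ler_norm _))// lerDl.
have lv : l (v_ n) @[n --> \oo] --> l v.
  apply/cvg_seqP => e e0.
  have M0 : 0 < `|M| + 1 by rewrite ltr_wpDl.
  have [N NP] := (cvg_seqP _ _).1 vP (e / (`|M| + 1)) (divr_gt0 e0 M0).
  exists N => n /NP; rewrite ler_pdivlMr// => h.
  have -> : l (v_ n) - l v = l (v_ n - v).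
    by rewrite lD -[- v]scaleN1r lZ mulN1r.
  apply: le_trans (lM _) _; apply: le_trans h; rewrite mulrC ler_wpM2l//.
  by rewrite (le_trans (ler_norm _))// lerDl.
have JvE : J v = d.
  apply/le_anti; rewrite Jd andbT.
  have Jn : J (v_ n) @[n --> \oo] --> J v.
    apply: cvgB; last by apply: cvgM => //; exact: cvg_cst.
    by rewrite expr2; under eq_fun do rewrite expr2; apply: cvgM; exact: cvg_norm.
  have dn : d + (@harmonic R) n @[n --> \oo] --> d + 0.
    by apply: cvgD; [exact: cvg_cst|exact: cvg_harmonic].
  rewrite -[d]addr0; apply: (ler_cvg_to Jn dn).
  by apply: nearW => n; exact/ltW.
exists v => w; apply/eqP; rewrite -subr_eq0; apply/eqP.
set p := dotp (T v) (T w) - l w.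
(* Minimality of [J] along the line [v + s w]. *)
have vary s : 0 <= 2 * s * p + s ^+ 2 * `|T w| ^+ 2.
  have := Jd (v + s *: w); rewrite -JvE /J (_ : T (v + s *: w) = T v + s *: T w) ?lD ?lZ; last by rewrite linearD linearZ.
  rewrite -!dotp_norm !(dotpDl, dotpDr, dotpZl, dotpZr) (dotpC (T w) (T v)) /p; nra.
have q0 : 0 < `|T w| ^+ 2 + 1 by rewrite ltr_wpDl// sqr_ge0.
(* The optimal [s] is [- p / |T w|^2]; the added [1] avoids a division by zero and still forces
   [p = 0]. *)
have := vary (- p / (`|T w| ^+ 2 + 1)).
have -> : 2 * (- p / (`|T w| ^+ 2 + 1)) * p +
    (- p / (`|T w| ^+ 2 + 1)) ^+ 2 * `|T w| ^+ 2 =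
    - (p / (`|T w| ^+ 2 + 1)) ^+ 2 * (`|T w| ^+ 2 + 2) by field; rewrite gt_eqF.
rewrite mulNr oppr_ge0 pmulr_lle0 ?ltr_wpDl ?sqr_ge0//.
move=> h; have /eqP : (p / (`|T w| ^+ 2 + 1)) ^+ 2 = 0.
  by apply/le_anti; rewrite h sqr_ge0.
by rewrite sqrf_eq0 mulf_eq0 invr_eq0 (gt_eqF q0) orbF => /eqP.
Qed.

(** Representing [v |-> <y, T v>] gives a [v] for which [T v - y] is orthogonal to the range of [T],
    hence zero. *)
Lemma lower_bounded_surjective :
  (forall y, (forall v, dotp (T v) y = 0) -> y = 0) -> forall y, exists v, T v = y.
Proof.
move=> T_dense y.
have [] := @riesz (fun v => dotp y (T v)) (`|y| * C).
- by move=> a v w; rewrite linearP /= dotpDr dotpZr.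
- move=> v; rewrite (le_trans (cauchy_schwarz _ _))// -mulrA ler_wpM2l//.
  by case/andP: (T_bounds v).
move=> v vP; exists v; apply/subr0_eq/T_dense => w.
by rewrite dotpC dotpBl vP subrr.
Qed.

End Riesz.

Section Adjoint.
Variables (R : realType) (H : hilbertType R).

Lemma adjointE (B : bop H) (x y : H) : dotp (B x) y = dotp x (adjoint B y).
Proof.
rewrite /adjoint; case: xgetP => [z _ /= ->//|noadj].
(* The default value of [xget] never occurs: the representing vector exists by [riesz] with the
   identity as [T]. *)
have [] := @riesz R H H idfun 1 1 ltr01 _ (fun x => dotp (B x) y) (`|B| * `|y|).
- by move=> v; rewrite !mul1r lexx.
- by move=> a v w; rewrite linearP /= dotpDl dotpZl.
- move=> v; rewrite (le_trans (cauchy_schwarz _ _))// mulrAC ler_wpM2r//.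
  exact: bop_le.
by move=> z zP; case: (noadj z) => w /=; rewrite -zP dotpC.
Qed.

(** Coercivity bounds [A] below and makes its range dense: if [y] is orthogonal to the range, then
    [<A y, y> = 0]. The inverse is used to solve the equation for [u']. *)
Lemma coercive_inverse (A : bop H) (c : R) : 0 < c ->
  (forall x, c * dotp x x <= dotp (A x) x) ->
  exists A' : bop H, (forall x, A (A' x) = x).
Proof.
move=> c0 Ac.
have lower x : c * `|x| <= `|A x|.
  have [->|x0] := eqVneq x 0; first by rewrite linear0 !normr0 mulr0.
  rewrite -(@ler_pM2r _ `|x|) ?normr_gt0// -mulrA -expr2 -dotp_norm.
  by rewrite (le_trans (Ac x))// dotp_le.
have [||A' A'P] := choice (@lower_bounded_surjective R H H A c `|A| c0 _ _).
- by move=> v; rewrite lower bop_le.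
- move=> y yA; apply: dotp_eq0; apply/le_anti; rewrite dotp_ge0 andbT.
  by rewrite -(ler_pM2l c0) mulr0 (le_trans (Ac _))// yA.
have A_inj x y : A x = A y -> x = y.
  move=> xy; apply/subr0_eq/eqP; rewrite -normr_le0 -(ler_pM2l c0) mulr0.
  by rewrite (le_trans (lower _))// linearB /= xy subrr normr0.
have A'lin : linear A'.
  by move=> a x y; apply: A_inj; rewrite linearP /= !A'P.
have A'bnd : exists M : R, forall x, `|A' x| <= M * `|x|.
  by exists c^-1 => x; rewrite ler_pdivlMl// (le_trans (lower _))// A'P.
by exists (Bop A'lin A'bnd) => x; exact: A'P.
Qed.

End Adjoint.

Section BopAlgebra.
Variables (R : realType) (H : normedModType R) (B : bop H).

Lemma bop_sub x y : B (x - y) = B x - B y. Proof. exact: linearB. Qed.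
Lemma bop_scale a x : B (a *: x) = a *: B x. Proof. exact: linearZ. Qed.
Lemma bop_zero : B 0 = 0. Proof. exact: linear0. Qed.

End BopAlgebra.

(** * Strong measurability and the Bochner integral *)

Section SimpleFunctions.
Context d (T : measurableType d).

(* [simple_fun] over an arbitrary measurable space and without any structure on
   the codomain: pairs and operators are needed as values. *)
Definition fsimple (X : Type) (s : T -> X) : Prop :=
  finite_set (range s) /\ forall x, measurable (s @^-1` [set x]).

Lemma fsimple_preimage X (s : T -> X) (A : set X) :
  fsimple s -> measurable (s @^-1` A).
Proof.
move=> [fs ms].
have -> : s @^-1` A = \bigcup_(y in range s `&` A) (s @^-1` [set y]).
  apply/seteqP; split=> [t At|t [y [_ Ay] /= sy]]; last by rewrite sy.
  by exists (s t) => //; split => //; exists t.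
by apply: fin_bigcup_measurable => //; apply: finite_setIl.
Qed.

Lemma fsimple_comp X Y (s : T -> X) (f : X -> Y) :
  fsimple s -> fsimple (f \o s).
Proof.
move=> hs; split; last by move=> y; rewrite comp_preimage; exact: fsimple_preimage.
apply: (@sub_finite_set _ _ (f @` range s)).
  by move=> _ [t _ <-]; exists (s t) => //; exists t.
by apply: finite_image; case: hs.
Qed.

Lemma fsimple_pair X Y (s : T -> X) (s' : T -> Y) :
  fsimple s -> fsimple s' -> fsimple (fun t => (s t, s' t)).
Proof.
move=> hs hs'; split.
  apply: (@sub_finite_set _ _ (range s `*` range s')).
    by move=> _ [t _ <-]; split; exists t.
  by apply: finite_setX; [case: hs|case: hs'].
move=> [x y].
have -> : (fun t => (s t, s' t)) @^-1` [set (x, y)] =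
    (s @^-1` [set x]) `&` (s' @^-1` [set y]).
  by apply/seteqP; split=> t /= => [[-> ->]//|[-> ->]].
by apply: measurableI; exact: fsimple_preimage.
Qed.

Lemma fsimple_indic (R : realType) (D : set T) : measurable D -> fsimple (\1_D : T -> R).
Proof.
move=> mD.
have : fsimple (fun t => t \in D).
  split.
    by apply: (@sub_finite_set _ _ setT) => //; exact: finite_finset.
  move=> [].
    rewrite (_ : _ @^-1` _ = D)//; apply/seteqP; split=> t /=; first exact: set_mem.
    by move=> /mem_set.
  rewrite (_ : _ @^-1` _ = ~` D); first exact: measurableC.
  apply/seteqP; split=> t /=; first by move=> /negbT/negP + Dt; apply; exact: mem_set.
  by move=> Dt; apply/negbTE/negP => /set_mem.
by move=> /(fsimple_comp (fun b : bool => b%:R : R)).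
Qed.

End SimpleFunctions.

Lemma fsimple_precomp d (T : measurableType d) d' (T' : measurableType d') X (s : T -> X) (g : T' -> T) :
  measurable_fun setT g -> fsimple s -> fsimple (s \o g).
Proof.
move=> mg [fs ms]; split.
  apply: sub_finite_set fs; move=> _ [t _ <-]; by exists (g t).
move=> x; rewrite comp_preimage -[X in measurable X]setTI.
by apply: mg => //; exact: ms.
Qed.

Section StrongMeasurability.
Variable R : realType.
Local Notation T := (measurableTypeR R).

(** Sequential continuity suffices, as the simple approximants are combined pairwise; it covers
    sums, products and the evaluation of operators. *)
Lemma sm_op2 (E1 E2 E3 : normedModType R) (op : E1 -> E2 -> E3)
    (f : T -> E1) (g : T -> E2) :
  (forall (x_ : nat -> E1) (y_ : nat -> E2) x y, x_ @ \oo --> x -> y_ @ \oo --> y ->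
     op (x_ n) (y_ n) @[n --> \oo] --> op x y) ->
  strongly_measurable f -> strongly_measurable g ->
  strongly_measurable (fun t => op (f t) (g t)).
Proof.
move=> cop [f_ sf cf] [g_ sg cg].
exists (fun n t => op (f_ n t) (g_ n t)) => [n|t]; last exact: cop.
exact: (fsimple_comp (fun p => op p.1 p.2) (fsimple_pair (sf n) (sg n))).
Qed.

Lemma sm_precomp (E : normedModType R) (f : T -> E) (g : T -> T) :
  measurable_fun setT g -> strongly_measurable f -> strongly_measurable (f \o g).
Proof.
move=> mg [f_ sf cf]; exists (fun n => f_ n \o g) => [n|t]; last exact: cf.
exact: fsimple_precomp mg (sf n).
Qed.

Lemma sm_simple (E : normedModType R) (s : T -> E) :
  simple_fun s -> strongly_measurable s.
Proof. by move=> ss; exists (fun=> s) => // t; exact: cvg_cst. Qed.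

Lemma sm_cst (E : normedModType R) (x : E) : strongly_measurable (fun _ : T => x).
Proof.
apply: sm_simple; apply: (@fsimple_comp _ _ R E \1_set0 (fun=> x)).
exact: fsimple_indic.
Qed.

Lemma sm_indic (D : set T) : measurable D -> strongly_measurable (\1_D : T -> R).
Proof. by move=> mD; apply: sm_simple; exact: fsimple_indic. Qed.

Lemma sm_add (E : normedModType R) (f g : T -> E) :
  strongly_measurable f -> strongly_measurable g -> strongly_measurable (f \+ g).
Proof. by apply: (sm_op2 (op := +%R)) => x_ y_ x y; exact: cvgD. Qed.

Lemma sm_scale (E : normedModType R) (f : T -> R) (g : T -> E) :
  strongly_measurable f -> strongly_measurable g ->
  strongly_measurable (fun t => f t *: g t).
Proof.
by apply: (@sm_op2 _ E E (fun (a : R) x => a *: x)) => x_ y_ x y; exact: cvgZ.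
Qed.

Lemma sm_bop (H : normedModType R) (f : T -> bop H) (g : T -> H) :
  strongly_measurable f -> strongly_measurable g ->
  strongly_measurable (fun t => f t (g t)).
Proof.
apply: (sm_op2 (op := @bop_fun R H)) => x_ y_ x y; exact: cvg_bop.
Qed.

(* Step functions on the grid of mesh [1 / (n + 1)] converge pointwise. *)
Lemma sm_continuous (E : normedModType R) (f : R -> E) :
  continuous f -> strongly_measurable (f : T -> E).
Proof.
move=> cf.
(* The cells [D n k] with [k < N n] tile [[-n, n)], and [K n] below is the index of the cell
   containing [t]. *)
pose c n k : R := k%:R / n.+1%:R - n%:R.
pose D n k : set T := `[c n k, c n k.+1[%classic.
pose N n := (n.*2 * n.+1)%N.
exists (fun n t => \sum_(k < N n) \1_(D n k) t *: f (c n k)) => [n|t].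
  have add0 : simple_fun (fun _ : T => 0 : E).
    exact: (@fsimple_comp _ _ R E \1_set0 (fun=> 0) (fsimple_indic R measurable0)).
  elim: (N n) => [|m IH]; first by under eq_fun do rewrite big_ord0.
  under eq_fun do rewrite big_ord_recr /=.
  have := fsimple_pair IH (fsimple_indic R (measurable_itv `[c n m, c n m.+1[)).
  by move=> /(fsimple_comp (fun p => p.1 + p.2 *: f (c n m))).
pose K n := Num.truncn ((t + n%:R) * n.+1%:R).
have t_lt_n n : `|t| < n%:R -> 0 < t + n%:R < n.*2%:R.
  by rewrite ltr_norml -mul2n natrM mulr2n mulrDl mul1r => /andP[] ? ?; lra.
have KP n : `|t| < n%:R -> D n (K n) t.
  move=> /t_lt_n /andP[t1 _]; rewrite /D /= in_itv/= /c.
  have n0 : (0 : R) < n.+1%:R by [].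
  have /truncn_itv /andP[] : 0 <= (t + n%:R) * n.+1%:R by rewrite mulr_ge0// ltW.
  by rewrite -/(K n) lerBlDr ltrBrDr ler_pdivrMr// ltr_pdivlMr// => -> ->.
have stE n : `|t| < n%:R -> \sum_(k < N n) \1_(D n k) t *: f (c n k) = f (c n (K n)).
  move=> tn; have DK := KP n tn.
  have KN : (K n < N n)%N.
    rewrite -(ltr_nat R) /N natrM; have /andP[t1 t2] := t_lt_n n tn.
    have n0 : (0 : R) < n.+1%:R by [].
    have h : (K n)%:R <= (t + n%:R) * n.+1%:R by rewrite truncn_le mulr_ge0// ltW.
    by rewrite (le_lt_trans h)// ltr_pM2r.
  rewrite (bigD1 (Ordinal KN))//= indicE mem_set// scale1r big1 ?addr0// => k kK.
  rewrite indicE memNset ?scale0r// => Dk; move/negP: kK; apply.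
  apply/eqP/val_inj => /=; have := KP n tn; move: Dk; rewrite /D /= !in_itv/= /c.
  have n0 : (0 : R) < n.+1%:R by [].
  rewrite !lerBlDr !ltrBrDr !ler_pdivrMr// !ltr_pdivlMr// => /andP[k1 k2] /andP[K1 K2].
  have := le_lt_trans k1 K2; have := le_lt_trans K1 k2.
  by rewrite !ltr_nat !ltnS => ? ?; apply/anti_leq/andP.
have cK : c n (K n) @[n --> \oo] --> t.
  apply/cvg_seqP => e e0.
  have [M MP] := (cvg_seqP _ _).1 (@cvg_harmonic R) e e0.
  exists (maxn M (Num.truncn `|t|).+1) => n; rewrite geq_max => /andP[/MP + nt].
  rewrite subr0 /harmonic/= ger0_norm// => /(le_trans _); apply.
  have /KP : `|t| < n%:R.
    by rewrite (lt_le_trans (truncnS_gt _))// ler_nat.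
  rewrite /D /= in_itv/= => /andP[c1 c2].
  rewrite ler0_norm ?subr_le0// opprB.
  move: c2; rewrite /c -[(K n).+1%:R]natr1 mulrDl mul1r.
  by move=> /ltW h; rewrite lerBlDr (le_trans h)// addrA (addrC _^-1).
apply/cvg_seqP => e e0.
have fcK : f (c n (K n)) @[n --> \oo] --> f t by exact: (continuous_cvg _ (cf t)).
have [M MP] := (cvg_seqP _ _).1 fcK e e0.
exists (maxn M (Num.truncn `|t|).+1) => n; rewrite geq_max => /andP[/MP + nt].
by rewrite stE// (lt_le_trans (truncnS_gt _))// ler_nat.
Qed.

Lemma sm_measurable (E : normedModType R) (f : T -> E) (phi : E -> R) :
  continuous phi -> strongly_measurable f -> measurable_fun setT (phi \o f).
Proof.
move=> cphi [f_ sf cf].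
apply/measurable_EFinP.
apply: (emeasurable_fun_cvg (fun n => EFin \o (phi \o f_ n))) => [n|t _].
  apply/measurable_EFinP => _ Y mY; rewrite setTI; apply: fsimple_preimage.
  exact: fsimple_comp (sf n).
apply: cvg_EFin; first by apply: nearW.
exact: (continuous_cvg _ (cphi _) (cf t)).
Qed.

Lemma sm_measurable_norm (E : normedModType R) (f : T -> E) :
  strongly_measurable f -> measurable_fun setT (fun t => `|f t|).
Proof. by apply: sm_measurable; exact: norm_continuous. Qed.

End StrongMeasurability.

(** * The Bochner integral through scalar pairings *)

Section Bochner.
Variables (R : realType) (H : hilbertType R).
Local Notation T := (measurableTypeR R).
Local Notation mu := (@lebesgue_measure R).
Local Notation integrable f := (mu.-integrable setT (EFin \o f)).
Implicit Types (f g s : T -> H).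

Definition bintegrable f : Prop :=
  strongly_measurable f /\ integrable (fun t => `|f t|).

Lemma integrable_le (g : T -> R) (h : T -> R) :
  measurable_fun setT g -> (forall t, `|g t| <= h t) -> integrable h ->
  integrable g.
Proof.
move=> mg gh ih; apply: le_integrable ih => //; first exact/measurable_EFinP.
move=> t _ /=; rewrite lee_fin (le_trans (gh t))// ler_norm//.
Qed.

Lemma bintegrable_le f (h : T -> R) :
  strongly_measurable f -> (forall t, `|f t| <= h t) -> integrable h ->
  bintegrable f.
Proof.
move=> mf fh ih; split => //; apply: integrable_le ih.
  exact: sm_measurable_norm.
by move=> t; rewrite normr_id.
Qed.

Lemma integrable_add (g h : T -> R) :
  integrable g -> integrable h -> integrable (g \+ h).
Proof. by move=> ig ih; exact: (integrableD measurableT ig ih). Qed.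

Lemma integrable_mulr (g : T -> R) (c : R) :
  integrable g -> integrable (fun t => g t * c).
Proof.
move=> ig; apply: eq_integrable (integrableZr measurableT c ig) => //.
Qed.

Lemma bintegrable_add f g : bintegrable f -> bintegrable g -> bintegrable (f \+ g).
Proof.
move=> [mf intf] [mg intg]; apply: (bintegrable_le _ _ (integrable_add intf intg)).
  exact: sm_add.
by move=> t; exact: ler_normD.
Qed.

Lemma bintegrable_scale (c : R) f : bintegrable f -> bintegrable (fun t => c *: f t).
Proof.
move=> [mf intf]; apply: (bintegrable_le _ _ (integrable_mulr `|c| intf)).
  exact: (sm_scale (sm_cst c)).
by move=> t; rewrite normrZ mulrC.
Qed.

Lemma bintegrable_sub f g : bintegrable f -> bintegrable g ->
  bintegrable (fun t => f t - g t).
Proof.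
move=> bf /(bintegrable_scale (-1)) /(bintegrable_add bf).
by congr bintegrable; apply/funext => t /=; rewrite scaleN1r.
Qed.

Lemma dotp_measurable f x : strongly_measurable f ->
  measurable_fun setT (fun t => dotp (f t) x).
Proof.
by apply: (@sm_measurable _ _ f (fun y => dotp y x)); apply: continuous_dotp => y;
  [exact: cvg_id|exact: cvg_cst].
Qed.

Lemma dotp_integrable f x : bintegrable f -> integrable (fun t => dotp (f t) x).
Proof.
move=> [mf intf]; apply: integrable_le (integrable_mulr `|x| intf).
  exact: dotp_measurable.
by move=> t; exact: cauchy_schwarz.
Qed.

Lemma le_int (g h : T -> R) : integrable g -> integrable h ->
  (forall t, g t <= h t) -> \int[mu]_t g t <= \int[mu]_t h t.
Proof. by move=> ig ih gh; apply: le_Rintegral. Qed.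

Lemma dotp_int_le f x : bintegrable f ->
  `|\int[mu]_t dotp (f t) x| <= (\int[mu]_t `|f t|) * `|x|.
Proof.
move=> bf; have idf := dotp_integrable x bf.
rewrite (le_trans (le_normr_Rintegral measurableT idf))//.
rewrite -RintegralZr//; last by case: bf.
apply: le_int; first exact: (integrable_norm idf).
  by apply: integrable_mulr; case: bf.
by move=> t; exact: cauchy_schwarz.
Qed.

(** Needed for the norm and for the pairing with a fixed vector. The condition [phi 0 = 0] discards
    the zero level set, whose measure may be infinite. *)
Lemma simple_integrable_comp s (phi : H -> R) :
  simple_integrable s -> phi 0 = 0 ->
  integrable (phi \o s) /\
  \int[mu]_t phi (s t) = \sum_(y \in range s) fine (mu (s @^-1` [set y])) * phi y.
Proof.
move=> [[fs ms] sfin] phi0.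
pose F y t : R := \1_(s @^-1` [set y]) t * phi y.
have iF y : integrable (F y).
  have [->|y0] := eqVneq y 0.
    apply: (eq_integrable _ (cst 0%E)) => //; last exact: integrable0.
    by move=> t _; rewrite /F /= phi0 mulr0.
  apply: integrable_mulr; apply/integrableP; split.
    by apply/measurable_EFinP; exact: measurable_indic.
  under eq_integral do rewrite /= ger0_norm//.
  by rewrite integral_indic// setIT; exact: sfin.
have intF y : \int[mu]_t F y t = fine (mu (s @^-1` [set y])) * phi y.
  have [y0|y0] := eqVneq y 0.
    rewrite y0 phi0 mulr0 /F phi0; under eq_Rintegral do rewrite mulr0.
    by rewrite Rintegral_cst// mul0r.
  rewrite /F RintegralZr//; last first.
    apply/integrableP; split.
      by apply/measurable_EFinP; exact: measurable_indic.
    under eq_integral do rewrite /= ger0_norm//.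
    by rewrite integral_indic// setIT; exact: sfin.
  by rewrite /Rintegral integral_indic// setIT.
have phisE t : phi (s t) = \sum_(y <- finmap.enum_fset (fset_set (range s))) F y t.
  rewrite (bigD1_seq (s t))/=; last first.
    - exact: finmap.fset_uniq.
    - by rewrite in_fset_set// mem_set//; exists t.
  rewrite big1_seq ?addr0; last first.
    move=> y /andP[yst _]; rewrite /F indicE memNset ?mul0r//= => sty.
    by rewrite sty eqxx in yst.
  by rewrite /F indicE mem_set ?mul1r.
split.
  apply: (eq_integrable _ (fun t => \sum_(y <- finmap.enum_fset (fset_set (range s))) (F y t)%:E)%E) => //.
    by move=> t _; rewrite /= phisE sumEFin.
  by apply: integrable_sum => // y _; exact: iF.
rewrite /Rintegral fsbig_finite//=.
under eq_integral do rewrite phisE -sumEFin.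
rewrite (integral_sum _ iF)//.
have iFE y : (\int[mu]_t (F y t)%:E = (fine (mu (s @^-1` [set y])) * phi y)%:E)%E.
  by rewrite -intF /Rintegral fineK//; exact: (integrable_fin_num measurableT (iF y)).
rewrite (eq_bigr _ (fun y _ => iFE y)).
by rewrite sumEFin.
Qed.

Lemma simple_bintegrable s : simple_integrable s -> bintegrable s.
Proof.
move=> hs; split; first by apply: sm_simple; case: hs.
by have [] := @simple_integrable_comp s (fun y => `|y|) hs (normr0 H).
Qed.

Lemma dotp_simple_integral s x : simple_integrable s ->
  dotp (simple_integral s) x = \int[mu]_t dotp (s t) x.
Proof.
move=> hs; have [_ ->] := @simple_integrable_comp s (fun y => dotp y x) hs (dotp0l x).
rewrite /simple_integral !fsbig_finite//; try by case: hs => [[]].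
rewrite (big_morph (dotp^~ x) (fun y z => dotpDl y z x) (dotp0l x)).
by apply: eq_bigr => y _; rewrite dotpZl.
Qed.

Lemma simple_integral_dist s s' : simple_integrable s -> simple_integrable s' ->
  `|simple_integral s - simple_integral s'| <= \int[mu]_t `|s t - s' t|.
Proof.
move=> hs hs'; have bs := simple_bintegrable hs; have bs' := simple_bintegrable hs'.
apply: norm_le_dotp; first by apply: Rintegral_ge0.
move=> x; rewrite dotpBl !dotp_simple_integral//.
rewrite -RintegralB//; try exact: dotp_integrable.
under eq_Rintegral do rewrite -dotpBl.
rewrite (le_trans (ler_norm _))//.
exact: (dotp_int_le x (bintegrable_sub bs bs')).
Qed.

(** The pairings determine [w], so the integral does not depend on the approximating sequence. *)
Lemma has_bochner_integral_dotp f w x : bintegrable f ->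
  has_bochner_integral f w -> \int[mu]_t dotp (f t) x = dotp w x.
Proof.
move=> bf [_ [s_ [ss sf sw]]].
have sxw : dotp (simple_integral (s_ n)) x @[n --> \oo] --> dotp w x.
  by apply: cvg_dotp => //; exact: cvg_cst.
apply: (cvg_unique _ _ sxw) => //.
have [_ {}sf] := (fine_cvgP _ _).1 sf.
apply/cvg_seqP => e e0.
have x0 : 0 < `|x| + 1 by rewrite ltr_wpDl.
have e'0 : 0 < e / (`|x| + 1) by rewrite divr_gt0.
have [N NP] := (cvg_seqP _ _).1 sf _ e'0.
exists N => n /NP; rewrite subr0 /= => h.
have bs := simple_bintegrable (ss n).
rewrite dotp_simple_integral// distrC -RintegralB//; try exact: dotp_integrable.
under eq_Rintegral do rewrite -dotpBl.
rewrite (le_trans (dotp_int_le x (bintegrable_sub bf bs)))//.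
apply: (@le_trans _ _ (e / (`|x| + 1) * (`|x| + 1))); last by rewrite divfK ?gt_eqF.
apply: ler_pM => //; first exact: Rintegral_ge0.
  exact: le_trans (ler_norm _) h.
by rewrite lerDl.
Qed.

(* The strongly measurable approximants are cut off where they exceed [2 |f|],
   which makes them integrable and dominated by [3 |f|]. *)
Lemma has_bochner_integral_ex f : bintegrable f -> exists w, has_bochner_integral f w.
Proof.
move=> bf; have [mf intf] := bf; have [g_ sg gf] := mf.
pose b n t := `|g_ n t| <= 2 * `|f t|.
have mb n : measurable_fun setT (b n).
  apply: measurable_fun_ler; first by apply: sm_measurable_norm; exact: sm_simple.
  by apply: measurable_funM => //; exact: sm_measurable_norm.
have sb n : fsimple (b n).
  split; first by apply: (@sub_finite_set _ _ setT) => //; exact: finite_finset.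
  by move=> x; rewrite -[X in measurable X]setTI; exact: mb.
pose s_ n t := if b n t then g_ n t else 0.
have s_le n t : `|s_ n t| <= 2 * `|f t| by rewrite /s_ /b; case: ifP => // _; rewrite normr0 mulr_ge0.
have ss n : simple_fun (s_ n).
  by have := fsimple_comp (fun p => if p.1 then p.2 else 0) (fsimple_pair (sb n) (sg n)).
have i2f : integrable (fun t => 2 * `|f t|).
  by under eq_fun do rewrite mulrC; exact: integrable_mulr.
have bs n : bintegrable (s_ n) by apply: bintegrable_le i2f => //; exact: sm_simple.
have si n : simple_integrable (s_ n).
  split => // x x0; rewrite ltey_eq; apply/orP; left.
  have mE : measurable (s_ n @^-1` [set x]) by case: (ss n).
  (* Chebyshev: on the level set of [x] the function [|s_n| / |x|] equals [1]. *)
  have : integrable (fun t => \1_(s_ n @^-1` [set x]) t : R).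
    apply: integrable_le (integrable_mulr `|x|^-1 (bs n).2).
      exact: measurable_indic.
    move=> t; rewrite indicE; case: (boolP (t \in _)) => [/set_mem /= ->|_].
      by rewrite normr1 divff// normr_eq0.
    by rewrite normr0 mulr_ge0.
  by move=> /(integrable_fin_num measurableT); rewrite integral_indic// setIT.
(* Where [f t = 0] the cutoff forces [s_ n t = 0]. Elsewhere it becomes inactive as soon as
   [|g_ n t - f t| <= |f t|]. *)
have s_f t : s_ n t @[n --> \oo] --> f t.
  have [f0|f0] := eqVneq (f t) 0.
    rewrite f0; apply/cvg_seqP => e e0; exists 0%N => n _.
    rewrite subr0; have := s_le n t; rewrite f0 normr0 mulr0 => h.
    by rewrite (le_trans h)// ltW.
  apply/cvg_seqP => e e0.
  have nf0 : 0 < `|f t| by rewrite normr_gt0.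
  have me : 0 < Num.min e `|f t| by rewrite lt_min e0.
  have [N NP] := (cvg_seqP _ _).1 (gf t) _ me.
  exists N => n /NP; rewrite le_min => /andP[ge gf'].
  rewrite /s_ /b ifT//.
  rewrite -[g_ n t](subrK (f t)) (le_trans (ler_normD _ _))//.
  by rewrite mulr2n mulrDl mul1r lerD.
have sub_cvg : (\int[mu]_t `|f t - s_ n t|%:E)%E @[n --> \oo] --> 0%E.
  have i3f : integrable (fun t => `|f t| + 2 * `|f t|) by exact: integrable_add.
  have [|||||_ _] := @dominated_convergence _ _ _ mu setT measurableT
     (fun n t => `|f t - s_ n t|%:E) (cst 0%E) (fun t => (`|f t| + 2 * `|f t|)%:E).
  - move=> n; apply/measurable_EFinP; apply: sm_measurable_norm.
    by case: (bintegrable_sub bf (bs n)).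
  - exact: measurable_cst.
  - apply: aeW => t _; apply: cvg_EFin; first by apply: nearW.
    apply/norm_cvg0P; rewrite -(subrr (f t)); apply: cvgB; first exact: cvg_cst.
    exact: s_f.
  - exact: i3f.
  - apply: aeW => t n _ /=; rewrite lee_fin normr_id.
    by rewrite (le_trans (ler_normB _ _))// lerD2l.
  by rewrite integral0.
have [_ rsub_cvg] := (fine_cvgP _ _).1 sub_cvg.
have [w sw] : exists w : H, simple_integral (s_ n) @[n --> \oo] --> w.
  apply: cauchy_seq_cvg => e e0.
  have e2 : 0 < e / 2 by rewrite divr_gt0.
  have [N NP] := (cvg_seqP _ _).1 rsub_cvg _ e2.
  exists N => n m /NP + /NP; rewrite !subr0 /= => hn hm.
  rewrite (le_trans (simple_integral_dist _ _))//.
  have i1 n' := (bintegrable_sub bf (bs n')).2.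
  apply: (@le_trans _ _ (\int[mu]_t (`|f t - s_ n t| + `|f t - s_ m t|))).
    apply: le_int => [||t]; first by case: (bintegrable_sub (bs n) (bs m)).
      exact: integrable_add.
    by rewrite -(subrKA (f t)) (le_trans (ler_normD _ _))// (distrC (s_ n t)).
  rewrite RintegralD// [e]splitr lerD//.
    exact: le_trans (ler_norm _) hn.
  exact: le_trans (ler_norm _) hm.
by exists w; split => //; exists s_.
Qed.

(** The working characterization of [bochner], valid only for integrable [f] because [bochner] is
    total with default [0]. *)
Lemma dotp_bochner f x : bintegrable f ->
  dotp (bochner f) x = \int[mu]_t dotp (f t) x.
Proof.
move=> bf; rewrite /bochner; case: xgetP => [w _ fw|]; last first.
  by have [w fw] := has_bochner_integral_ex bf => /(_ w).
by rewrite (has_bochner_integral_dotp _ bf fw).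
Qed.

Lemma bochner_norm_le f : bintegrable f -> `|bochner f| <= \int[mu]_t `|f t|.
Proof.
move=> bf; apply: norm_le_dotp; first by apply: Rintegral_ge0.
move=> x; rewrite dotp_bochner// (le_trans (ler_norm _))//.
exact: dotp_int_le.
Qed.

End Bochner.

(** * Vector-valued calculus *)

Section Derivatives.
Variables (R : realType) (E : normedModType R).
Implicit Types (w : R -> E) (d : E) (t : R).

(** A form without division, in which [h = 0] is allowed; the estimates of vector-valued derivatives
    are made in it. *)
Lemma is_derive_epsP w t d :
  is_derive t 1 w d <->
  forall e : R, 0 < e -> exists2 del : R, 0 < del &
    forall h, `|h| <= del -> `|w (t + h) - w t - h *: d| <= e * `|h|.
Proof.
split=> [[dw <-] e e0|H].
  have /cvgrPdist_le /(_ e e0) : h^-1 *: ((w \o shift t) (h *: 1) - w t) @[h --> 0^'] --> 'D_1 w t by exact: dw.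
  move=> [del /= del0 delP]; exists (del / 2); first by rewrite divr_gt0.
  move=> h hdel; have [->|h0] := eqVneq h 0.
    by rewrite addr0 subrr scale0r subrr !normr0 mulr0.
  have := delP h; rewrite /= sub0r normrN => /(_ _ h0).
  have hd : `|h| < del by rewrite (le_lt_trans hdel)// ltr_pdivrMr// ltr_pMr// ltr1n.
  move=> /(_ hd); rewrite /shift /= scaler1 [h + t]addrC.
  rewrite -(@ler_pM2r _ `|h|) ?normr_gt0// => /(le_trans _); apply.
  rewrite mulrC -normrZ (scalerBr h) scalerA divff// scale1r.
  by rewrite distrC.
have cw : h^-1 *: ((w \o shift t) (h *: 1) - w t) @[h --> 0^'] --> d.
  apply/cvgrPdist_le => e e0; have [del del0 delP] := H e e0.
  exists del => //= h; rewrite /= sub0r normrN => hdel h0.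
  rewrite scaler1 -(@ler_pM2l _ `|h|) ?normr_gt0//.
  rewrite -normrZ (scalerBr h) scalerA divff// scale1r mulrC.
  by rewrite distrC /shift/= [h + t]addrC; apply: delP; exact: ltW.
apply: DeriveDef; first by apply/cvg_ex; exists d.
exact/cvg_lim.
Qed.

Lemma is_derive_continuous w t d : is_derive t 1 w d -> {for t, continuous w}.
Proof. by move=> dw; apply/differentiable_continuous/derivable1_diffP; case: dw. Qed.

Lemma is_derive1E w t d : is_derive t 1 w d -> derive1 w t = d.
Proof. by move=> [_ <-]; rewrite derive1E. Qed.

Lemma is_derive_local w w' t d (e : R) : 0 < e ->
  (forall s, `|s - t| <= e -> w s = w' s) -> is_derive t 1 w d -> is_derive t 1 w' d.
Proof.
move=> e0 ww' /is_derive_epsP H; apply/is_derive_epsP => eps /H[del del0 delP].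
exists (Num.min del e); first by rewrite lt_min del0.
move=> h; rewrite le_min => /andP[/delP hd he].
by rewrite -!ww' ?subrr ?normr0 ?(ltW e0)// addrAC subrr add0r.
Qed.

End Derivatives.

Section RealCalculus.
Variable R : realType.

Lemma derive_nonpos_le (f df : R -> R) (a b : R) : a <= b ->
  (forall x, a <= x <= b -> is_derive x 1 f (df x)) ->
  (forall x, a <= x <= b -> df x <= 0) -> f b <= f a.
Proof.
rewrite le_eqVlt => /predU1P[->//|ab] dfx df0.
have [||c] := @MVT R f df a b ab.
- by move=> x /[!in_itv]/= /andP[ax xb]; apply: dfx; rewrite !ltW.
- apply: derivable_within_continuous => x /[!in_itv]/= /dfx dx; exact: ex_derive.
rewrite in_itv/= => /andP[ac cb] fE.
by rewrite -subr_le0 fE mulr_le0_ge0 ?subr_ge0 ?(ltW ab)// df0// !ltW.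
Qed.

Lemma derive_le_le (f df g dg : R -> R) (a b : R) : a <= b ->
  (forall x, a <= x <= b -> is_derive x 1 f (df x)) ->
  (forall x, a <= x <= b -> is_derive x 1 g (dg x)) ->
  (forall x, a <= x <= b -> df x <= dg x) -> f b - f a <= g b - g a.
Proof.
move=> ab dfx dgx dfg.
suff : (f - g) b <= (f - g) a by rewrite /= !fctE; lra.
apply: (@derive_nonpos_le _ (fun x => df x - dg x)) => // x axb.
  by apply: is_deriveB; [exact: dfx|exact: dgx].
by rewrite subr_le0 dfg.
Qed.

End RealCalculus.

Section WeakDerivatives.
Variables (R : realType) (H : hilbertType R).
Implicit Types (w F : R -> H).

Lemma is_derive_dotpl w (t : R) d x :
  is_derive t 1 w d -> is_derive t 1 (fun s => dotp (w s) x) (dotp d x).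
Proof.
move=> /is_derive_epsP dw; apply/is_derive_epsP => e e0.
have x0 : 0 < `|x| + 1 by rewrite ltr_wpDl.
have [del del0 delP] := dw (e / (`|x| + 1)) (divr_gt0 e0 x0).
exists del => // h /delP hd.
have -> : dotp (w (t + h)) x - dotp (w t) x - h *: dotp d x =
  dotp (w (t + h) - w t - h *: d) x by rewrite !dotpBl dotpZl.
rewrite (le_trans (cauchy_schwarz _ _))//.
apply: (le_trans (ler_wpM2r _ hd)) => //.
rewrite mulrAC ler_wpM2r// -mulrA ler_piMr ?ltW//.
by rewrite mulrC ltr_pdivrMr// mul1r ltrDl.
Qed.

(** For a fixed [x] this is the comparison of two real derivatives. As the majorant [h] does not
    depend on [x] apart from the factor [|x|], the bound passes to the norm. *)
Lemma weak_mvi w F (h dh : R -> R) (a b : R) : a <= b ->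
  (forall x (t : R), a <= t <= b -> is_derive t 1 (fun s => dotp (w s) x) (dotp (F t) x)) ->
  (forall t : R, a <= t <= b -> is_derive t 1 h (dh t)) ->
  (forall t, a <= t <= b -> `|F t| <= dh t) ->
  `|w b - w a| <= h b - h a.
Proof.
move=> ab dw dh' Fh; apply: norm_le_dotp => [|x].
  have := @derive_le_le R (fun=> 0) (fun=> 0) h dh a b ab.
  rewrite subrr; apply => // t /Fh; exact: le_trans.
rewrite dotpBl mulrBl.
apply: (@derive_le_le R (fun s => dotp (w s) x) (fun s => dotp (F s) x)
  (fun s => h s * `|x|) (fun s => dh s * `|x|) a b ab (dw x)).
- move=> t /dh' dht; have := is_deriveM dht (is_derive_cst `|x| t 1).
  by rewrite scaler0 add0r => /is_derive_eq; apply; rewrite mulrC.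
- by move=> t /Fh Ft; rewrite (le_trans (dotp_le _ _))// ler_wpM2r.
Qed.

(** The mean value inequality for [s |-> w s - s d] against [e s], with both signs of [h]. *)
Lemma weak_increment w F (t h : R) (d : H) (e : R) :
  (forall x (s : R), is_derive s 1 (fun r => dotp (w r) x) (dotp (F s) x)) ->
  (forall s, `|s - t| <= `|h| -> `|F s - d| <= e) ->
  `|w (t + h) - w t - h *: d| <= e * `|h|.
Proof.
move=> dw Fd.
pose v s := w s - s *: d.
have dv x (s : R) : is_derive s 1 (fun r => dotp (v r) x) (dotp (F s - d) x).
  have -> : (fun r => dotp (v r) x) = (fun r => dotp (w r) x) - (fun r => r * dotp d x).
    by apply/funext => r; rewrite !fctE /v dotpBl dotpZl.
  rewrite dotpBl; apply: is_deriveB.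
  have := is_deriveM (is_derive_id s (1 : R)) (is_derive_cst (dotp d x) s 1).
  by rewrite scaler0 add0r => /is_derive_eq; apply; rewrite /= -[RHS]mulr1.
have dl (s : R) : is_derive s 1 (fun r => e * r) e.
  have := is_deriveM (is_derive_cst e s 1) (is_derive_id s (1 : R)).
  by rewrite scaler0 addr0 => /is_derive_eq; apply; rewrite /= -[RHS]mulr1.
have -> : w (t + h) - w t - h *: d = v (t + h) - v t.
  rewrite /v scalerDl [RHS]addrAC opprB [t *: d - w t]addrC [in RHS]addrA.
  by rewrite opprD [RHS]addrA addrK.
have [h0|h0] := leP 0 h.
  have -> : e * `|h| = e * (t + h) - e * t by rewrite ger0_norm//; ring.
  apply: (@weak_mvi v (fun s => F s - d) _ (fun=> e)) => //; first by rewrite lerDl.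
  move=> s /andP[ts sth]; apply: Fd.
  by rewrite ger0_norm ?subr_ge0// ger0_norm// lerBlDl.
have -> : e * `|h| = e * t - e * (t + h) by rewrite ltr0_norm//; ring.
rewrite distrC; apply: (@weak_mvi v (fun s => F s - d) _ (fun=> e)) => //.
  by rewrite gerDl ltW.
move=> s /andP[ths st]; apply: Fd.
rewrite distrC ger0_norm ?subr_ge0// ltr0_norm//.
by rewrite lerBlDl -lerBlDr opprK.
Qed.

(** Continuity of [F] in norm makes the increments small uniformly over the test vectors, which
    upgrades scalar derivatives to a norm derivative. *)
Lemma weak_is_derive w F : continuous F ->
  (forall x (t : R), is_derive t 1 (fun s => dotp (w s) x) (dotp (F t) x)) ->
  forall t : R, is_derive t 1 w (F t).
Proof.
move=> cF dw t; apply/is_derive_epsP => e e0.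
have /cvgrPdist_le /(_ e e0)[del /= del0 delP] := cF t.
exists (del / 2); first by rewrite divr_gt0.
move=> h hdel; apply: weak_increment dw _ => s st.
rewrite distrC; apply: delP => /=; rewrite distrC (le_lt_trans st)//.
by rewrite (le_lt_trans hdel)// ltr_pdivrMr// ltr_pMr// ltr1n.
Qed.

Lemma is_derive0_eq w (b : R) : (forall t : R, is_derive t 1 w 0) ->
  w b = 0 -> forall t, w t = 0.
Proof.
move=> dw wb t.
have aux s r : s <= r -> w r = w s.
  move=> sr; apply/subr0_eq/eqP; rewrite -normr_le0 -(subrr (0 : R)).
  apply: (@weak_mvi w (fun=> 0) (fun=> 0) (fun=> 0)) => //.
    by move=> x q _; exact: is_derive_dotpl.
  by move=> q _; rewrite normr0.
by have [/aux <-//|/ltW/aux->] := leP t b.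
Qed.

End WeakDerivatives.

(** * Continuous functions vanishing before a given time, and locally uniform convergence *)

Section Compactness.
Variables (R : realType) (E : normedModType R).
Implicit Types (F G : R -> E) (a b T : R).

(** Only [s] is confined to [[a, T]], so that [t] may leave the interval. The modulus is the
    parameter tending to [0] in the near-covering form of compactness. *)
Lemma heine F a T (e : R) : continuous F -> 0 < e ->
  exists2 del : R, 0 < del &
    forall s t, a <= s <= T -> `|t - s| <= del -> `|F t - F s| <= e.
Proof.
move=> cF e0.
pose P (d s : R) := forall t, `|t - s| <= `|d| -> `|F t - F s| <= e.
have /compact_near_coveringP /(_ _ (nbhs (0 : R)) P _) := @segment_compact R a T.
case.
  move=> s _; have /cvgrPdist_le /(_ _ (divr_gt0 e0 (ltr0Sn R 1)))[del /= del0 delP] := cF s.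
  have d2 : 0 < del / 2 by rewrite divr_gt0.
  exists (ball s (del / 2), ball 0 (del / 2)) => /=.
    by split; apply: nbhsx_ballx.
  move=> [s' d] /=; rewrite -!ball_normE /= sub0r normrN => -[ss' dd] t ts'.
  have F1 : `|F s - F s'| <= e / 2.
    by apply: delP => /=; rewrite (lt_le_trans ss')// ler_pdivrMr// ler_pMr// ler1n.
  have F2 : `|F s - F t| <= e / 2.
    apply: delP => /=; rewrite -(subrKA s') (le_lt_trans (ler_normD _ _))//.
    by rewrite [del]splitr ltrD// distrC (le_lt_trans ts').
  by rewrite -(subrKA (F s)) (le_trans (ler_normD _ _))// [e]splitr lerD// distrC.
move=> del /= del0 delP; exists (del / 2); first by rewrite divr_gt0.
move=> s t sT ts; apply: (delP (del / 2)).
- rewrite /= sub0r normrN gtr0_norm ?divr_gt0//.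
  by rewrite ltr_pdivrMr// ltr_pMr// ltr1n.
- by rewrite /= in_itv.
- by rewrite (@gtr0_norm _ (del / 2)) ?divr_gt0.
Qed.

Lemma continuous_bounded F a T : continuous F ->
  exists2 M : R, 0 <= M & forall t, a <= t <= T -> `|F t| <= M.
Proof.
move=> cF; have [aT|Ta] := leP a T; last first.
  by exists 0 => // t /andP[at_ tT]; move: (le_trans at_ tT); rewrite leNgt Ta.
have [|c _ cP] := @EVT_max R (fun t => `|F t|) a T aT.
  by apply: continuous_subspaceT => t; apply: cvg_norm; exact: cF.
by exists `|F c| => // t tT; apply: cP; rewrite in_itv.
Qed.

(** The starting time is kept explicit: it fixes where primitives begin and reduces estimates on
    half-lines to compact intervals. *)
Definition ccont b F : Prop := continuous F /\ forall t, t <= b -> F t = 0.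

Lemma ccont_bounded b F T : ccont b F ->
  exists2 M : R, 0 <= M & forall t, t <= T -> `|F t| <= M.
Proof.
move=> [cF F0]; have [M M0 MP] := continuous_bounded b T cF.
exists M => // t tT; have [/F0->|/ltW bt] := leP t b; first by rewrite normr0.
by rewrite MP// bt.
Qed.

Lemma ccont_heine b F T (e : R) : ccont b F -> 0 < e ->
  exists2 del : R, 0 < del &
    forall s t, s <= T -> `|t - s| <= del -> `|F t - F s| <= e.
Proof.
move=> [cF F0] e0; have [del del0 delP] := heine (b - 1) T cF e0.
(* With the step at most [1], a point [s < b - 1] forces [t <= b], where both values vanish. *)
exists (Num.min del 1); first by rewrite lt_min del0 ltr01.
move=> s t sT; rewrite le_min => /andP[tsd ts1].
have [bs|sb] := leP (b - 1) s; first by apply: delP => //; rewrite bs.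
have s0 : s <= b by move: sb; lra.
have t0 : t <= b.
  by move: ts1; rewrite ler_norml => /andP[_]; move: sb; lra.
by rewrite !F0// subrr normr0 ltW.
Qed.

Lemma ccont_le b b' F : b' <= b -> ccont b F -> ccont b' F.
Proof. by move=> bb [cF F0]; split => // t tb; apply: F0; exact: le_trans bb. Qed.

Lemma ccont_add b F G : ccont b F -> ccont b G -> ccont b (fun t => F t + G t).
Proof.
move=> [cF F0] [cG G0]; split => [t|t tb]; last by rewrite F0// G0// addr0.
by apply: cvgD; [exact: cF|exact: cG].
Qed.

Lemma ccont_scale b F (c : R) : ccont b F -> ccont b (fun t => c *: F t).
Proof.
move=> [cF F0]; split => [t|t tb]; last by rewrite F0// scaler0.
by apply: cvgZ; [exact: cvg_cst|exact: cF].
Qed.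

Lemma ccont_opp b F : ccont b F -> ccont b (fun t => - F t).
Proof.
move=> /(ccont_scale (-1)); congr ccont.
by apply/funext => t; rewrite scaleN1r.
Qed.

Lemma ccont_sub b F G : ccont b F -> ccont b G -> ccont b (fun t => F t - G t).
Proof. by move=> hF /ccont_opp; exact: ccont_add. Qed.

Lemma ccont0 b : ccont b (fun=> 0 : E).
Proof. by split => // t; exact: cvg_cst. Qed.

Lemma ccont_bop b F (B : bop E) : ccont b F -> ccont b (fun t => B (F t)).
Proof.
move=> [cF F0]; split => [t|t tb]; last by rewrite F0// linear0.
by apply: (@cvg_bop _ _ _ _ _ (fun=> B)); [exact: cvg_cst|exact: cF].
Qed.

Lemma ccont_shift b F (k : R) : ccont b F -> ccont (b - k) (fun t => F (t + k)).
Proof.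
move=> [cF F0]; split=> [t|t tb]; last by rewrite F0// -lerBrDr.
apply: (@continuous_comp _ _ _ (fun t => t + k) F); last exact: cF.
by apply: cvgD; [exact: cvg_id|exact: cvg_cst].
Qed.

(** Uniformity reaches back to [-oo], as required for passing to the limit in a convolution that
    sees the whole past. *)
Definition luconv (F_ : nat -> R -> E) F : Prop := forall T (e : R), 0 < e ->
  exists N, forall n, (N <= n)%N -> forall t, t <= T -> `|F_ n t - F t| <= e.

Definition lucauchy (F_ : nat -> R -> E) : Prop := forall T (e : R), 0 < e ->
  exists N, forall n m, (N <= n)%N -> (N <= m)%N ->
    forall t, t <= T -> `|F_ n t - F_ m t| <= e.

Lemma luconv_cvg (F_ : nat -> R -> E) F t : luconv F_ F -> F_ n t @[n --> \oo] --> F t.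
Proof.
move=> FF; apply/cvg_seqP => e e0; have [N NP] := FF t e e0.
by exists N => n Nn; exact: NP.
Qed.

Lemma luconv_cst F : luconv (fun=> F) F.
Proof. by move=> T e e0; exists 0%N => n _ t _; rewrite subrr normr0 ltW. Qed.

Lemma luconv_add (F_ : nat -> R -> E) F (G_ : nat -> R -> E) G : luconv F_ F -> luconv G_ G ->
  luconv (fun n t => F_ n t + G_ n t) (fun t => F t + G t).
Proof.
move=> FF GG T e e0; have e2 : 0 < e / 2 by rewrite divr_gt0.
have [N NP] := FF T _ e2; have [M MP] := GG T _ e2.
exists (maxn N M) => n; rewrite geq_max => /andP[Nn Mn] t tT.
rewrite opprD addrACA (le_trans (ler_normD _ _))// [e]splitr.
by rewrite lerD ?NP ?MP.
Qed.

Lemma luconv_bop (F_ : nat -> R -> E) F (B : bop E) : luconv F_ F ->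
  luconv (fun n t => B (F_ n t)) (fun t => B (F t)).
Proof.
move=> FF T e e0.
have B0 : 0 < `|B| + 1 by rewrite ltr_wpDl.
have [N NP] := FF T _ (divr_gt0 e0 B0).
exists N => n Nn t tT; rewrite -linearB /= (le_trans (bop_le _ _))//.
have := NP n Nn t tT; rewrite ler_pdivlMr// mulrC => /(le_trans _); apply.
by rewrite ler_wpM2r// lerDl.
Qed.

Lemma luconv_opp (F_ : nat -> R -> E) F : luconv F_ F -> luconv (fun n t => - F_ n t) (fun t => - F t).
Proof.
move=> FF T e e0; have [N NP] := FF T _ e0.
by exists N => n Nn t tT; rewrite -opprD normrN NP.
Qed.

Lemma luconv_ccont b (F_ : nat -> R -> E) F : (forall n, ccont b (F_ n)) -> luconv F_ F -> ccont b F.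
Proof.
move=> cF FF; split=> [t|t tb]; last first.
  have F0 : F_ n t @[n --> \oo] --> (0 : E).
    by under eq_fun do rewrite (cF _).2//; exact: cvg_cst.
  exact: (cvg_unique _ (luconv_cvg (t := t) FF) F0).
apply/cvgrPdist_le => e e0; have e3 : 0 < e / 3 by rewrite divr_gt0.
have [N /(_ N (leqnn N)) NP] := FF (t + 1) _ e3.
have /cvgrPdist_le /(_ _ e3) Ft := (cF N).1 t.
near=> s.
have s1 : s <= t + 1.
  have : `|t - s| <= 1 by near: s; exact: (cvgr_dist_le _ _ (@cvg_id _ (nbhs t))).
  by rewrite ler_norml => /andP[+ _]; rewrite lerBrDr; lra.
have h1 := NP s s1; have h2 : `|F_ N t - F t| <= e / 3 by rewrite NP// lerDl.
have h3 : `|F_ N t - F_ N s| <= e / 3 by near: s; exact: Ft.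
rewrite -(subrKA (F_ N t)) (le_trans (ler_normD _ _))//.
rewrite (le_trans (lerD (_ : _ <= e / 3) (_ : _ <= e / 3 + e / 3)))//.
- by rewrite distrC.
- by rewrite -(subrKA (F_ N s)) (le_trans (ler_normD _ _))// lerD.
- by rewrite le_eqVlt; apply/orP; left; apply/eqP; field.
Unshelve. all: by end_near. Qed.

End Compactness.

Lemma lucauchy_conv (R : realType) (E : completeNormedModType R)
    (F_ : nat -> R -> E) : lucauchy F_ -> exists F, luconv F_ F.
Proof.
move=> cF.
have limF t : exists l : E, F_ n t @[n --> \oo] --> l.
  apply: cauchy_seq_cvg => e e0; have [N NP] := cF t e e0.
  by exists N => n m Nn Nm; exact: NP.
have [F FP] := choice limF; exists F => T e e0.
have [N NP] := cF T e e0; exists N => n Nn t tT.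
have c : `|F_ n t - F_ m t| @[m --> \oo] --> `|F_ n t - F t|.
  by apply: cvg_norm; apply: cvgB; [exact: cvg_cst|exact: FP].
apply: (ler_cvg_to c (@cvg_cst _ e _ \oo _)); exists N => // m Nm; exact: NP.
Qed.

(** * Primitives and convolutions *)

Section Reflection.
Variable R : realType.
Local Notation T := (measurableTypeR R).
Local Notation mu := (@lebesgue_measure R).
Local Notation integrable f := (mu.-integrable setT (EFin \o f)).

Definition reflect_at (t : R) (s : T) : T := t - s.

Lemma measurable_reflect (t : R) : measurable_fun setT (reflect_at t).
Proof. by apply: measurable_funB => //; exact: measurable_cst. Qed.

HB.instance Definition _ (t : R) :=
  isMeasurableFun.Build _ _ _ _ (reflect_at t) (measurable_reflect t).

(** By uniqueness of Lebesgue measure it suffices to compare half-open intervals; the reflection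
    exchanges their open and closed ends. *)
Lemma reflect_measure (t : R) (A : set T) : measurable A ->
  mu A = pushforward mu (reflect_at t) A.
Proof.
apply: (@lebesgue_measure_unique R (pushforward mu (reflect_at t))).
move=> X [[a b] _ <-] /=; rewrite /pushforward.
have -> : reflect_at t @^-1` `]a, b] = `[t - b, t - a[%classic.
  by apply/seteqP; split=> s /=; rewrite !in_itv/= /reflect_at => /andP[h1 h2];
    apply/andP; split; move: h1 h2; lra.
rewrite !lebesgue_measure_itv/= !lte_fin ltrD2l ltrN2.
by case: ifP => // _; rewrite -!EFinB; congr (_%:E); ring.
Qed.

Lemma reflect_integral (g : T -> \bar R) (t : R) :
  measurable_fun setT g -> (forall s, (0 <= g s)%E) ->
  (\int[mu]_s g (t - s)%R = \int[mu]_s g s)%E.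
Proof.
move=> mg g0.
have := @ge0_integral_pushforward _ _ T T R (reflect_at t) (measurable_reflect t) mu setT g
  measurableT mg (fun y _ => g0 y).
rewrite preimage_setT => <-.
apply: eq_measure_integral => A mA _; exact/esym/reflect_measure.
Qed.

Lemma reflect_integrable (g : T -> R) (t : R) :
  integrable g -> integrable (fun s => g (t - s)).
Proof.
move=> /integrableP[/measurable_EFinP mg fg]; apply/integrableP; split.
  apply/measurable_EFinP; exact: (measurableT_comp mg (measurable_reflect t)).
rewrite (@reflect_integral (fun s => `|(g s)%:E|%E) t)//.
by apply: measurableT_comp => //; exact/measurable_EFinP.
Qed.

Lemma reflect_Rintegral (g : T -> R) (t : R) :
  integrable g -> \int[mu]_s g (t - s) = \int[mu]_s g s.
Proof.
move=> ig; have irg := reflect_integrable t ig.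
move: (ig) => /integrableP[mg _].
rewrite /Rintegral; congr fine.
have := @integral_pushforward _ _ T T R (reflect_at t) (measurable_reflect t) mu setT (EFin \o g) mg.
rewrite preimage_setT => /(_ irg measurableT) <-.
apply: eq_measure_integral => A mA _; exact/esym/reflect_measure.
Qed.

End Reflection.

(** * Primitives of functions vanishing before time [b] *)

Section Primitive.
Variables (R : realType) (H : hilbertType R).
Local Notation T := (measurableTypeR R).
Local Notation mu := (@lebesgue_measure R).
Local Notation integrable f := (mu.-integrable setT (EFin \o f)).
Implicit Types (F G : R -> H) (b t : R).

Lemma Rintegral_eq0 (D : set T) (g : T -> R) :
  (forall s, D s -> g s = 0) -> \int[mu]_(s in D) g s = 0.
Proof.
move=> g0; rewrite /Rintegral integral0_eq// => s /g0 ->//.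
Qed.

(** The integral starts at [b - 1] in order to place [t = b] in the interior, where the fundamental
    theorem applies. For [ccont b] functions the extra piece contributes nothing. *)
Definition primitive b F t : H :=
  bochner (fun s => \1_(`[b - 1, t] : set R) s *: F s).

Lemma bintegrable_itv (F : R -> H) (a t : R) : continuous F ->
  bintegrable (fun s : T => \1_(`[a, t] : set R) s *: F s).
Proof.
move=> cF; have [M M0 MF] := continuous_bounded a t cF.
have h : integrable (fun s => \1_(`[a, t] : set R) s * M).
  by apply: integrable_mulr; exact: integrable_indic_itv.
apply: bintegrable_le h; first by apply: sm_scale; [exact: sm_indic|exact: sm_continuous].
move=> s; rewrite normrZ indicE; case: (boolP (s \in _)) => [|_]; last by rewrite normr0 !mul0r.
by rewrite inE /= in_itv/= normr1 !mul1r => /MF.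
Qed.

Lemma dotp_primitive b F t x : continuous F ->
  dotp (primitive b F t) x = \int[mu]_(s in `[b - 1, t]) dotp (F s) x.
Proof.
move=> cF; rewrite dotp_bochner; last exact: bintegrable_itv.
rewrite [RHS]Rintegral_mkcond; apply: eq_Rintegral => s _.
by rewrite dotpZl patchE indicE; case: ifP => _; rewrite ?mul1r ?mul0r.
Qed.

Lemma is_derive_primitive b F : ccont b F ->
  forall t : R, is_derive t 1 (primitive b F) (F t).
Proof.
move=> [cF F0]; apply: weak_is_derive => // x t.
have cFx : continuous (fun s => dotp (F s) x).
  by apply: continuous_dotp => // ?; exact: cvg_cst.
have [tb|bt] := ltP t b.
  have e0 : 0 < b - t by rewrite subr_gt0.
  rewrite F0 ?(ltW tb)// dotp0l.
  apply: (is_derive_local (w := cst (0 : R)) e0).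
  move=> s st; rewrite dotp_primitive// Rintegral_eq0// => r /=.
  rewrite in_itv/= => /andP[_ rs].
  rewrite F0 ?dotp0l// (le_trans rs)//.
  by move: st; rewrite ler_norml => /andP[_]; lra.
have -> : (fun s => dotp (primitive b F s) x) =
    (fun s => \int[mu]_(r in `[b - 1, s]) dotp (F r) x).
  by apply/funext => s; rewrite dotp_primitive.
have := @continuous_FTC1 R (fun s => dotp (F s) x) (BLeft (b - 1)) t (t + 1).
move=> /(_ (ltr_pwDr ltr01 (lexx t))); case.
- apply: continuous_compact_integrable; first exact: segment_compact.
  exact: continuous_subspaceT.
- by rewrite /= lte_fin; move: bt; lra.
- exact: cFx.
- by move=> d1 d2; apply: DeriveDef; [exact: d1|rewrite -derive1E; exact: d2].
Qed.

Lemma primitive0 b F t : ccont b F -> t <= b -> primitive b F t = 0.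
Proof.
move=> [cF F0] tb; apply: dotp_inj => x; rewrite dotp_primitive// dotp0l.
rewrite Rintegral_eq0// => s /=.
by rewrite in_itv/= => /andP[_ st]; rewrite F0 ?dotp0l// (le_trans st).
Qed.

Lemma ccont_primitive b F : ccont b F -> ccont b (primitive b F).
Proof.
move=> hF; split=> t; last exact: primitive0.
exact: is_derive_continuous (is_derive_primitive hF t).
Qed.

(** Linearity, commutation with the equation and integration of approximants are all deduced from
    this uniqueness rather than by manipulating integrals. *)
Lemma primitive_unique b F w : ccont b F -> (forall t, t <= b -> w t = 0) ->
  (forall t : R, is_derive t 1 w (F t)) -> w = primitive b F.
Proof.
move=> hF w0 dw; apply/funext => t; apply: subr0_eq.
apply: (@is_derive0_eq R H (w - primitive b F) b) => [s|].
  rewrite -(subrr (F s)); apply: is_deriveB => //; exact: is_derive_primitive.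
by rewrite !fctE w0// primitive0// subrr.
Qed.

Lemma primitive_le b F (h dh : R -> R) t : ccont b F -> b <= t ->
  (forall s : R, b <= s <= t -> is_derive s 1 h (dh s)) ->
  (forall s, b <= s <= t -> `|F s| <= dh s) ->
  `|primitive b F t| <= h t - h b.
Proof.
move=> hF bt dh' Fh; rewrite -[primitive b F t]subr0 -(primitive0 hF (lexx b)).
apply: (weak_mvi bt _ dh' Fh) => x s _.
by apply: is_derive_dotpl; exact: is_derive_primitive.
Qed.

Lemma primitive_bound b F (M : R) t : ccont b F -> b <= t ->
  (forall s, b <= s <= t -> `|F s| <= M) -> `|primitive b F t| <= M * (t - b).
Proof.
move=> hF bt FM; rewrite mulrBr; apply: (@primitive_le b F (fun s => M * s) (fun=> M)) => //.
move=> s _; have := is_deriveM (is_derive_cst M s 1) (is_derive_id s (1 : R)).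
by rewrite scaler0 addr0 => /is_derive_eq; apply; rewrite /= -[RHS]mulr1.
Qed.

Lemma primitive_add b F G : ccont b F -> ccont b G ->
  primitive b (fun t => F t + G t) = (fun t => primitive b F t + primitive b G t).
Proof.
move=> hF hG; apply/esym/primitive_unique; first exact: ccont_add.
  by move=> t tb; rewrite !primitive0// addr0.
by move=> t; apply: is_deriveD; exact: is_derive_primitive.
Qed.

Lemma primitive_scale b F (c : R) : ccont b F ->
  primitive b (fun t => c *: F t) = (fun t => c *: primitive b F t).
Proof.
move=> hF; apply/esym/primitive_unique; first exact: ccont_scale.
  by move=> t tb; rewrite !primitive0// scaler0.
by move=> t; apply: is_deriveZ; exact: is_derive_primitive.
Qed.

Lemma is_derive_bop (B : bop H) F G (t : R) : is_derive t 1 F (G t) ->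
  is_derive t 1 (fun s => B (F s)) (B (G t)).
Proof.
move=> /is_derive_epsP dF; apply/is_derive_epsP => e e0.
have B0 : 0 < `|B| + 1 by rewrite ltr_wpDl.
have [del del0 delP] := dF (e / (`|B| + 1)) (divr_gt0 e0 B0).
exists del => // h /delP hd; rewrite -linearZ -!linearB /= (le_trans (bop_le _ _))//.
have : `|F (t + h) - F t - h *: G t| * (`|B| + 1) <= e * `|h|.
  by rewrite -ler_pdivlMr// mulrAC.
by apply: le_trans; rewrite mulrC ler_wpM2l// lerDl.
Qed.

Lemma luconv_primitive b (F_ : nat -> R -> H) F : (forall n, ccont b (F_ n)) ->
  ccont b F -> luconv F_ F -> luconv (fun n => primitive b (F_ n)) (primitive b F).
Proof.
move=> hF_ hF FF T e e0.
have T0 : 0 < `|T - b| + 1 by rewrite ltr_wpDl.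
have [N NP] := FF T _ (divr_gt0 e0 T0); exists N => n Nn t tT.
have [tb|/ltW bt] := leP t b; first by rewrite !primitive0// subrr normr0 ltW.
have -> : primitive b (F_ n) t - primitive b F t = primitive b (fun t => F_ n t - F t) t.
  have -> : (fun t => F_ n t - F t) = (fun t => F_ n t + (-1) *: F t).
    by apply/funext => s; rewrite scaleN1r.
  by rewrite primitive_add ?primitive_scale ?scaleN1r//; exact: ccont_scale.
rewrite (le_trans (primitive_bound (M := e / (`|T - b| + 1)) _ bt _))//.
- exact: ccont_sub.
- by move=> s /andP[_ st]; apply: NP => //; exact: le_trans tT.
rewrite mulrAC ler_pdivrMr// ler_wpM2l ?(ltW e0)//.
by move: (ler_norm (T - b)) tT; lra.
Qed.

End Primitive.

Section BochnerLinearity.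
Variables (R : realType) (H : hilbertType R).
Local Notation T := (measurableTypeR R).
Local Notation mu := (@lebesgue_measure R).
Implicit Types f g : T -> H.

Lemma bochner_add f g : bintegrable f -> bintegrable g ->
  bochner (fun t => f t + g t) = bochner f + bochner g.
Proof.
move=> bf bg; apply: dotp_inj => x.
rewrite [LHS](dotp_bochner _ (bintegrable_add bf bg)) dotpDl.
rewrite [X in _ = X + _](dotp_bochner _ bf) [X in _ = _ + X](dotp_bochner _ bg).
rewrite -(RintegralD measurableT (dotp_integrable x bf) (dotp_integrable x bg)).
by apply: eq_Rintegral => t _; rewrite dotpDl.
Qed.

Lemma bochner_scale (c : R) f : bintegrable f ->
  bochner (fun t => c *: f t) = c *: bochner f.
Proof.
move=> bf; apply: dotp_inj => x.
rewrite [LHS](dotp_bochner _ (bintegrable_scale c bf)) dotpZl.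
rewrite [X in _ = _ * X](dotp_bochner _ bf).
rewrite -(RintegralZl _ measurableT (dotp_integrable x bf)).
by apply: eq_Rintegral => t _; rewrite dotpZl.
Qed.

End BochnerLinearity.

(** * Convolution with causal operator-valued kernels *)

Section Convolution.
Variables (R : realType) (H : hilbertType R).
Local Notation T := (measurableTypeR R).
Local Notation mu := (@lebesgue_measure R).
Local Notation integrable f := (mu.-integrable setT (EFin \o f)).
Implicit Types (Q : R -> bop H) (u v : R -> H).

Definition causal_kernel Q : Prop :=
  [/\ strongly_measurable Q, integrable (fun t => `|Q t|) &
      forall t, t < 0 -> Q t = 0].

Definition kmass Q : R := \int[mu]_t `|Q t|.

Lemma kmass_ge0 Q : 0 <= kmass Q.
Proof. exact: Rintegral_ge0. Qed.

(** Together with causality and integrability of the kernel, this makes the convolution integrand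
    integrable at every time. *)
Definition lbounded u : Prop :=
  strongly_measurable u /\
  forall t : R, exists2 M : R, 0 <= M & forall s, s <= t -> `|u s| <= M.

Lemma ccont_lbounded b u : ccont b u -> lbounded u.
Proof.
move=> hu; split; first by apply: sm_continuous; case: hu.
by move=> t; exact: ccont_bounded hu.
Qed.

Lemma conv_integrand_le Q u t (M : R) : (forall s, s < 0 -> Q s = 0) ->
  (forall s, s <= t -> `|u s| <= M) -> 0 <= M ->
  forall s, `|Q (t - s) (u s)| <= `|Q (t - s)| * M.
Proof.
move=> Q0 uM M0 s; have [/uM us|ts] := leP s t.
  by rewrite (le_trans (bop_le _ _))// ler_wpM2l.
by rewrite Q0 ?subr_lt0//= normr0 mulr_ge0.
Qed.

Lemma conv_bintegrable Q u t : causal_kernel Q -> lbounded u ->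
  bintegrable (fun s : T => Q (t - s) (u s)).
Proof.
move=> [mQ iQ Q0] [mu' /(_ t)[M M0 uM]].
apply: bintegrable_le (integrable_mulr M (reflect_integrable t iQ)).
  apply: sm_bop => //; exact: (sm_precomp (@measurable_reflect R t) mQ).
exact: conv_integrand_le.
Qed.

Lemma convolution_le Q u t (M : R) : causal_kernel Q -> lbounded u -> 0 <= M ->
  (forall s, s <= t -> `|u s| <= M) -> `|convolution Q u t| <= kmass Q * M.
Proof.
move=> hQ hu M0 uM; have [mQ iQ Q0] := hQ.
have bQ := conv_bintegrable t hQ hu.
rewrite (le_trans (bochner_norm_le bQ))// /kmass -(reflect_Rintegral t iQ).
rewrite -RintegralZr//; last exact: (reflect_integrable t iQ).
apply: le_int; first by case: bQ.
  exact: integrable_mulr (reflect_integrable t iQ).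
exact: conv_integrand_le.
Qed.

Lemma lbounded_add u v : lbounded u -> lbounded v -> lbounded (fun t => u t + v t).
Proof.
move=> [mu' ub] [mv vb]; split; first exact: sm_add.
move=> t; have [M M0 uM] := ub t; have [N N0 vN] := vb t.
exists (M + N); first exact: addr_ge0.
by move=> s st; rewrite (le_trans (ler_normD _ _))// lerD ?uM ?vN.
Qed.

Lemma lbounded_scale (c : R) u : lbounded u -> lbounded (fun t => c *: u t).
Proof.
move=> [mu' ub]; split; first exact: (sm_scale (sm_cst c)).
move=> t; have [M M0 uM] := ub t; exists (`|c| * M); first exact: mulr_ge0.
by move=> s st; rewrite normrZ ler_wpM2l ?uM.
Qed.

Lemma conv_add Q u v t : causal_kernel Q -> lbounded u -> lbounded v ->
  convolution Q (fun s => u s + v s) t = convolution Q u t + convolution Q v t.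
Proof.
move=> hQ hu hv; rewrite /convolution -bochner_add; try exact: conv_bintegrable.
by congr bochner; apply/funext => s; rewrite linearD.
Qed.

Lemma conv_scale Q u (c : R) t : causal_kernel Q -> lbounded u ->
  convolution Q (fun s => c *: u s) t = c *: convolution Q u t.
Proof.
move=> hQ hu; rewrite /convolution -bochner_scale; try exact: conv_bintegrable.
by congr bochner; apply/funext => s; rewrite linearZ.
Qed.

Lemma conv_sub Q u v t : causal_kernel Q -> lbounded u -> lbounded v ->
  convolution Q (fun s => u s - v s) t = convolution Q u t - convolution Q v t.
Proof.
move=> hQ hu hv; rewrite -[- convolution Q v t]scaleN1r -conv_scale//.
rewrite -(conv_add _ hQ hu (lbounded_scale (-1) hv)).
by congr (convolution Q _ t); apply/funext => s; rewrite scaleN1r.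
Qed.

Lemma conv_perturb Q dQ u (h t : R) : causal_kernel Q -> causal_kernel dQ -> lbounded u ->
  convolution (fun s => Q s + h *: dQ s) u t =
  convolution Q u t + h *: convolution dQ u t.
Proof.
move=> hQ hdQ hu; rewrite /convolution -bochner_scale; last exact: conv_bintegrable.
rewrite -bochner_add//; first exact: conv_bintegrable.
by apply: bintegrable_scale; exact: conv_bintegrable.
Qed.

Lemma kernel_perturb Q dQ (h : R) : causal_kernel Q -> causal_kernel dQ ->
  causal_kernel (fun s => Q s + h *: dQ s).
Proof.
move=> [mQ iQ Q0] [mdQ idQ dQ0]; split.
- by apply: sm_add => //; exact: (sm_scale (sm_cst h)).
- apply: integrable_le (integrable_add iQ (integrable_mulr `|h| idQ)).
    by apply: sm_measurable_norm; apply: sm_add => //; exact: (sm_scale (sm_cst h)).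
  by move=> t; rewrite normr_id (le_trans (ler_normD _ _))// lerD2l normrZ mulrC.
- by move=> t t0; rewrite Q0// dQ0// scaler0 addr0.
Qed.

Lemma kmass_perturb Q dQ (h : R) : causal_kernel Q -> causal_kernel dQ ->
  kmass (fun s => Q s + h *: dQ s) <= kmass Q + kmass dQ * `|h|.
Proof.
move=> hQ hdQ; have [_ iQ _] := hQ; have [_ idQ _] := hdQ.
have [_ iQd _] := kernel_perturb h hQ hdQ.
rewrite /kmass -RintegralZr// -RintegralD//; last exact: integrable_mulr.
apply: le_int => //; first exact: (integrable_add iQ (integrable_mulr `|h| idQ)).
by move=> t; rewrite (le_trans (ler_normD _ _))// lerD2l normrZ mulrC.
Qed.

(** Substituting [r = t - s] moves the time variable onto [u], so that translations pass through the
    convolution. *)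
Lemma dotp_conv Q u t x : causal_kernel Q -> lbounded u ->
  dotp (convolution Q u t) x = \int[mu]_r dotp (Q r (u (t - r))) x.
Proof.
move=> hQ hu; have bQ := conv_bintegrable t hQ hu.
rewrite dotp_bochner// -(reflect_Rintegral t); last exact: dotp_integrable.
by apply: eq_Rintegral => r _; rewrite subKr.
Qed.

Lemma conv_shift Q u (k t : R) : causal_kernel Q -> lbounded u ->
  lbounded (fun s => u (s + k)) ->
  convolution Q (fun s => u (s + k)) t = convolution Q u (t + k).
Proof.
move=> hQ hu huk; apply: dotp_inj => x.
rewrite [LHS](dotp_conv _ _ hQ huk) [RHS](dotp_conv _ _ hQ hu).
by apply: eq_Rintegral => r _; rewrite addrAC.
Qed.

(** By translation invariance an increment of the convolution is the convolution of an increment.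
    With [v = 0] this yields continuity, with [v] equal to [h] times the derivative of [u] it yields
    differentiability. *)
Lemma conv_increment Q b u v (t h e : R) : causal_kernel Q -> ccont b u -> ccont b v ->
  0 <= e ->
  (forall s, s <= t -> `|u (s + h) - u s - v s| <= e) ->
  `|convolution Q u (t + h) - convolution Q u t - convolution Q v t| <=
    kmass Q * e.
Proof.
move=> hQ hu hv e0 uv.
have lu := ccont_lbounded hu; have lv := ccont_lbounded hv.
have luh := ccont_lbounded (ccont_shift h hu).
have luhu : lbounded (fun s => u (s + h) - u s).
  have := lbounded_add luh (lbounded_scale (-1) lu); congr lbounded.
  by apply/funext => s; rewrite scaleN1r.
rewrite -conv_shift// -!conv_sub//; apply: convolution_le => //.
have := lbounded_add luhu (lbounded_scale (-1) lv); congr lbounded.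
by apply/funext => s; rewrite scaleN1r.
Qed.

Lemma ccont_conv Q b u : causal_kernel Q -> ccont b u -> ccont b (convolution Q u).
Proof.
move=> hQ hu; have lu := ccont_lbounded hu; split=> t; last first.
  move=> tb; apply/eqP; rewrite -normr_le0 -(mulr0 (kmass Q)).
  apply: convolution_le => // s st; case: hu => _ -> //; first by rewrite normr0.
  exact: le_trans tb.
apply/cvgrPdist_le => e e0.
have q0 : 0 < kmass Q + 1 by rewrite ltr_wpDl// kmass_ge0.
have e'0 : 0 < e / (kmass Q + 1) by rewrite divr_gt0.
have [del del0 delP] := ccont_heine t hu e'0.
exists del => //= s ts; rewrite distrC.
have := @conv_increment Q b u (fun=> 0) t (s - t) _ hQ hu (ccont0 H b) (ltW e'0).
rewrite subrKC.
have -> : convolution Q (fun=> 0) t = 0.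
  apply/eqP; rewrite -normr_le0 -(mulr0 (kmass Q)); apply: convolution_le => //.
    exact: (ccont_lbounded (ccont0 H b)).
  by move=> *; rewrite normr0.
rewrite subr0 => h; apply: le_trans (h _) _ => [r rt|].
  rewrite subr0; apply: delP => //.
  by rewrite addrAC subrr add0r distrC ltW.
by rewrite mulrA ler_pdivrMr// mulrDr mulr1 mulrC lerDl ltW.
Qed.

(** The derivative falls on [u], so the kernel may jump at [0]. *)
Lemma is_derive_conv Q b u v : causal_kernel Q -> ccont b u -> ccont b v ->
  (forall t : R, is_derive t 1 u (v t)) ->
  forall t : R, is_derive t 1 (convolution Q u) (convolution Q v t).
Proof.
move=> hQ hu hv du t; apply/is_derive_epsP => e e0.
have q0 : 0 < kmass Q + 1 by rewrite ltr_wpDl// kmass_ge0.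
have e'0 : 0 < e / (kmass Q + 1) by rewrite divr_gt0.
have [del del0 delP] := ccont_heine t hv e'0.
exists del => // h hdel.
rewrite -conv_scale//; last exact: ccont_lbounded hv.
apply: (le_trans (@conv_increment Q b u (fun s => h *: v s) t h
  (e / (kmass Q + 1) * `|h|) hQ hu (ccont_scale h hv) _ _)).
- by rewrite mulr_ge0// ltW.
- move=> s st; apply: (@weak_increment R H u v) => [x r|r rs].
    exact: is_derive_dotpl.
  by apply: delP => //; exact: le_trans hdel.
by rewrite mulrA ler_wpM2r// mulrA ler_pdivrMr// mulrDr mulr1 mulrC lerDl ltW.
Qed.

Lemma luconv_conv Q b (u_ : nat -> R -> H) u : causal_kernel Q ->
  (forall n, ccont b (u_ n)) -> ccont b u -> luconv u_ u ->
  luconv (fun n => convolution Q (u_ n)) (convolution Q u).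
Proof.
move=> hQ hu_ hu uu t e e0.
have q0 : 0 < kmass Q + 1 by rewrite ltr_wpDl// kmass_ge0.
have e'0 : 0 < e / (kmass Q + 1) by rewrite divr_gt0.
have [N NP] := uu t _ e'0; exists N => n Nn s st.
rewrite -conv_sub//; [|exact: ccont_lbounded (hu_ n)|exact: ccont_lbounded hu].
apply: (le_trans (@convolution_le Q _ s (e / (kmass Q + 1)) hQ _ _ _)).
- exact: (ccont_lbounded (ccont_sub (hu_ n) hu)).
- exact: ltW.
- by move=> r rs; apply: NP => //; exact: le_trans st.
by rewrite mulrA ler_pdivrMr// mulrDr mulr1 mulrC lerDl ltW.
Qed.

End Convolution.

(** * Energy estimate *)

Section Energy.
Variables (R : realType) (H : hilbertType R).
Implicit Types (u v : R -> H).

Lemma is_derive_dotp u v (t : R) (du dv : H) :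
  is_derive t 1 u du -> is_derive t 1 v dv ->
  is_derive t 1 (fun s => dotp (u s) (v s)) (dotp du (v t) + dotp (u t) dv).
Proof.
move=> hu hv; apply/is_derive_epsP => e e0.
have K0 : 0 < `|v t| + 1 + `|du| + `|u t|.
  by move: (normr_ge0 (v t)) (normr_ge0 du) (normr_ge0 (u t)); lra.
(* The three summands are the factors multiplying the errors in the product rule below. *)
set K := `|v t| + 1 + `|du| + `|u t| in K0.
have [d1 d10 d1P] := (is_derive_epsP _ _ _).1 hu _ (divr_gt0 e0 K0).
have [d2 d20 d2P] := (is_derive_epsP _ _ _).1 hv _ (divr_gt0 e0 K0).
have mK : 0 < Num.min 1 (e / K) by rewrite lt_min ltr01 divr_gt0.
have /cvgrPdist_lt /(_ _ mK)[d3 /= d30 d3P] := is_derive_continuous hv.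
exists (Num.min (Num.min d1 d2) (d3 / 2)); first by rewrite !lt_min d10 d20 divr_gt0.
move=> h; rewrite !le_min => /andP[/andP[/d1P hu' /d2P hv'] hd3].
have : `|v t - v (t + h)| < Num.min 1 (e / K).
  apply: d3P; rewrite /= opprD addrA subrr add0r normrN (le_lt_trans hd3)//.
  by rewrite ltr_pdivrMr// ltr_pMr// ltr1n.
rewrite distrC lt_min => /andP[/ltW v1 /ltW vK].
have vle : `|v (t + h)| <= `|v t| + 1.
  by rewrite -[v (t + h)](subrK (v t)) addrC (le_trans (ler_normD _ _))// lerD2l.
have -> : dotp (u (t + h)) (v (t + h)) - dotp (u t) (v t) -
    h *: (dotp du (v t) + dotp (u t) dv) =
    dotp (u (t + h) - u t - h *: du) (v (t + h)) +
    h * dotp du (v (t + h) - v t) + dotp (u t) (v (t + h) - v t - h *: dv).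
  by rewrite !(dotpBl, dotpBr, dotpZl, dotpZr) /GRing.scale /=; ring.
have b1 : `|dotp (u (t + h) - u t - h *: du) (v (t + h))| <= e / K * `|h| * (`|v t| + 1).
  by rewrite (le_trans (cauchy_schwarz _ _))// ler_pM.
have b2 : `|h * dotp du (v (t + h) - v t)| <= e / K * `|h| * `|du|.
  rewrite normrM [leRHS](_ : _ = `|h| * (`|du| * (e / K))); last by ring.
  by rewrite ler_wpM2l// (le_trans (cauchy_schwarz _ _))// ler_wpM2l.
have b3 : `|dotp (u t) (v (t + h) - v t - h *: dv)| <= e / K * `|h| * `|u t|.
  by rewrite (le_trans (cauchy_schwarz _ _))// mulrC ler_wpM2r.
rewrite (le_trans (ler_normD _ _))// (le_trans (lerD (ler_normD _ _) b3))//.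
rewrite (le_trans (lerD (lerD b1 b2) (lexx _)))// -!mulrDr -/K.
by rewrite mulrAC divfK// gt_eqF.
Qed.

Lemma expR_lin_is_derive (c b t : R) :
  is_derive t 1 (fun s => expR (c * (s - b))) (c * expR (c * (t - b))).
Proof.
have d1 : is_derive t 1 (fun s : R => c * (s - b)) c.
  have -> : (fun s : R => c * (s - b)) = c \*: (id - cst b).
    by apply/funext => s; rewrite /= !fctE.
  have := is_deriveZ c (is_deriveB (is_derive_id t 1) (is_derive_cst b t 1)).
  by rewrite subr0 => /is_derive_eq; apply; rewrite /GRing.scale /= mulr1.
have := @is_derive1_comp R expR (fun s => c * (s - b)) t _ _ (is_derive_expR _) d1.
by move=> /is_derive_eq; apply; rewrite mulrC.
Qed.

Lemma selfadjoint_energy_derive (A : bop H) u u' (t : R) : selfadjoint A ->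
  is_derive t 1 u (u' t) ->
  is_derive t 1 (fun s => dotp (A (u s)) (u s)) (2 * dotp (A (u' t)) (u t)).
Proof.
move=> sA du; have := is_derive_dotp (is_derive_bop A du) du.
move=> /is_derive_eq; apply.
by rewrite [dotp (A (u t)) _]sA [dotp (u t) _]dotpC mulr2n mulrDl mul1r.
Qed.

Section EnergyEstimate.
Variables (A : bop H) (c kappa b T delta : R) (u u' : R -> H) (g G : R -> R).
Hypotheses (c0 : 0 < c) (kappa0 : 0 <= kappa) (bT : b <= T) (delta0 : 0 <= delta).
Hypotheses (sA : selfadjoint A) (cA : forall x, c * dotp x x <= dotp (A x) x).
Hypotheses (hu : ccont b u) (du : forall t : R, is_derive t 1 u (u' t)).
Hypothesis dG : forall t : R, b <= t <= T -> is_derive t 1 G (g t).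
Hypotheses (g0 : forall t, b <= t <= T -> 0 <= g t) (G0 : G b = 0).
Hypothesis growth : forall t, b <= t <= T -> forall N, 0 <= N ->
  (forall s, s <= t -> `|u s| <= N) ->
  dotp (A (u' t)) (u t) <= `|u t| * (g t + kappa * N) + delta.

Let gam : R := 4 * kappa / c + 1.

(* [N] is the maximum of [exp (- gam (t - b)) |u t|] over [b, T]; the choice of
   [gam] makes the memory term absorb at most a quarter of [c N^2]. *)
Lemma energy_estimate t : b <= t <= T ->
  `|u t| ^+ 2 <= expR (gam * (T - b)) ^+ 2 *
    (8 / c ^+ 2 * G T ^+ 2 + 4 / c * delta * (T - b)).
Proof.
move=> btT.
have gam1 : 0 < gam by rewrite /gam ltr_wpDl// divr_ge0 ?(ltW c0)// mulr_ge0.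
have gamE : kappa / gam <= c / 4.
  rewrite ler_pdivrMr// /gam mulrDr mulr1.
  have -> : c / 4 * (4 * kappa / c) = kappa by field; rewrite gt_eqF.
  by rewrite lerDl divr_ge0// ltW.
pose E (s : R) := expR (gam * (s - b)).
have E0 s : 0 < E s by exact: expR_gt0.
have E1 s : b <= s -> 1 <= E s.
  by move=> bs; rewrite -expR0 ler_expR mulr_ge0 ?subr_ge0// ltW.
have Emono s r : s <= r -> E s <= E r.
  by move=> sr; rewrite ler_expR ler_wpM2l ?(ltW gam1)// lerD2r.
pose m s := `|u s| / E s.
have [|ts tsT tsP] := @EVT_max R m b T bT.
  apply: continuous_subspaceT => s.
  apply: cvgM; first by apply: cvg_norm; case: hu => cu _; exact: cu.
  apply: cvgV; first by rewrite gt_eqF.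
  exact: (is_derive_continuous (expR_lin_is_derive gam b s)).
rewrite in_itv/= in tsT; have /andP[bts tsleT] := tsT.
set N := m ts in tsP *.
have N0 : 0 <= N by rewrite divr_ge0// ltW.
have uN s : s <= T -> `|u s| <= N * E s.
  move=> sT; have [sb|bs] := leP s b.
    by case: hu => _ -> //; rewrite normr0 mulr_ge0// ltW.
  by rewrite -ler_pdivrMr//; apply: tsP; rewrite in_itv/= (ltW bs).
have GE s : b <= s <= T -> 0 <= G s.
  move=> /andP[bs sT].
  have := @derive_le_le R (fun=> 0) (fun=> 0) G g b s bs.
  rewrite subrr G0 subr0; apply.
  - by move=> x /andP[bx xs]; apply: dG; rewrite bx (le_trans xs).
  - by move=> x /andP[bx xs]; apply: g0; rewrite bx (le_trans xs).
have GT : G ts <= G T.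
  rewrite -subr_ge0; have := @derive_le_le R (fun=> 0) (fun=> 0) G g ts T tsleT.
  rewrite subrr; apply.
  - by move=> x /andP[bx xs]; apply: dG; rewrite (le_trans bts)//=.
  - by move=> x /andP[bx xs]; apply: g0; rewrite (le_trans bts)//=.
(* Since [|u| <= N E], twice the growth bound is at most [2 N E g + 2 kappa N^2 E^2 + 2 delta]. The
   derivative of [h] is this plus a nonnegative multiple of [G]. *)
pose h (s : R) := 2 * N * (E s * G s) + kappa / gam * N ^+ 2 * (E s * E s) + 2 * delta * s.
pose dh (s : R) := 2 * N * (gam * E s * G s + E s * g s) +
   kappa / gam * N ^+ 2 * (gam * E s * E s + E s * (gam * E s)) + 2 * delta.
have dh' (s : R) : b <= s <= ts -> is_derive s 1 h (dh s).
  move=> /andP[bs sts].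
  have dGs := dG (introT andP (conj bs (le_trans sts tsleT))).
  have dE := expR_lin_is_derive gam b s.
  have d1 := is_deriveZ (2 * N) (is_deriveM dE dGs).
  have d2 := is_deriveZ (kappa / gam * N ^+ 2) (is_deriveM dE dE).
  have d3 := is_deriveZ (2 * delta) (is_derive_id s (1 : R)).
  have := is_deriveD (is_deriveD d1 d2) d3.
  move=> /is_derive_eq; apply; rewrite /dh /GRing.scale /= -/(E s); ring.
have cN : c * `|u ts| ^+ 2 <= h ts - h b.
  rewrite -dotp_norm (le_trans (cA _))//.
  have -> : dotp (A (u ts)) (u ts) = dotp (A (u ts)) (u ts) - dotp (A (u b)) (u b).
    by rewrite (hu.2 b)// dotp0r subr0.
  apply: (@derive_le_le R (fun s => dotp (A (u s)) (u s))
     (fun s => 2 * dotp (A (u' s)) (u s)) h dh b ts bts) => [s _|s /andP[bs sts]].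
    exact: selfadjoint_energy_derive.
  have bsT : b <= s <= T by rewrite bs (le_trans sts).
  have uNs r : r <= s -> `|u r| <= N * E s.
    move=> rs; rewrite (le_trans (uN r _)) ?(le_trans rs) ?(le_trans sts)//.
    by rewrite ler_wpM2l// Emono.
  have hgr := growth bsT (mulr_ge0 N0 (ltW (E0 s))) uNs.
  have us := uN s (le_trans sts tsleT).
  have gs := g0 bsT; have Gs := GE s bsT; have Es := ltW (E0 s).
  rewrite /dh.
  have h1 : `|u s| * (g s + kappa * (N * E s)) <= N * E s * (g s + kappa * (N * E s)).
    apply: ler_wpM2r => //; apply: addr_ge0 => //; apply: mulr_ge0 => //.
    exact: mulr_ge0.
  have -> : kappa / gam * N ^+ 2 * (gam * E s * E s + E s * (gam * E s)) =
     2 * kappa * N ^+ 2 * E s ^+ 2 by field; rewrite gt_eqF.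
  have h2 : 0 <= N * (gam * E s * G s).
    by do ![apply: mulr_ge0 => //]; exact: ltW.
  by nra.
have uts : `|u ts| = N * E ts by rewrite /N /m divfK// gt_eqF.
have main : N ^+ 2 <= 8 / c ^+ 2 * G T ^+ 2 + 4 / c * delta * (T - b).
  have := cN; rewrite uts /h => {}cN.
  have Eb : E b = 1 by rewrite /E subrr mulr0 expR0.
  rewrite Eb G0 in cN.
  have e1 := E1 ts bts; have e0 := E0 ts.
  have hL : 0 <= delta * (T - ts) by apply: mulr_ge0 => //; rewrite subr_ge0.
  have hL2 : 0 <= delta * (T - b) by apply: mulr_ge0 => //; rewrite subr_ge0.
  have GTs := GE ts tsT.
  have q : kappa / gam * N ^+ 2 * (E ts * E ts) <= c / 4 * N ^+ 2 * (E ts * E ts).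
    by apply: ler_wpM2r; [rewrite mulr_ge0// ltW|rewrite ler_wpM2r// sqr_ge0].
  have q' : 0 <= kappa / gam * N ^+ 2.
    by apply: mulr_ge0; [rewrite divr_ge0// ltW|exact: sqr_ge0].
  have step1 : 3 / 4 * c * N ^+ 2 * E ts ^+ 2 <= 2 * N * E ts * G T + 2 * delta * (T - b).
    have s1 : 2 * N * (E ts * G ts) <= 2 * N * E ts * G T.
      rewrite -[leRHS]mulrA; apply: ler_wpM2l; first exact: mulr_ge0.
      by apply: ler_wpM2l => //; exact: ltW.
    by move: cN q q' s1 hL; nra.
  (* The weight cancels because [E ts >= 1] gives [E ts <= E ts ^ 2] and [1 <= E ts ^ 2]. *)
  have step2 : 3 / 4 * c * N ^+ 2 <= 2 * N * G T + 2 * delta * (T - b).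
    have GT0 : 0 <= N * G T by apply: mulr_ge0 => //; apply: GE; rewrite bT lexx.
    have s2 : 2 * N * E ts * G T + 2 * delta * (T - b) <=
        (2 * N * G T + 2 * delta * (T - b)) * E ts ^+ 2.
      have : 0 <= N * G T * (E ts ^+ 2 - E ts) by rewrite mulr_ge0// subr_ge0 ler_eXnr.
      have : 0 <= delta * (T - b) * (E ts ^+ 2 - 1) by rewrite mulr_ge0// subr_ge0 expr_ge1// ltW.
      by nra.
    by have := le_trans step1 s2; rewrite ler_pM2r// exprn_gt0.
  (* Young's inequality spends another [c / 4], so that [c / 2] of the energy remains; dividing by
     it produces the constants [8 / c ^ 2] and [4 / c]. *)
  have amgm : 2 * N * G T <= c / 4 * N ^+ 2 + 4 / c * G T ^+ 2.
    rewrite -subr_ge0.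
    have -> : c / 4 * N ^+ 2 + 4 / c * G T ^+ 2 - 2 * N * G T =
      (c / 2 * N - 2 * G T) ^+ 2 / c by field; rewrite gt_eqF.
    by rewrite divr_ge0 ?sqr_ge0// ltW.
  rewrite -(@ler_pM2l _ (c / 2)) ?divr_gt0//.
  have -> : c / 2 * (8 / c ^+ 2 * G T ^+ 2 + 4 / c * delta * (T - b)) =
     4 / c * G T ^+ 2 + 2 * delta * (T - b) by field; rewrite gt_eqF.
  by move: step2 amgm; nra.
have /andP[bt tT] := btT.
apply: (@le_trans _ _ (E T ^+ 2 * N ^+ 2)).
  rewrite -exprMn [E T * N]mulrC; apply: lerXn2r; rewrite ?nnegrE//.
    by apply: mulr_ge0 => //; exact: ltW.
  by rewrite (le_trans (uN t tT))// ler_wpM2l// Emono.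
by rewrite ler_wpM2l ?sqr_ge0.
Qed.

End EnergyEstimate.
End Energy.

(** * Yosida approximation and existence *)

Section SkewGenerator.
Variables (R : realType) (H V : hilbertType R) (j P : {linear V -> H}).
Hypothesis P_skew : skew_adjoint j P.
Hypothesis P_graph : exists c C : R, 0 < c /\
  forall v, c * `|v| <= `|j v| + `|P v| <= C * `|v|.

(* By skew-adjointness this says that [u] lies in the domain of [P] and [P u = p]. *)
Definition weakP (u p : H) : Prop := forall v, dotp (P v) u = - dotp (j v) p.

Lemma weakP_domain u p : weakP u p -> exists2 w, u = j w & p = P w.
Proof.
move=> up; have [|w uw pw] := (P_skew u (- p)).1.
  by move=> v; rewrite up dotpNr.
by exists w => //; apply: oppr_inj.
Qed.

Lemma weakP_range w : weakP (j w) (P w).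
Proof.
move=> v; have := (P_skew (j w) (- P w)).2; rewrite -dotpNr; apply.
by exists w.
Qed.

Lemma weakP_orth u p : weakP u p -> dotp p u = 0.
Proof.
move=> up; have [w uw pw] := weakP_domain up.
by have := up w; rewrite -uw -pw (dotpC u p) => h; lra.
Qed.

Lemma weakP_sub u p u' p' : weakP u p -> weakP u' p' -> weakP (u - u') (p - p').
Proof. by move=> h h' v; rewrite !dotpBr h h' opprB addrC opprK. Qed.

Lemma weakP_scale a u p : weakP u p -> weakP (a *: u) (a *: p).
Proof. by move=> h v; rewrite !dotpZr h mulrN. Qed.

(** Closedness of the graph of [P]: both sides of the defining identity pass to the limit. *)
Lemma weakP_cvg (u_ p_ : nat -> H) u p : (forall n, weakP (u_ n) (p_ n)) ->
  u_ @ \oo --> u -> p_ @ \oo --> p -> weakP u p.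
Proof.
move=> up uu pp v.
have c1 : dotp (P v) (u_ n) @[n --> \oo] --> dotp (P v) u.
  by apply: cvg_dotp => //; exact: cvg_cst.
have c2 : - dotp (j v) (p_ n) @[n --> \oo] --> - dotp (j v) p.
  by apply: cvgN; apply: cvg_dotp => //; exact: cvg_cst.
have e : (fun n => dotp (P v) (u_ n)) = (fun n => - dotp (j v) (p_ n)).
  by apply/funext => n; rewrite up.
by rewrite e in c1; exact: (cvg_unique _ c1 c2).
Qed.

(** The lift is selected pointwise. The lower graph bound, applied to the difference of two values,
    makes the selection continuous into [V]. *)
Lemma weakP_lift (u p : R -> H) : continuous u -> continuous p ->
  (forall t, weakP (u t) (p t)) ->
  exists w : R -> V, [/\ continuous w, forall t, u t = j (w t) & forall t, p t = P (w t)].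
Proof.
move=> cu cp up.
have [w wP] := choice (fun t => let: ex_intro2 w a b := weakP_domain (up t) in
  ex_intro (fun w => u t = j w /\ p t = P w) w (conj a b)).
exists w; split => [t|t|t]; [|by case: (wP t)|by case: (wP t)].
have [c [C [c0 cC]]] := P_graph.
apply/cvgrPdist_le => e e0.
have ce : 0 < c * e / 2 by rewrite divr_gt0// mulr_gt0.
have /cvgrPdist_le /(_ _ ce) hu := cu t; have /cvgrPdist_le /(_ _ ce) hp := cp t.
apply: filterS2 hu hp => s us ps.
rewrite -(ler_pM2l c0); have /andP[+ _] := cC (w t - w s); move=> /le_trans; apply.
rewrite !linearB /= -!(wP _).1 -!(wP _).2 [c * e]splitr; exact: lerD.
Qed.

(** [K] is the Yosida approximation [P (I + l P)^-1], and [x - l K x] is the resolvent at [x].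
    Skewness gives [|j v + l P v|^2 = |j v|^2 + l^2 |P v|^2], hence a lower bound. A vector [y]
    orthogonal to the range satisfies [P y = l^-1 y], hence vanishes by skewness. *)
Lemma yosida_ex (l : R) : 0 < l -> exists K : bop H,
  forall x, weakP (x - l *: K x) (K x).
Proof.
move=> l0; have [c [C [c0 cC]]] := P_graph.
pose f v := j v + l *: P v.
have flin : linear f.
  by move=> a v w; rewrite /f (linearP j) (linearP P) /= !scalerDr !scalerA (mulrC l a) addrACA.
pose TM := GRing.isLinear.Build R V H *:%R f flin.
pose T : {linear V -> H} := HB.pack f TM.
have TE v : T v = j v + l *: P v by [].
have T2 v : `|T v| ^+ 2 = `|j v| ^+ 2 + l ^+ 2 * `|P v| ^+ 2.
  rewrite TE -!dotp_norm !(dotpDl, dotpDr, dotpZl, dotpZr).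
  have -> : dotp (P v) (j v) = 0 by apply: weakP_orth; exact: weakP_range.
  by rewrite (dotpC (j v)) (weakP_orth (weakP_range v)); ring.
have jT v : `|j v| <= `|T v|.
  by rewrite -(@ler_pXn2r _ 2)// ?nnegrE// T2 lerDl mulr_ge0// sqr_ge0.
have PT v : `|P v| <= `|T v| / l.
  rewrite ler_pdivlMr// -(@ler_pXn2r _ 2)// ?nnegrE ?mulr_ge0 ?(ltW l0)//.
  by rewrite T2 exprMn mulrC lerDr sqr_ge0.
have T_bounds v : c / (1 + l^-1) * `|v| <= `|T v| <= (1 + l) * C * `|v|.
  have /andP[lo hi] := cC v; apply/andP; split.
    rewrite mulrAC ler_pdivrMr ?addr_gt0 ?invr_gt0// (le_trans lo)//.
    by rewrite mulrDr mulr1 lerD.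
  rewrite TE (le_trans (ler_normD _ _))// normrZ gtr0_norm//.
  rewrite -mulrA; apply: le_trans (ler_wpM2l _ hi); last by rewrite addr_ge0// ltW.
  rewrite mulrDl mul1r mulrDr; have := normr_ge0 (P v).
  by have := mulr_ge0 (ltW l0) (normr_ge0 (j v)); lra.
have c'0 : 0 < c / (1 + l^-1) by rewrite divr_gt0// addr_gt0// invr_gt0.
have T_dense y : (forall v, dotp (T v) y = 0) -> y = 0.
  move=> yT; have wy : weakP y (l^-1 *: y).
    move=> v; have := yT v; rewrite TE dotpDl dotpZl dotpZr => h.
    apply: (mulfI (lt0r_neq0 l0)); rewrite mulrN mulrA divff ?gt_eqF// mul1r; lra.
  have /eqP := weakP_orth wy; rewrite dotpZl mulf_eq0 invr_eq0 gt_eqF//=.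
  by move=> /eqP/dotp_eq0.
have [J JP] := choice (lower_bounded_surjective c'0 T_bounds T_dense).
have wK x : weakP (x - l *: P (J x)) (P (J x)).
  have -> : x - l *: P (J x) = j (J x) by rewrite -{1}(JP x) TE addrK.
  exact: weakP_range.
(* The resolvent [J] comes from choice; linearity of [P (J x)] is recovered from uniqueness. *)
have K_unique x k k' : weakP (x - l *: k) k -> weakP (x - l *: k') k' -> k = k'.
  move=> h h'; have := weakP_orth (weakP_sub h h').
  have -> : x - l *: k - (x - l *: k') = - l *: (k - k').
    by rewrite opprB addrC subrKA scaleNr scalerBr opprB.
  rewrite dotpZr => /eqP; rewrite mulf_eq0 oppr_eq0 gt_eqF//= => /eqP/dotp_eq0.
  exact: subr0_eq.
have Klin : linear (fun x => P (J x)).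
  move=> a x y; apply: (K_unique (a *: x + y)) => //.
  have := weakP_sub (weakP_scale a (wK x)) (weakP_scale (-1) (wK y)).
  rewrite !scaleN1r !opprK; congr weakP.
  by rewrite (scalerBr a) addrACA (scalerDr l) opprD !scalerA (mulrC a l).
have Kbnd : exists M : R, forall x, `|P (J x)| <= M * `|x|.
  by exists l^-1 => x; rewrite mulrC -{2}(JP x); exact: PT.
by exists (Bop Klin Kbnd) => x; exact: wK.
Qed.

(** [K x] is orthogonal to [x - l K x], so the pairing equals [l |K x|^2]. *)
Lemma yosida_monotone (l : R) (K : bop H) x : 0 <= l ->
  weakP (x - l *: K x) (K x) -> 0 <= dotp (K x) x.
Proof.
move=> l0 /weakP_orth; rewrite dotpBr dotpZr => /subr0_eq ->.
by rewrite mulr_ge0// dotp_ge0.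
Qed.

(** Write [x - y] as the difference of the resolvents plus [l K x - m L y]. The first part is
    orthogonal to [K x - L y]; the second has norm at most [(l + m) M]. *)
Lemma yosida_diff_lower (l m M : R) (K L : bop H) x y : 0 <= l -> 0 <= m ->
  weakP (x - l *: K x) (K x) -> weakP (y - m *: L y) (L y) ->
  `|K x| <= M -> `|L y| <= M ->
  - (2 * M ^+ 2 * (l + m)) <= dotp (K x - L y) (x - y).
Proof.
move=> l0 m0 hK hL KM LM; have M0 := le_trans (normr_ge0 _) KM.
have := weakP_orth (weakP_sub hK hL).
have -> : x - l *: K x - (y - m *: L y) = (x - y) - (l *: K x - m *: L y).
  by rewrite !opprB addrACA [- (l *: K x) - y]addrC addrACA.
rewrite dotpBr => /subr0_eq ->; rewrite lerNl -dotpNr (le_trans (dotp_le _ _))//.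
have h1 : `|K x - L y| <= 2 * M.
  by rewrite (le_trans (ler_normB _ _))// mulr2n mulrDl mul1r lerD.
have h2 : `|- (l *: K x - m *: L y)| <= (l + m) * M.
  rewrite normrN (le_trans (ler_normB _ _))// !normrZ !ger0_norm// mulrDl.
  by rewrite lerD// ler_wpM2l.
rewrite (le_trans (ler_pM _ _ h1 h2))//.
by rewrite le_eqVlt; apply/orP; left; apply/eqP; ring.
Qed.

End SkewGenerator.

Lemma subr_sub4 (U : zmodType) (g a c a' c' : U) :
  g - a - c - (g - a' - c') = - (a - a' + (c - c')).
Proof.
rewrite -[g - a - c]addrA -[g - a' - c']addrA -!opprD opprB [LHS]addrC subrKA.
by rewrite [in RHS]opprD [in RHS]opprB [in RHS]opprB [RHS]addrACA -opprD.
Qed.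

(** * Picard iteration for the equation with a bounded operator in place of [P] *)

Section Volterra.
Variables (R : realType) (H : hilbertType R).
Variables (A A' N : bop H) (Q : R -> bop H) (b : R) (g : R -> H).
Hypotheses (AA' : forall x, A (A' x) = x) (hQ : causal_kernel Q) (hg : ccont b g).

(** The unknown [v] is the derivative of the solution [primitive b v]. Solved for [v], the equation
    contains [v] only under integrals. *)
Let step v t := A' (g t - N (primitive b v t) - convolution Q (primitive b v) t).
Let picard n := iter n step (fun=> 0).

Lemma ccont_step v : ccont b v -> ccont b (step v).
Proof.
move=> hv; apply: ccont_bop; apply: ccont_sub; last first.
  by apply: ccont_conv => //; exact: ccont_primitive.
by apply: ccont_sub => //; apply: ccont_bop; exact: ccont_primitive.
Qed.

Lemma ccont_picard n : ccont b (picard n).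
Proof. by elim: n => [|n IH]; [exact: ccont0|exact: ccont_step]. Qed.

Let gam : R := 2 * (`|A'| * (`|N| + kmass Q)) + 1.
Let E (t : R) := expR (gam * (t - b)).

Let gam1 : 0 < gam.
Proof.
by rewrite /gam ltr_wpDl// mulr_ge0// mulr_ge0// addr_ge0// kmass_ge0.
Qed.

Let E_mono s t : s <= t -> E s <= E t.
Proof. by move=> st; rewrite ler_expR ler_wpM2l ?(ltW gam1)// lerD2r. Qed.

(** One primitive turns the bound [D * E] into [D / gam * E]. The operators contribute the factor
    [|A'| (|N| + kmass Q)], which is at most [gam / 2] by the choice of [gam]. *)
Lemma step_contract v w (D t : R) : ccont b v -> ccont b w -> 0 <= D ->
  (forall s, b <= s <= t -> `|v s - w s| <= D * E s) ->
  forall s, b <= s <= t -> `|step v s - step w s| <= D / 2 * E s.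
Proof.
move=> hv hw D0 vw s /andP[bs st].
have hvw := ccont_sub hv hw.
have E0 r : 0 <= E r by rewrite ltW// expR_gt0.
have pvw r : primitive b v r - primitive b w r = primitive b (fun t => v t - w t) r.
  have -> : (fun t => v t - w t) = (fun t => v t + (-1) *: w t).
    by apply/funext => x; rewrite scaleN1r.
  by rewrite primitive_add ?primitive_scale ?scaleN1r//; exact: ccont_scale.
have pE r : r <= s -> `|primitive b (fun t => v t - w t) r| <= D / gam * E s.
  move=> rs; have [rb|/ltW br] := leP r b.
    by rewrite primitive0// normr0 mulr_ge0// divr_ge0// ltW.
  apply: (@le_trans _ _ (D / gam * E r)); last first.
    by rewrite ler_wpM2l ?E_mono// divr_ge0// ltW.
  apply: (le_trans (@primitive_le R H b _ (fun x => D / gam * E x) (fun x => D * E x)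
     r hvw br _ _)).
  - move=> x _; have := is_deriveZ (D / gam) (expR_lin_is_derive gam b x).
    move=> /is_derive_eq; apply; rewrite /GRing.scale /= /E; field; exact: lt0r_neq0.
  - by move=> x /andP[bx xr]; apply: vw; rewrite bx (le_trans xr)// (le_trans rs).
  - by rewrite gerBl mulr_ge0// divr_ge0// ltW.
have lv := ccont_lbounded (ccont_primitive hv).
have lw := ccont_lbounded (ccont_primitive hw).
have -> : step v s - step w s = - A' (N (primitive b (fun t => v t - w t) s) +
    convolution Q (primitive b (fun t => v t - w t)) s).
  have -> : primitive b (fun t => v t - w t) = (fun r => primitive b v r - primitive b w r).
    by apply/funext => r; rewrite pvw.
  rewrite (conv_sub _ hQ lv lw) [X in A' (X + _)]linearB.
  transitivity (A' ((g s - N (primitive b v s) - convolution Q (primitive b v) s) -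
    (g s - N (primitive b w s) - convolution Q (primitive b w) s))).
    by rewrite [RHS]linearB.
  rewrite -[RHS](linearN A'); congr (A' _).
  exact: subr_sub4.
rewrite normrN (le_trans (bop_le _ _))//.
have D1 : 0 <= D / gam * E s by rewrite mulr_ge0// divr_ge0// ltW.
have h1 : `|N (primitive b (fun t => v t - w t) s)| <= `|N| * (D / gam * E s).
  by rewrite (le_trans (bop_le _ _))// ler_wpM2l// pE.
have h2 : `|convolution Q (primitive b (fun t => v t - w t)) s| <= kmass Q * (D / gam * E s).
  exact: (convolution_le hQ (ccont_lbounded (ccont_primitive hvw)) D1 pE).
apply: (le_trans (ler_wpM2l _ (le_trans (ler_normD _ _) (lerD h1 h2)))) => //.
rewrite -mulrDl mulrA.
have -> : D / 2 * E s = gam / 2 * (D / gam * E s) by field; exact: lt0r_neq0.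
by rewrite ler_wpM2r// ler_pdivlMr// /gam mulrC lerDl.
Qed.

Lemma picard_lucauchy : lucauchy picard.
Proof.
move=> T e e0.
have [D D0 hD] := ccont_bounded T (ccont_picard 1).
have E1 s : b <= s -> 1 <= E s.
  by move=> bs; rewrite -expR0 ler_expR mulr_ge0 ?subr_ge0// ltW.
have diff n s : b <= s <= T -> `|picard n.+1 s - picard n s| <= D / 2 ^+ n * E s.
  elim: n s => [|n IH] s.
    move=> /andP[bs sT]; rewrite expr0 divr1 /= subr0 (le_trans (hD s sT))//.
    by rewrite ler_peMr// E1.
  move=> bsT; have -> : D / 2 ^+ n.+1 = D / 2 ^+ n / 2 by rewrite exprS; field; rewrite expf_neq0.
  apply: (step_contract (ccont_picard n.+1) (ccont_picard n) _ IH) => //.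
  by rewrite divr_ge0// exprn_ge0.
(* [2 - 2 / 2 ^+ k] is the geometric sum of [2^-i] over [i < k]. *)
have tail n k s : b <= s <= T ->
    `|picard (n + k)%N s - picard n s| <= (2 - 2 / 2 ^+ k) * (D / 2 ^+ n) * E s.
  move=> bsT; elim: k => [|k IH].
    by rewrite addn0 subrr normr0 expr0 divr1 subrr !mul0r.
  rewrite addnS -(subrKA (picard (n + k)%N s)) (le_trans (ler_normD _ _))//.
  rewrite (le_trans (lerD (diff _ _ bsT) IH))// -mulrDl ler_wpM2r//.
    by rewrite ltW// expR_gt0.
  rewrite le_eqVlt; apply/orP; left; apply/eqP; rewrite exprD exprS; field.
  by rewrite !expf_neq0.
have ET0 : 0 < 2 * D * E T + 1.
  by rewrite ltr_wpDl// mulr_ge0 ?mulr_ge0// ltW// expR_gt0.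
have [M MP] : exists M : nat, forall n, (M <= n)%N -> (2 ^+ n)^-1 <= e / (2 * D * E T + 1).
  have h : 0 < e / (2 * D * E T + 1) by rewrite divr_gt0.
  have := @cvg_geometric R 1 (2^-1) _; rewrite ger0_norm// invf_lt1// ltr1n => /(_ isT).
  move=> /cvg_seqP /(_ _ h)[M MP]; exists M => n /MP.
  by rewrite subr0 /geometric /= mul1r exprVn ger0_norm// invr_ge0 exprn_ge0.
have aux n k s : (M <= n)%N -> s <= T -> `|picard (n + k)%N s - picard n s| <= e.
  move=> Mn sT; have [sb|/ltW bs] := leP s b.
    by rewrite !(ccont_picard _).2// subrr normr0 ltW.
  have bsT : b <= s <= T by rewrite bs.
  rewrite (le_trans (tail n k s bsT))//.
  apply: (@le_trans _ _ (2 * D * E T * (2 ^+ n)^-1)).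
    have -> : 2 * D * E T * (2 ^+ n)^-1 = 2 * (D / 2 ^+ n) * E T by ring.
    have Dn : 0 <= D / 2 ^+ n by rewrite divr_ge0// exprn_ge0.
    have k0 : 0 <= 2 / 2 ^+ k :> R by rewrite divr_ge0// exprn_ge0.
    apply: ler_pM; [|by rewrite ltW// expR_gt0| |exact: E_mono].
      rewrite mulr_ge0// subr_ge0 ler_pdivrMr ?exprn_gt0// ler_peMr//.
      by rewrite exprn_ege1// ler1n.
    by rewrite ler_wpM2r// gerBl.
  have := MP n Mn; rewrite ler_pdivlMr// => h; apply: le_trans h.
  by rewrite mulrC ler_wpM2l ?lerDl// invr_ge0 exprn_ge0.
exists M => n m Mn Mm s sT; have [nm|/ltnW mn] := leqP n m.
  by rewrite distrC -(subnKC nm) aux.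
by rewrite -(subnKC mn) aux.
Qed.

Lemma volterra : exists2 v, ccont b v & forall t,
  A (v t) + N (primitive b v t) + convolution Q (primitive b v) t = g t.
Proof.
have [v vP] := lucauchy_conv picard_lucauchy.
have hv : ccont b v := luconv_ccont ccont_picard vP.
exists v => // t.
have pv : luconv (fun n => primitive b (picard n)) (primitive b v).
  exact: luconv_primitive ccont_picard hv vP.
have cp n : ccont b (primitive b (picard n)) by exact/ccont_primitive/ccont_picard.
have sv : luconv (fun n => step (picard n)) (step v).
  apply: luconv_bop; apply: luconv_add.
    apply: luconv_add; first exact: luconv_cst.
    by apply: luconv_opp; exact: luconv_bop.
  apply: luconv_opp; apply: luconv_conv => //.
  exact: ccont_primitive.
have vE : v t = step v t.
  apply: (cvg_unique _ _ (luconv_cvg (t := t) sv)) => //.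
  have := luconv_cvg (t := t) vP.
  by move=> /(cvg_comp (addn 1) (fun n => picard n t)); apply; exact: cvg_addnl.
by rewrite {1}vE /step AA' [X in X + _]addrAC subrK subrK.
Qed.

End Volterra.

(* Proves linear identities between vectors by testing against an arbitrary
   vector; abstracting the atoms first keeps unification fast. *)
Ltac vring :=
  repeat match goal with
  | |- context [convolution ?Q ?u ?t] => generalize (convolution Q u t); intro
  | |- context [primitive ?b ?u ?t] => generalize (primitive b u t); intro
  | |- context [bop_fun ?B ?x] => generalize (bop_fun B x); intro
  end;
  apply: dotp_inj => ?; rewrite !(dotpDl, dotpNl, dotpZl);
  repeat match goal with |- context [dotp ?x ?y] => generalize (dotp x y); intro end;
  ring.

(** * Energy estimate for the equation *)

Section EnergyForEquation.
Variables (R : realType) (H : hilbertType R).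
Variables (A B : bop H) (Q : R -> bop H) (c kappa : R).
Hypotheses (c0 : 0 < c) (sA : selfadjoint A).
Hypothesis cA : forall x, c * dotp x x <= dotp (A x) x.
Hypotheses (hQ : causal_kernel Q) (BQ : `|B| + kmass Q <= kappa).

(** The term [p] stands for [P u] or an approximation of it. [delta = 0] serves exact solutions and
    single Yosida approximations; a positive [delta] serves differences of two Yosida
    approximations, for which monotonicity holds only up to an error. *)
Lemma energy_equation (b T delta : R) (u u' p f : R -> H) (g G : R -> R) :
  ccont b u -> (forall t : R, is_derive t 1 u (u' t)) -> b <= T -> 0 <= delta ->
  (forall t, b <= t <= T -> A (u' t) + p t + B (u t) + convolution Q u t = f t) ->
  (forall t, b <= t <= T -> - delta <= dotp (p t) (u t)) ->
  (forall t, b <= t <= T -> `|f t| <= g t) ->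
  (forall t : R, b <= t <= T -> is_derive t 1 G (g t)) -> G b = 0 ->
  forall t, b <= t <= T -> `|u t| ^+ 2 <= expR ((4 * kappa / c + 1) * (T - b)) ^+ 2 *
    (8 / c ^+ 2 * G T ^+ 2 + 4 / c * delta * (T - b)).
Proof.
move=> hu du bT d0 eq pd fg dG G0.
have kappa0 : 0 <= kappa by rewrite (le_trans _ BQ)// addr_ge0// kmass_ge0.
apply: (@energy_estimate R H A c kappa b T delta u u' g G) => //.
  by move=> t /fg; exact: le_trans.
move=> t bt N N0 uN.
have -> : A (u' t) = f t - B (u t) - convolution Q u t - p t.
  by rewrite -eq//; vring.
rewrite !dotpBl; have pt := pd t bt.
have h1 : dotp (f t) (u t) <= `|u t| * g t.
  by rewrite (le_trans (dotp_le _ _))// mulrC ler_wpM2l// fg.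
have h2 : - dotp (B (u t)) (u t) <= `|u t| * (`|B| * N).
  rewrite -dotpNl (le_trans (dotp_le _ _))// normrN mulrC ler_wpM2l//.
  by rewrite (le_trans (bop_le _ _))// ler_wpM2l// uN.
have h3 : - dotp (convolution Q u t) (u t) <= `|u t| * (kmass Q * N).
  rewrite -dotpNl (le_trans (dotp_le _ _))// normrN mulrC ler_wpM2l//.
  exact: convolution_le (ccont_lbounded hu) _ _.
have h4 : `|u t| * ((`|B| + kmass Q) * N) <= `|u t| * (kappa * N).
  by rewrite ler_wpM2l// ler_wpM2r.
lra.
Qed.

End EnergyForEquation.

Lemma sqr_le_le (R : realType) (x y : R) : 0 <= y -> x ^+ 2 <= y ^+ 2 -> x <= y.
Proof.
move=> y0 xy; have [x0|/ltW x0] := leP 0 x; last exact: le_trans y0.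
by rewrite -(@ler_pXn2r _ 2)// ?nnegrE.
Qed.

(** * Strong solutions: stability, integration in time, and smooth data *)

Section StrongSolutions.
Variables (R : realType) (H V : hilbertType R) (j P : {linear V -> H}).
Hypothesis P_skew : skew_adjoint j P.
Hypothesis P_graph : exists c C : R, 0 < c /\
  forall v, c * `|v| <= `|j v| + `|P v| <= C * `|v|.
Local Notation weakP := (weakP j P).

(** The value of [P u] is read off the equation, so no lift to [V] appears. With [u'] as an explicit
    argument, the notion passes to locally uniform limits. *)
Definition strong (b : R) (A B : bop H) (Q : R -> bop H) (g u u' : R -> H) : Prop :=
  [/\ ccont b u, ccont b u', forall t : R, is_derive t 1 u (u' t) &
      forall t, weakP (u t) (g t - A (u' t) - B (u t) - convolution Q u t)].

(* Coercivity constant of [A] and a bound for [B] and [Q], uniform over the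
   perturbed coefficients. *)
Definition good_coeffs (c kappa : R) (A B : bop H) (Q : R -> bop H) : Prop :=
  [/\ selfadjoint A, forall x, c * dotp x x <= dotp (A x) x, causal_kernel Q &
      `|B| + kmass Q <= kappa].

(** [3 / c] majorizes the square root of [8 / c ^ 2], and [L] is the length of the time interval.
    The value depends on the coefficients only through [c] and [kappa]. *)
Definition energy_const (c kappa L : R) : R := expR ((4 * kappa / c + 1) * L) * (3 / c).

Lemma energy_const_ge0 c kappa L : 0 < c -> 0 <= energy_const c kappa L.
Proof. by move=> c0; rewrite mulr_ge0 ?divr_ge0// ltW// expR_gt0. Qed.

(** With [g] equal to the norm of [f], the number [G T] is the [L^1] norm of [f] on [[b, T]]; this
    form allows data that converge only in [L^1]. *)
Lemma strong_estimate (c kappa b T : R) A B Q f u u' (g G : R -> R) :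
  0 < c -> good_coeffs c kappa A B Q -> strong b A B Q f u u' -> b <= T ->
  (forall t, b <= t <= T -> `|f t| <= g t) ->
  (forall t : R, b <= t <= T -> is_derive t 1 G (g t)) -> G b = 0 -> 0 <= G T ->
  forall t, t <= T -> `|u t| <= energy_const c kappa (T - b) * G T.
Proof.
move=> c0 [sA cA hQ BQ] [hu hu' du wP] bT fg dG G0 GT t tT.
have K0 : 0 <= energy_const c kappa (T - b) * G T.
  by rewrite mulr_ge0// energy_const_ge0.
have [tb|/ltW bt] := leP t b; first by rewrite (hu.2 t tb) normr0.
apply: sqr_le_le => //.
apply: (le_trans (@energy_equation R H A B Q c kappa c0 sA cA hQ BQ b T 0 u u'
  (fun s => f s - A (u' s) - B (u s) - convolution Q u s) f g G hu du bT (lexx _)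
  _ _ fg dG G0 t _)).
- by move=> s _; vring.
- by move=> s _; rewrite oppr0 (weakP_orth P_skew (wP s)).
- by rewrite bt.
rewrite mulr0 mul0r addr0 /energy_const; set E := expR _.
have -> : (E * (3 / c) * G T) ^+ 2 = E ^+ 2 * (9 / c ^+ 2 * G T ^+ 2).
  by field; rewrite gt_eqF.
rewrite ler_wpM2l ?sqr_ge0// ler_wpM2r ?sqr_ge0// ler_wpM2r ?invr_ge0 ?sqr_ge0//.
by rewrite ler_nat.
Qed.

Lemma strong_bound (c kappa b T m : R) A B Q f u u' :
  0 < c -> good_coeffs c kappa A B Q -> strong b A B Q f u u' -> b <= T -> 0 <= m ->
  (forall t, b <= t <= T -> `|f t| <= m) ->
  forall t, t <= T -> `|u t| <= energy_const c kappa (T - b) * (m * (T - b)).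
Proof.
move=> c0 hc hs bT m0 fm.
apply: (strong_estimate (g := fun=> m) (G := fun s => m * (s - b)) c0 hc hs bT fm).
- move=> t _; have := is_deriveZ m (is_deriveB (is_derive_id t (1 : R)) (is_derive_cst b t 1)).
  by rewrite subr0 => /is_derive_eq; apply; rewrite /GRing.scale /= mulr1.
- by rewrite subrr mulr0.
- by rewrite mulr_ge0// subr_ge0.
Qed.

Lemma strong_sub b A B Q f g u u' v v' : causal_kernel Q ->
  strong b A B Q f u u' -> strong b A B Q g v v' ->
  strong b A B Q (fun t => f t - g t) (fun t => u t - v t) (fun t => u' t - v' t).
Proof.
move=> hQ [hu hu' du wu] [hv hv' dv wv]; split.
- exact: ccont_sub.
- exact: ccont_sub.
- by move=> t; exact: is_deriveB.
- move=> t; have := weakP_sub (wu t) (wv t); congr weakP.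
  rewrite (conv_sub _ hQ (ccont_lbounded hu) (ccont_lbounded hv)) !bop_sub.
  vring.
Qed.

Lemma weakP_primitive b (u p : R -> H) t : ccont b u -> ccont b p ->
  (forall s, weakP (u s) (p s)) -> weakP (primitive b u t) (primitive b p t).
Proof.
move=> [cu _] [cp _] up v; rewrite -dotpNl ![dotp _ (primitive _ _ _)]dotpC.
rewrite [LHS](dotp_primitive _ _ _ cu) [RHS](dotp_primitive _ _ _ cp).
by apply: eq_Rintegral => s _; rewrite dotpC up dotpC dotpNr.
Qed.

(** The coefficients do not depend on time, so the primitive of the prescribed value of [P u] is the
    value prescribed by the integrated equation. The new solution has derivative [u], so convergence
    of [u] alone will control it. *)
Lemma strong_lift b A B Q f u u' : causal_kernel Q -> ccont b f ->
  strong b A B Q f u u' ->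
  strong b A B Q (primitive b f) (primitive b u) u.
Proof.
move=> hQ hf [hu hu' du wu]; have hI := ccont_primitive hu.
split; [exact: hI|exact: hu|exact: is_derive_primitive|].
pose p t := f t - A (u' t) - B (u t) - convolution Q u t.
have hp : ccont b p.
  apply: ccont_sub; last exact: ccont_conv hQ hu.
  apply: ccont_sub; last exact: ccont_bop hu.
  by apply: ccont_sub; [exact: hf|exact: ccont_bop hu'].
move=> t; have := weakP_primitive t hu hp wu; congr weakP.
suff -> : primitive b p = fun t => primitive b f t - A (u t) - B (primitive b u t) -
    convolution Q (primitive b u) t by [].
apply/esym/primitive_unique => // [s sb|s].
  rewrite (ccont_primitive hf).2// hu.2// hI.2// (ccont_conv hQ hI).2//.
  by rewrite !bop_zero ?oppr0 !addr0.
apply: is_deriveB; last exact: is_derive_conv hQ hI hu (is_derive_primitive hu) s.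
apply: is_deriveB; last by apply: is_derive_bop; exact: is_derive_primitive.
by apply: is_deriveB; [exact: is_derive_primitive|exact: is_derive_bop].
Qed.

(** Only the derivatives have to converge, since the solutions are their primitives. For the data
    pointwise convergence is enough, by closedness of [P]. *)
Lemma strong_limit b A B Q (f_ u_ u'_ : nat -> R -> H) f u' : causal_kernel Q ->
  (forall n, strong b A B Q (f_ n) (u_ n) (u'_ n)) ->
  luconv u'_ u' -> (forall t, f_ n t @[n --> \oo] --> f t) ->
  strong b A B Q f (primitive b u') u'.
Proof.
move=> hQ hs uu ff.
have hu'_ n : ccont b (u'_ n) by case: (hs n).
have hu' : ccont b u' := luconv_ccont hu'_ uu.
have u_E n : u_ n = primitive b (u'_ n).
  by have [[_ u0] hu du _] := hs n; exact: primitive_unique.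
have hu_ n : ccont b (u_ n) by case: (hs n).
have hu : ccont b (primitive b u') := ccont_primitive hu'.
have u_u : luconv u_ (primitive b u').
  by have := luconv_primitive hu'_ hu' uu; congr luconv; apply/funext => n.
split; [exact: hu|exact: hu'|exact: is_derive_primitive|].
move=> t; apply: (weakP_cvg (fun n => (let: And4 _ _ _ w := hs n in w) t)).
  exact: luconv_cvg.
apply: cvgB; last exact: (luconv_cvg (luconv_conv hQ hu_ hu u_u)).
apply: cvgB; last exact: (luconv_cvg (luconv_bop B u_u)).
by apply: cvgB; [exact: ff|exact: (luconv_cvg (luconv_bop A uu))].
Qed.

Lemma lift_equation b (A N : bop H) Q g w : causal_kernel Q -> ccont b g -> ccont b w ->
  (forall t, A (w t) + N (primitive b w t) + convolution Q (primitive b w) t = g t) ->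
  forall t, A (primitive b w t) + N (primitive b (primitive b w) t) +
    convolution Q (primitive b (primitive b w)) t = primitive b g t.
Proof.
move=> hQ hg hw eq t; have hI := ccont_primitive hw; have hII := ccont_primitive hI.
pose F t := A (primitive b w t) + N (primitive b (primitive b w) t) +
    convolution Q (primitive b (primitive b w)) t.
suff -> : primitive b g = F by [].
apply/esym/primitive_unique => // [s sb|s].
  by rewrite /F hI.2// hII.2// (ccont_conv hQ hII).2// !bop_zero !addr0.
rewrite -eq; apply: is_deriveD.
  by apply: is_deriveD; apply: is_derive_bop; exact: is_derive_primitive.
exact: is_derive_conv hQ hII hI (is_derive_primitive hI) s.
Qed.

(** [u2], [u1], [u0] solve the Yosida equations with data [g], [I g], [I I g], and each is the
    derivative of the next. The energy bounds for [u2] and [u1] bound [K n (u1 n)], whence [u1] is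
    Cauchy; its limit [w] is the derivative of the limit of [u0]. *)
Lemma smooth_existence (c kappa b : R) A B Q g : 0 < c ->
  good_coeffs c kappa A B Q -> ccont b g ->
  exists u, strong b A B Q (primitive b (primitive b g)) (primitive b u) u.
Proof.
move=> c0 [sA cA hQ BQ] hg.
have [A' AA'] := coercive_inverse c0 cA.
pose l n : R := n.+1%:R^-1.
have l0 n : 0 < l n by rewrite /l invr_gt0.
have [K KP] := choice (fun n => yosida_ex P_skew P_graph (l0 n)).
have vex n : exists v, ccont b v /\ forall t, A (v t) + (K n + B) (primitive b v t) +
    convolution Q (primitive b v) t = g t.
  by have [v hv eq] := volterra (K n + B) AA' hQ hg; exists v.
have [v vP] := choice vex.
have hv n : ccont b (v n) by case: (vP n).
pose u2 n := primitive b (v n); pose u1 n := primitive b (u2 n).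
pose u0 n := primitive b (u1 n).
have hu2 n : ccont b (u2 n) := ccont_primitive (hv n).
have hu1 n : ccont b (u1 n) := ccont_primitive (hu2 n).
have hu0 n : ccont b (u0 n) := ccont_primitive (hu1 n).
have hg1 := ccont_primitive hg; have hg0 := ccont_primitive hg1.
have eq2 n t : A (v n t) + (K n + B) (u2 n t) + convolution Q (u2 n) t = g t.
  by case: (vP n) => _; apply.
have eq1 n t : A (u2 n t) + (K n + B) (u1 n t) + convolution Q (u1 n) t = primitive b g t.
  exact: lift_equation hQ hg (hv n) (eq2 n) t.
have eq0 n t : A (u1 n t) + (K n + B) (u0 n t) + convolution Q (u0 n) t =
    primitive b (primitive b g) t.
  exact: lift_equation hQ hg1 (hu2 n) (eq1 n) t.
have addE n x : (K n + B) x = K n x + B x by [].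
have du2 n : forall t : R, is_derive t 1 (u2 n) (v n t) := is_derive_primitive (hv n).
have du1 n : forall t : R, is_derive t 1 (u1 n) (u2 n t) := is_derive_primitive (hu2 n).
have Kmono n x : 0 <= dotp (K n x) x.
  exact: (yosida_monotone P_skew (ltW (l0 n)) (KP n x)).
have energy T (u u' : nat -> R -> H) (f : R -> H) (m : R) : b <= T -> 0 <= m ->
    (forall n, ccont b (u n)) -> (forall n (t : R), is_derive t 1 (u n) (u' n t)) ->
    (forall n t, A (u' n t) + (K n + B) (u n t) + convolution Q (u n) t = f t) ->
    (forall t, t <= T -> `|f t| <= m) ->
    exists2 M : R, 0 <= M & forall n t, t <= T -> `|u n t| <= M.
  move=> bT m0 hu du eq fm.
  exists (energy_const c kappa (T - b) * (m * (T - b))).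
    by rewrite mulr_ge0 ?energy_const_ge0// mulr_ge0// subr_ge0.
  move=> n t tT; have mT : 0 <= m * (T - b) by rewrite mulr_ge0// subr_ge0.
  have [tb|/ltW bt] := leP t b.
    by rewrite (hu n).2// normr0 mulr_ge0// energy_const_ge0.
  apply: sqr_le_le; first by rewrite mulr_ge0// energy_const_ge0.
  apply: (le_trans (@energy_equation R H A B Q c kappa c0 sA cA hQ BQ b T 0 (u n) (u' n)
    (fun s => K n (u n s)) f (fun=> m) (fun s => m * (s - b)) (hu n) (du n) bT (lexx _)
    _ _ _ _ _ t _)).
  - by move=> s _; rewrite -(eq n s) addE; vring.
  - by move=> s _; rewrite oppr0.
  - by move=> s /andP[_ /fm].
  - move=> s _.
    have := is_deriveZ m (is_deriveB (is_derive_id s (1 : R)) (is_derive_cst b s 1)).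
    by rewrite subr0 => /is_derive_eq; apply; rewrite /GRing.scale /= mulr1.
  - by rewrite subrr mulr0.
  - by rewrite bt.
  rewrite mulr0 mul0r addr0 /energy_const; set E := expR _.
  have -> : (E * (3 / c) * (m * (T - b))) ^+ 2 = E ^+ 2 * (9 / c ^+ 2 * (m * (T - b)) ^+ 2).
    by field; rewrite gt_eqF.
  rewrite ler_wpM2l ?sqr_ge0// ler_wpM2r ?sqr_ge0// ler_wpM2r ?invr_ge0 ?sqr_ge0//.
  by rewrite ler_nat.
have cu1 : lucauchy u1.
  move=> T e e0; pose T' := Num.max T b.
  have bT' : b <= T' by rewrite le_max lexx orbT.
  have [m m0 gm] := ccont_bounded T' hg.
  have [m1 m10 g1m] := ccont_bounded T' hg1.
  have [M2 M20 u2M] := energy T' u2 v g m bT' m0 hu2 du2 eq2 gm.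
  have [M1 M10 u1M] := energy T' u1 u2 _ m1 bT' m10 hu1 du1 eq1 g1m.
  (* The equation of [u1] expresses [K n (u1 n)] through terms bounded uniformly in [n]. *)
  pose M := m1 + `|A| * M2 + `|B| * M1 + kmass Q * M1.
  have KM n t : t <= T' -> `|K n (u1 n t)| <= M.
    move=> tT.
    have -> : K n (u1 n t) = primitive b g t - A (u2 n t) - B (u1 n t) - convolution Q (u1 n) t.
      by rewrite -(eq1 n t) addE; vring.
    rewrite (le_trans (ler_normB _ _))// lerD//; last first.
      apply: convolution_le => //; first exact: ccont_lbounded (hu1 n).
      by move=> s st; apply: u1M; exact: le_trans tT.
    rewrite (le_trans (ler_normB _ _))// lerD//; last first.
      by rewrite (le_trans (bop_le _ _))// ler_wpM2l// u1M.
    rewrite (le_trans (ler_normB _ _))// lerD// ?g1m//.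
    by rewrite (le_trans (bop_le _ _))// ler_wpM2l// u2M.
  pose E := expR ((4 * kappa / c + 1) * (T' - b)).
  pose C := E ^+ 2 * (4 / c * (2 * M ^+ 2) * (T' - b)).
  have C0 : 0 <= C.
    apply: mulr_ge0; first exact: sqr_ge0.
    apply: mulr_ge0; last by rewrite subr_ge0.
    apply: mulr_ge0; first by rewrite divr_ge0// ltW.
    by apply: mulr_ge0 => //; exact: sqr_ge0.
  (* If [l n] and [l k] are both below this threshold, then [C (l n + l k) <= e ^ 2]. *)
  have h : 0 < e ^+ 2 / (2 * (C + 1)).
    by rewrite divr_gt0 ?exprn_gt0// mulr_gt0// ltr_wpDl.
  have [N NP] := (cvg_seqP _ _).1 (@cvg_harmonic R) _ h.
  have lN n : (N <= n)%N -> l n <= e ^+ 2 / (2 * (C + 1)).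
    by move=> /NP; rewrite subr0 /harmonic /= ger0_norm.
  exists N => n k Nn Nk t tT.
  have tT' : t <= T' by rewrite le_max tT.
  have [tb|/ltW bt] := leP t b; first by rewrite !(hu1 _).2// subrr normr0 ltW.
  apply: sqr_le_le; first exact: ltW.
  apply: (le_trans (@energy_equation R H A B Q c kappa c0 sA cA hQ BQ b T'
    (2 * M ^+ 2 * (l n + l k)) (fun s => u1 n s - u1 k s) (fun s => u2 n s - u2 k s)
    (fun s => K n (u1 n s) - K k (u1 k s)) (fun=> 0) (fun=> 0) (fun=> 0)
    (ccont_sub (hu1 n) (hu1 k)) _ bT' _ _ _ _ _ _ t _)) => //.
  - apply: mulr_ge0; first by apply: mulr_ge0 => //; exact: sqr_ge0.
    by apply: addr_ge0; exact: ltW.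
  - move=> s _; rewrite -[RHS](subrr (primitive b g s)) -{1}(eq1 n s) -(eq1 k s) !addE.
    rewrite (conv_sub _ hQ (ccont_lbounded (hu1 n)) (ccont_lbounded (hu1 k))) !bop_sub.
    by vring.
  - move=> s /andP[_ sT]; apply: (yosida_diff_lower P_skew) (KP n _) (KP k _) _ _.
    + exact: ltW.
    + exact: ltW.
    + exact: KM.
    + exact: KM.
  - by move=> s _; rewrite normr0.
  - by rewrite bt.
  rewrite expr0n /= mulr0 add0r.
  have -> : expR ((4 * kappa / c + 1) * (T' - b)) ^+ 2 *
      (4 / c * (2 * M ^+ 2 * (l n + l k)) * (T' - b)) = C * (l n + l k).
    by rewrite /C /E; ring.
  have C1 : 0 < C + 1 by rewrite ltr_wpDl.
  apply: (@le_trans _ _ ((C + 1) * (l n + l k))).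
    by rewrite ler_wpM2r ?lerDl// addr_ge0// ltW.
  apply: (@le_trans _ _ ((C + 1) * (e ^+ 2 / (2 * (C + 1)) + e ^+ 2 / (2 * (C + 1))))).
    by rewrite ler_wpM2l ?(ltW C1)// lerD ?lN.
  by rewrite le_eqVlt; apply/orP; left; apply/eqP; field; rewrite gt_eqF.
have [w wP] := lucauchy_conv cu1; exists w.
have hw : ccont b w := luconv_ccont hu1 wP.
have u0w : luconv u0 (primitive b w) := luconv_primitive hu1 hw wP.
have hIw := ccont_primitive hw.
split; [exact: hIw|exact: hw|exact: is_derive_primitive|].
move=> t.
(* The equation shows that the Yosida terms converge. Hence the resolvents [u0 - l K u0] have the
   same limit as [u0], and closedness of [P] applies. *)
have KE n : K n (u0 n t) = primitive b (primitive b g) t - A (u1 n t) - B (u0 n t) -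
    convolution Q (u0 n) t.
  by rewrite -(eq0 n t) addE; vring.
have Kcvg : K n (u0 n t) @[n --> \oo] --> primitive b (primitive b g) t - A (w t) -
    B (primitive b w t) - convolution Q (primitive b w) t.
  under eq_fun do rewrite KE.
  apply: cvgB; last exact: (luconv_cvg (luconv_conv hQ hu0 hIw u0w)).
  apply: cvgB; last exact: (luconv_cvg (luconv_bop B u0w)).
  by apply: cvgB; [exact: cvg_cst|exact: (luconv_cvg (luconv_bop A wP))].
apply: (weakP_cvg (fun n => KP n (u0 n t)) _ Kcvg).
rewrite -[X in _ --> X]subr0; apply: cvgB; first exact: luconv_cvg.
rewrite -[X in _ --> X](scale0r (primitive b (primitive b g) t - A (w t) -
    B (primitive b w t) - convolution Q (primitive b w) t)).
by apply: cvgZ => //; exact: cvg_harmonic.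
Qed.

End StrongSolutions.

(** * Density and rough data *)

Section Density.
Variables (R : realType) (H : hilbertType R).
Local Notation T := (measurableTypeR R).
Local Notation mu := (@lebesgue_measure R).
Local Notation integrable f := (mu.-integrable setT (EFin \o f)).
Implicit Types (f g s : T -> H).

Lemma sm_sub f g : strongly_measurable f -> strongly_measurable g ->
  strongly_measurable (fun t => f t - g t).
Proof. by apply: (sm_op2 (op := fun x y : H => x - y)) => x_ y_ x y; exact: cvgB. Qed.

Lemma integrable_indicM (D : set T) (h : T -> R) : measurable D -> integrable h ->
  integrable (fun t => \1_D t * h t).
Proof.
move=> mD ih; apply: integrable_le (integrable_norm ih) => [|t].
  by apply: measurable_funM; [exact: measurable_indic|
    case/integrableP: ih => /measurable_EFinP].
by rewrite normrM /= indicE; case: (t \in D); rewrite ?normr1 ?mul1r ?normr0 ?mul0r.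
Qed.

Lemma bintegrable_indic (D : set T) f : measurable D -> bintegrable f ->
  bintegrable (fun t => \1_D t *: f t).
Proof.
move=> mD [mf intf]; apply: bintegrable_le (integrable_indicM mD intf).
  by apply: sm_scale => //; exact: sm_indic.
by move=> t; rewrite normrZ ger0_norm.
Qed.

Lemma int_triangle f g s : bintegrable f -> bintegrable g -> bintegrable s ->
  \int[mu]_t `|f t - s t| <= \int[mu]_t `|f t - g t| + \int[mu]_t `|g t - s t|.
Proof.
move=> bf bg bs.
have i1 := (bintegrable_sub bf bg).2; have i2 := (bintegrable_sub bg bs).2.
rewrite -(RintegralD measurableT i1 i2); apply: le_int.
- by case: (bintegrable_sub bf bs).
- exact: (integrable_add i1 i2).
- by move=> t; rewrite -(subrKA (g t)) ler_normD.
Qed.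

Lemma int_dist_sym f g : \int[mu]_t `|f t - g t| = \int[mu]_t `|g t - f t|.
Proof. by apply: eq_Rintegral => t _; rewrite distrC. Qed.

Lemma simple_dense f (e : R) : bintegrable f -> 0 < e ->
  exists2 s, simple_integrable s & \int[mu]_t `|f t - s t| <= e.
Proof.
move=> bf e0; have [w [_ [s_ [ss sf _]]]] := has_bochner_integral_ex bf.
have [_ {}sf] := (fine_cvgP _ _).1 sf.
have [N NP] := (cvg_seqP _ _).1 sf e e0; exists (s_ N) => //.
by have := NP N (leqnn N); rewrite subr0; apply: le_trans; exact: ler_norm.
Qed.

Lemma indic_dense (E : set T) (b t : R) (e : R) : measurable E -> 0 < e ->
  exists2 h : R -> R, continuous h &
    \int[mu]_s (\1_(`[b, t] : set T) s * `|\1_E s - h s|) <= e.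
Proof.
move=> mE e0.
have mD : measurable (`[b, t] : set T) by exact: measurable_itv.
have fD : (mu (`[b, t] : set T) < +oo)%E.
  by rewrite lebesgue_measure_itv/=; case: ifP => // _; rewrite ltry.
have iE : mu.-integrable `[b, t] (EFin \o (\1_E : T -> R)).
  apply: (@measurable_bounded_integrable _ _ _ mu (\1_E : T -> R) `[b, t] mD fD).
    exact: measurable_indic.
  exists 1; split => // M M1 s _ /=.
  by rewrite indicE (le_trans _ (ltW M1))//; case: (s \in E); rewrite ?normr1 ?normr0.
have [h_ [ch ih hE]] := approximation_continuous_integrable mD fD iE.
have [_ {}hE] := (fine_cvgP _ _).1 hE.
have [N NP] := (cvg_seqP _ _).1 hE e e0; exists (h_ N) => //.
have := NP N (leqnn N); rewrite subr0 => /(le_trans (ler_norm _)).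
apply: le_trans; rewrite le_eqVlt; apply/orP; left; apply/eqP.
rewrite /= -[RHS]/(\int[mu]_(s in `[b, t]) `|\1_E s - h_ N s|) [RHS]Rintegral_mkcond.
by apply: eq_Rintegral => s _; rewrite patchE indicE; case: ifP => _; rewrite ?mul1r ?mul0r.
Qed.

Lemma continuous_dense s (b t : R) (e : R) : simple_integrable s -> 0 < e ->
  exists2 h : R -> H, continuous h &
    \int[mu]_r `|\1_(`[b, t] : set T) r *: s r - \1_(`[b, t] : set T) r *: h r| <= e.
Proof.
move=> [[fs ms] sfin] e0.
pose D : set T := `[b, t]%classic.
have mD : measurable D by exact: measurable_itv.
have sE r : s r = \sum_(y <- finmap.enum_fset (fset_set (range s))) \1_(s @^-1` [set y]) r *: y.
  rewrite (bigD1_seq (s r))/=; last first.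
    - exact: finmap.fset_uniq.
    - by rewrite in_fset_set// mem_set//; exists r.
  rewrite big1_seq ?addr0; last first.
    move=> y /andP[yst _]; rewrite indicE memNset ?scale0r//= => sty.
    by rewrite sty eqxx in yst.
  by rewrite indicE mem_set ?scale1r.
(* Generalized from the values of [s] to an arbitrary list of vectors, for an induction that halves
   the tolerance at each step. *)
suff main (l : seq H) (e' : R) : 0 < e' -> exists2 h : R -> H, continuous h &
    \int[mu]_r (\1_D r * `|\sum_(y <- l) \1_(s @^-1` [set y]) r *: y - h r|) <= e'.
  have [h ch hle] := main (finmap.enum_fset (fset_set (range s))) e e0.
  exists h => //; apply: le_trans hle; rewrite le_eqVlt; apply/orP; left; apply/eqP.
  by apply: eq_Rintegral => r _; rewrite -scalerBr normrZ ger0_norm// -sE.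
have ibd (k : T -> H) (M : R) : strongly_measurable k -> (forall r, D r -> `|k r| <= M) ->
    integrable (fun r => \1_D r * `|k r|).
  move=> mk kM; apply: (@integrable_le _ _ (fun r => \1_D r * M)).
  - by apply: measurable_funM; [exact: measurable_indic|exact: sm_measurable_norm].
  - move=> r; rewrite normrM normr_id indicE; case: (boolP (r \in D)) => [|_].
      by rewrite inE => /kM; rewrite normr1 !mul1r.
    by rewrite normr0 !mul0r.
  - by apply: integrable_mulr; exact: integrable_indic_itv.
elim: l e' => [|y l IH] e' e'0.
  exists (fun=> 0) => [|]; first by move=> x; exact: cvg_cst.
  rewrite (_ : (\int[mu]_r _) = 0) ?ltW//.
  by apply: Rintegral_eq0 => r _; rewrite big_nil subr0 normr0 mulr0.
have e2 : 0 < e' / 2 by rewrite divr_gt0.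
have [h ch hle] := IH _ e2.
have y0 : 0 < `|y| + 1 by rewrite ltr_wpDl.
have [k ck kle] := indic_dense b t (ms y) (divr_gt0 e2 y0).
exists (fun r => k r *: y + h r).
  by move=> x; apply: cvgD; [apply: cvgZ; [exact: ck|exact: cvg_cst]|exact: ch].
have msum l' : strongly_measurable (fun r => \sum_(z <- l') \1_(s @^-1` [set z]) r *: z).
  elim: l' => [|z l' IHl]; first by under eq_fun do rewrite big_nil; exact: sm_cst.
  under eq_fun do rewrite big_cons.
  by apply: sm_add => //; apply: sm_scale; [exact: sm_indic|exact: sm_cst].
have bsum l' : exists M : R, forall r, `|\sum_(z <- l') \1_(s @^-1` [set z]) r *: z| <= M.
  elim: l' => [|z l' [M IHl]]; first by exists 0 => r; rewrite big_nil normr0.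
  exists (`|z| + M) => r; rewrite big_cons (le_trans (ler_normD _ _))// lerD// normrZ.
  by rewrite indicE; case: (r \in _); rewrite ?normr1 ?mul1r ?normr0 ?mul0r.
have [M0 _ hM0] := continuous_bounded b t ch.
have [M1 _ hM1] := continuous_bounded b t ck.
have [M2 hM2] := bsum l.
have ih : integrable (fun r => \1_D r * `|\sum_(z <- l) \1_(s @^-1` [set z]) r *: z - h r|).
  apply: (ibd _ (M2 + M0)).
    exact: sm_sub (msum l) (sm_continuous ch).
  move=> r; rewrite /D /= in_itv/= => /hM0 hr.
  by rewrite (le_trans (ler_normB _ _))// lerD.
have ik : integrable (fun r => \1_D r * `|\1_(s @^-1` [set y]) r - k r|).
  apply: integrable_le (integrable_mulr (1 + M1) (integrable_indic_itv b t true false)).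
    apply: measurable_funM; first exact: measurable_indic.
    apply: measurableT_comp => //; apply: measurable_funB; first exact: measurable_indic.
    exact: continuous_measurable_fun.
  move=> r; rewrite normrM normr_id [X in X * _ <= _]ger0_norm// indicE.
  case: (boolP (r \in D)) => [|_]; last by rewrite !mul0r.
  rewrite inE /D /= in_itv/= => /hM1 hr; rewrite !mul1r.
  rewrite (le_trans (ler_normB _ _))// lerD//.
  by rewrite indicE; case: (r \in _); rewrite ?normr1 ?normr0.
apply: (@le_trans _ _ (\int[mu]_r ((\1_D r * `|\1_(s @^-1` [set y]) r - k r|) * `|y| +
    \1_D r * `|\sum_(z <- l) \1_(s @^-1` [set z]) r *: z - h r|))).
  apply: le_int.
  - apply: ibd (`|y| + M2 + (M1 * `|y| + M0)) _ _.
      have := sm_sub (msum (y :: l)) (sm_continuous _ : strongly_measurable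
        ((fun r => k r *: y + h r) : T -> H)).
      by apply => x; apply: cvgD; [apply: cvgZ; [exact: ck|exact: cvg_cst]|exact: ch].
    move=> r; rewrite /D /= in_itv/= => rD; rewrite (le_trans (ler_normB _ _))// lerD//.
      rewrite big_cons (le_trans (ler_normD _ _))// lerD// normrZ indicE.
      by case: (r \in _); rewrite ?normr1 ?mul1r ?normr0 ?mul0r.
    rewrite (le_trans (ler_normD _ _))// lerD//; last exact: hM0.
    by rewrite normrZ ler_wpM2r// hM1.
  - exact: (integrable_add (integrable_mulr `|y| ik) ih).
  - move=> r; rewrite -mulrA -mulrDr ler_wpM2l// big_cons -normrZ scalerBl.
    by rewrite opprD addrACA ler_normD.
rewrite (RintegralD measurableT (integrable_mulr `|y| ik) ih) (RintegralZr _ measurableT ik).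
rewrite [e']splitr lerD//.
have : \int[mu]_r (\1_D r * `|\1_(s @^-1` [set y]) r - k r|) * (`|y| + 1) <= e' / 2.
  by rewrite -ler_pdivlMr.
apply: le_trans; rewrite ler_wpM2l ?lerDl//.
by apply: Rintegral_ge0 => r _; rewrite mulr_ge0.
Qed.

End Density.

(** * Approximation in [L^1] by twice integrated continuous functions *)

Section Approximation.
Variables (R : realType) (H : hilbertType R).
Local Notation T := (measurableTypeR R).
Local Notation mu := (@lebesgue_measure R).
Local Notation integrable f := (mu.-integrable setT (EFin \o f)).
Implicit Types (f g phi psi : R -> H) (a b t : R).

(** The [L^1] distance on [[b, t]]. The two functions are truncated separately because each
    truncated function is integrable on the whole line. *)
Definition l1err b (gam Phi : R -> H) t : R :=
  \int[mu]_r `|\1_(`[b, t] : set T) r *: gam r - \1_(`[b, t] : set T) r *: Phi r|.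

(** The ramp [chi] rises from [0] to [1] on [[b, b + 1]]. It damps the approximant only where [phi]
    vanishes, so the error does not grow. *)
Lemma cutoff_dense b t (e : R) phi : bintegrable phi ->
  (forall r, r < b + 1 -> phi r = 0) -> 0 < e ->
  exists2 psi, ccont b psi & l1err b phi psi t <= e.
Proof.
move=> bphi phi0 e0; have e2 : 0 < e / 2 by rewrite divr_gt0.
have mD : measurable (`[b, t] : set T) by exact: measurable_itv.
have [s ss se] := simple_dense bphi e2.
have [h ch he] := continuous_dense b t ss e2.
pose chi r : R := Num.min 1 (Num.max 0 (r - b)).
have chi01 r : 0 <= chi r <= 1 by rewrite /chi le_min ler01 /= le_max lexx /= ge_min lexx.
have cchi : continuous chi.
  move=> r; apply: (@continuous_min R R (fun=> 1) (fun r => Num.max 0 (r - b))).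
    exact: cvg_cst.
  apply: (@continuous_max R R (fun=> 0) (fun r => r - b)); first exact: cvg_cst.
  by apply: (@cvgB _ R^o); [exact: cvg_id|exact: cvg_cst].
exists (fun r => chi r *: h r).
  split => [r|r rb]; first by apply: cvgZ; [exact: cchi|exact: ch].
  by rewrite /chi max_l ?subr_le0// min_r ?scale0r.
have bs := simple_bintegrable ss.
have b1 := bintegrable_indic mD bphi; have b2 := bintegrable_indic mD bs.
have b3 := bintegrable_itv b t ch.
apply: (@le_trans _ _ (l1err b phi h t)).
  apply: le_int; [|exact: (bintegrable_sub b1 b3).2|].
    apply: (bintegrable_sub b1 _).2; apply: bintegrable_itv => r.
    by apply: cvgZ; [exact: cchi|exact: ch].
  move=> r; have [rb|br] := ltP r (b + 1).
    rewrite phi0// scaler0 !sub0r !normrN !normrZ ler_wpM2l//.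
    by rewrite ger0_norm ?ler_piMl//; case/andP: (chi01 r).
  by rewrite /chi max_r ?min_l ?scale1r// ?subr_ge0; move: br; lra.
rewrite [e]splitr (le_trans (int_triangle b1 b2 b3))// lerD//.
apply: le_trans se; apply: le_int; [exact: (bintegrable_sub b1 b2).2|
  exact: (bintegrable_sub bphi bs).2|move=> r].
rewrite -scalerBr normrZ ger0_norm// indicE.
by case: (r \in _); rewrite ?mul1r ?mul0r.
Qed.

Lemma is_derive_shift (w : R -> H) (k t : R) (d : H) :
  is_derive (t + k) 1 w d -> is_derive t 1 (fun s => w (s + k)) d.
Proof.
move=> /is_derive_epsP dw; apply/is_derive_epsP => e /dw[del del0 delP].
by exists del => // h /delP; rewrite [t + h + k]addrAC.
Qed.

(* Steklov averages [k^-1 (I phi(r) - I phi(r - k))]. *)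
Lemma steklov b t (e : R) phi : ccont b phi -> 0 < e ->
  exists2 psi, ccont b psi & forall r, r <= t -> `|phi r - primitive b psi r| <= e.
Proof.
move=> hphi e0; have [k k0 kP] := ccont_heine t hphi e0.
have hI := ccont_primitive hphi.
pose psi r := k^-1 *: (phi r - phi (r + - k)).
have hs : ccont b (fun r => phi (r + - k)).
  by apply: ccont_le (ccont_shift (- k) hphi); rewrite opprK lerDl ltW.
have hpsi : ccont b psi by apply: ccont_scale; exact: ccont_sub hphi hs.
exists psi => // r rt.
have <- : (fun r => k^-1 *: (primitive b phi r - primitive b phi (r + - k))) = primitive b psi.
  apply: primitive_unique hpsi _ _ => [s sb|s].
    rewrite hI.2// hI.2 ?subrr ?scaler0//; move: sb k0; lra.
  apply: is_deriveZ; apply: is_deriveB; first exact: is_derive_primitive.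
  by apply: is_derive_shift; exact: is_derive_primitive.
have inc : `|primitive b phi (r + - k) - primitive b phi r - (- k) *: phi r| <= e * `|- k|.
  apply: (@weak_increment R H (primitive b phi) phi) => [x s|s].
    by apply: is_derive_dotpl; exact: is_derive_primitive.
  by rewrite normrN (ger0_norm (ltW k0)) => sk; exact: kP.
rewrite normrN (ger0_norm (ltW k0)) in inc.
rewrite -(ler_pM2l k0) [leRHS]mulrC -{1}(ger0_norm (ltW k0)) -normrZ.
rewrite scalerBr scalerA divff ?gt_eqF// scale1r.
apply: le_trans inc; rewrite le_eqVlt; apply/orP; left; apply/eqP; congr `|_|.
by rewrite scaleNr opprK opprB addrC.
Qed.

(** [p] is close to [I p1] and [p1] to [I p2]. Integrating the second error over [[b, t]] costs the
    factor [|t - b|], for which its tolerance compensates. The uniform error [d] over an interval of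
    length [m] then costs at most [e / 2] in [L^1]. *)
Lemma smooth_dense b t (e : R) phi : bintegrable phi ->
  (forall r, r < b + 1 -> phi r = 0) -> 0 < e ->
  exists2 psi, ccont b psi &
    l1err b phi (primitive b (primitive b psi)) t <= e.
Proof.
move=> bphi phi0 e0; have e2 : 0 < e / 2 by rewrite divr_gt0.
have mD : measurable (`[b, t] : set T) by exact: measurable_itv.
have [p hp pe] := cutoff_dense t bphi phi0 e2.
have iD : integrable (\1_(`[b, t] : set T) : T -> R) := integrable_indic_itv b t true false.
pose m := \int[mu]_r (\1_(`[b, t] : set T) r : R).
have m0 : 0 <= m by exact: Rintegral_ge0.
have m1 : 0 < m + 1 by rewrite ltr_wpDl.
pose d := e / 2 / (m + 1).
have d0 : 0 < d by rewrite !divr_gt0.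
have d2 : 0 < d / 2 by rewrite divr_gt0.
have [p1 hp1 p1P] := steklov t hp d2.
have L0 : 0 < `|t - b| + 1 by rewrite ltr_wpDl.
have [p2 hp2 p2P] := steklov t hp1 (divr_gt0 d2 L0).
exists p2 => //.
have h1 := ccont_primitive hp1; have h2 := ccont_primitive hp2.
have h22 := ccont_primitive h2.
have close r : b <= r <= t -> `|p r - primitive b (primitive b p2) r| <= d.
  move=> /andP[br rt]; rewrite -(subrKA (primitive b p1 r)) (le_trans (ler_normD _ _))//.
  rewrite [d]splitr lerD ?p1P//.
  have -> : primitive b p1 r - primitive b (primitive b p2) r =
      primitive b (fun s => p1 s - primitive b p2 s) r.
    have -> : (fun s => p1 s - primitive b p2 s) = (fun s => p1 s + (-1) *: primitive b p2 s).
      by apply/funext => s; rewrite scaleN1r.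
    rewrite primitive_add; [|exact: hp1|exact: ccont_scale].
    by rewrite primitive_scale; [rewrite scaleN1r|exact: h2].
  apply: (le_trans (@primitive_bound R H b _ (d / 2 / (`|t - b| + 1)) r
    (ccont_sub hp1 h2) br _)).
    by move=> s /andP[_ sr]; apply: p2P; exact: le_trans rt.
  rewrite mulrAC ler_pdivrMr// ler_wpM2l ?(ltW d2)//.
  by move: (ler_norm (t - b)) rt; lra.
have cp : continuous p by case: hp.
have cII : continuous (primitive b (primitive b p2)) by case: h22.
have b1 := bintegrable_indic mD bphi; have b2 := bintegrable_itv b t cp.
have b3 := bintegrable_itv b t cII.
rewrite /l1err [e]splitr (le_trans (int_triangle b1 b2 b3))// lerD//.
apply: (@le_trans _ _ (\int[mu]_r (\1_(`[b, t] : set T) r * d))).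
  apply: le_int; [exact: (bintegrable_sub b2 b3).2|exact: integrable_mulr|move=> r].
  rewrite -scalerBr normrZ ger0_norm// indicE.
  case: (boolP (r \in _)) => [|_]; last by rewrite !mul0r.
  by rewrite inE /= in_itv/= !mul1r; exact: close.
rewrite (RintegralZr _ measurableT iD) -/m.
have -> : e / 2 = (m + 1) * d by rewrite /d [RHS]mulrC divfK// gt_eqF.
by rewrite ler_wpM2r ?(ltW d0)// lerDl.
Qed.

Variables (b : R) (gam : R -> H).
Hypothesis gam0 : forall r, r < b + 1 -> gam r = 0.
Hypothesis gamI : forall t, bintegrable (fun r : T => \1_(`[b, t] : set T) r *: gam r).

Lemma l1err_le (Phi : R -> H) t t' : continuous Phi -> t <= t' ->
  l1err b gam Phi t <= l1err b gam Phi t'.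
Proof.
move=> cP tt; apply: le_int.
- exact: (bintegrable_sub (gamI t) (bintegrable_itv b t cP)).2.
- exact: (bintegrable_sub (gamI t') (bintegrable_itv b t' cP)).2.
move=> r; rewrite -!scalerBr !normrZ ler_wpM2r// !ger0_norm// !indicE ler_nat.
case: (boolP (r \in `[b, t]%classic)) => // rt; rewrite mem_set//.
by move: rt; rewrite inE /= !in_itv/= => /andP[-> rt]; exact: le_trans tt.
Qed.

Lemma l1err_ge0 (Phi : R -> H) t : 0 <= l1err b gam Phi t.
Proof. exact: Rintegral_ge0. Qed.

(** The [n]-th function has error at most [1 / (n + 1)] on [[b, n]]; monotonicity of the error in
    [t] makes this one sequence work on every interval. *)
Lemma approx_sequence : exists Psi_ : nat -> R -> H,
  (forall n, ccont b (Psi_ n)) /\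
  forall t (e : R), 0 < e -> exists N, forall n, (N <= n)%N ->
    l1err b gam (primitive b (primitive b (Psi_ n))) t <= e.
Proof.
have ex (n : nat) : exists psi, ccont b psi /\
    l1err b gam (primitive b (primitive b psi)) n%:R <= n.+1%:R^-1.
  have n0 : 0 < n.+1%:R^-1 :> R by [].
  have g0 r : r < b + 1 -> \1_(`[b, n%:R] : set T) r *: gam r = 0.
    by move=> rb; rewrite gam0// scaler0.
  have [psi hpsi le] := smooth_dense n%:R (gamI n%:R) g0 n0.
  exists psi; split => //; apply: le_trans le; rewrite le_eqVlt; apply/orP; left; apply/eqP.
  apply: eq_Rintegral => r _; rewrite scalerA indicE.
  by case: (r \in _); rewrite ?mulr1 ?mulr0.
have [Psi_ PsiP] := choice ex; exists Psi_; split => [n|t e e0].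
  by case: (PsiP n).
have [N NP] := (cvg_seqP _ _).1 (@cvg_harmonic R) e e0.
exists (maxn N (Num.truncn t).+1) => n; rewrite geq_max => /andP[/NP + tn].
rewrite subr0 /harmonic /= ger0_norm// => hn.
have tn' : t <= n%:R.
  by rewrite (le_trans (ltW (truncnS_gt t)))// ler_nat.
have cI : continuous (primitive b (primitive b (Psi_ n))).
  by case: (ccont_primitive (ccont_primitive (PsiP n).1)).
by rewrite (le_trans (l1err_le cI tn'))// (le_trans (PsiP n).2).
Qed.

(** [f] is the integral of [gam], so the uniform distance of the primitives is at most the [L^1]
    distance of the integrands. *)
Lemma l1err_primitive f (Phi : R -> H) t T' : ccont b f -> ccont b Phi ->
  (forall s, b <= s -> f s = bochner (fun r => \1_(`[b, s] : set T) r *: gam r)) ->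
  t <= T' -> `|f t - primitive b Phi t| <= l1err b gam Phi T'.
Proof.
move=> hf hP fE tT; have hI := ccont_primitive hP.
have [tb|/ltW bt] := leP t b.
  by rewrite hf.2// hI.2// subrr normr0; exact: l1err_ge0.
apply: le_trans (l1err_le hP.1 tT).
apply: norm_le_dotp => [|x]; first exact: l1err_ge0.
have bP := bintegrable_itv b t hP.1.
rewrite dotpBl (fE t bt) [X in X - _](dotp_bochner _ (gamI t)).
rewrite [X in _ - X](dotp_primitive _ _ _ hP.1).
have -> : \int[mu]_(s in `[b - 1, t]) dotp (Phi s) x =
    \int[mu]_s dotp (\1_(`[b, t] : set T) s *: Phi s) x.
  rewrite Rintegral_mkcond; apply: eq_Rintegral => s _.
  rewrite patchE dotpZl indicE; have [sb|bs] := leP s b.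
    by rewrite hP.2// dotp0l mulr0 if_same.
  have -> : (s \in `[b, t]%classic) = (s \in `[b - 1, t]%classic).
    apply/idP/idP; rewrite !inE /= !in_itv/= => /andP[_ ->]; rewrite andbT; move: bs; lra.
  by case: ifP => _; rewrite ?mul1r ?mul0r.
rewrite -(RintegralB measurableT (dotp_integrable x (gamI t)) (dotp_integrable x bP)).
under eq_Rintegral do rewrite -dotpBl.
exact: le_trans (ler_norm _) (dotp_int_le x (bintegrable_sub (gamI t) bP)).
Qed.

Lemma l1_dist_le (Phi Phi' : R -> H) t : continuous Phi -> continuous Phi' ->
  \int[mu]_(s in `[b, t]) `|Phi s - Phi' s| <= l1err b gam Phi t + l1err b gam Phi' t.
Proof.
move=> cP cP'; have bP := bintegrable_itv b t cP; have bP' := bintegrable_itv b t cP'.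
rewrite [l1err b gam Phi t]int_dist_sym.
apply: le_trans (int_triangle bP (gamI t) bP').
rewrite Rintegral_mkcond le_eqVlt; apply/orP; left; apply/eqP.
apply: eq_Rintegral => s _; rewrite patchE -scalerBr normrZ ger0_norm// indicE.
by case: ifP => _; rewrite ?mul1r ?mul0r.
Qed.

End Approximation.

(** * Data with a merely integrable derivative; here [gam] plays the role of [f'] *)

Section RoughData.
Variables (R : realType) (H V : hilbertType R) (j P : {linear V -> H}).
Hypothesis P_skew : skew_adjoint j P.
Hypothesis P_graph : exists c C : R, 0 < c /\
  forall v, c * `|v| <= `|j v| + `|P v| <= C * `|v|.
Local Notation T := (measurableTypeR R).
Local Notation mu := (@lebesgue_measure R).
Local Notation strong := (strong j P).

Lemma is_derive_integral (b : R) (k : R -> R) (t : R) : continuous k -> b <= t ->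
  is_derive t 1 (fun s => \int[mu]_(r in `[b - 1, s]) k r) (k t).
Proof.
move=> ck bt.
have := @continuous_FTC1 R k (BLeft (b - 1)) t (t + 1).
move=> /(_ (ltr_pwDr ltr01 (lexx t))); case.
- apply: continuous_compact_integrable; first exact: segment_compact.
  exact: continuous_subspaceT.
- by rewrite /= lte_fin; move: bt; lra.
- exact: ck.
- by move=> d1 d2; apply: DeriveDef; [exact: d1|rewrite -derive1E; exact: d2].
Qed.

Lemma strong_uniq b A B Q c kappa f u u' v v' : 0 < c -> good_coeffs c kappa A B Q ->
  strong b A B Q f u u' -> strong b A B Q f v v' -> u = v.
Proof.
move=> c0 hc hu hv; have [_ _ hQ _] := hc.
have huv := strong_sub hQ hu hv.
apply/funext => t; apply/subr0_eq/eqP; rewrite -normr_le0.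
have bT : b <= Num.max b t by rewrite le_max lexx.
have := strong_bound P_skew c0 hc huv bT (lexx 0) _ (t := t).
rewrite mul0r mulr0; apply; first by move=> s _; rewrite subrr normr0.
by rewrite le_max lexx orbT.
Qed.

Variables (b : R) (gam : R -> H) (f : R -> H).
Hypothesis gamI : forall t, bintegrable (fun r : T => \1_(`[b, t] : set T) r *: gam r).
Hypothesis hf : ccont b f.
Hypothesis fE : forall s, b <= s ->
  f s = bochner (fun r => \1_(`[b, s] : set T) r *: gam r).
Variable Psi_ : nat -> R -> H.
Hypothesis hPsi : forall n, ccont b (Psi_ n).
Let Phi_ n := primitive b (primitive b (Psi_ n)).
Hypothesis PsiE : forall t (e : R), 0 < e -> exists N, forall n, (N <= n)%N ->
  l1err b gam (Phi_ n) t <= e.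

Let hPhi n : ccont b (Phi_ n) := ccont_primitive (ccont_primitive (hPsi n)).

Lemma strong_diff_le c kappa A B Q n m u u' v v' t s : 0 < c ->
  good_coeffs c kappa A B Q ->
  strong b A B Q (Phi_ n) u u' -> strong b A B Q (Phi_ m) v v' ->
  b <= t -> s <= t -> `|u s - v s| <= energy_const c kappa (t - b) *
    (l1err b gam (Phi_ n) t + l1err b gam (Phi_ m) t).
Proof.
move=> c0 hc hu hv bt st; have [_ _ hQ _] := hc.
have [cn n0] := hPhi n; have [cm m0] := hPhi m.
have huv := strong_sub hQ hu hv.
pose k r := `|Phi_ n r - Phi_ m r|.
have ck : continuous k by move=> r; apply: cvg_norm; apply: cvgB; [exact: cn|exact: cm].
pose G s := \int[mu]_(r in `[b - 1, s]) k r.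
have k0 r : r <= b -> k r = 0 by move=> rb; rewrite /k n0// m0// subrr normr0.
have Gb : G b = 0.
  by apply: Rintegral_eq0 => r /=; rewrite in_itv/= => /andP[_ /k0].
have G0 : 0 <= G t by apply: Rintegral_ge0 => r _; exact: normr_ge0.
apply: (le_trans (strong_estimate P_skew c0 hc huv bt (g := k) (G := G) _ _ Gb G0 st)) => //.
  by move=> r /andP[br _]; exact: is_derive_integral.
apply: ler_wpM2l; first exact: energy_const_ge0.
apply: le_trans (l1_dist_le gamI t cn cm).
rewrite /G [leLHS]Rintegral_mkcond [leRHS]Rintegral_mkcond le_eqVlt; apply/orP; left; apply/eqP.
apply: eq_Rintegral => r _; rewrite !patchE; have [rb|br] := leP r b.
  by rewrite -/(k r) k0// !if_same.
have -> // : (r \in `[b, t]%classic) = (r \in `[b - 1, t]%classic).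
apply/idP/idP; rewrite !inE /= !in_itv/= => /andP[_ ->]; rewrite andbT; move: br; lra.
Qed.

(** The solutions [v n] for the data [Phi_ n] converge to what must be the derivative of the
    solution. Letting [m] tend to infinity in [strong_diff_le] gives a rate that depends on the
    coefficients only through [c] and [kappa], hence is uniform under perturbation. *)
Lemma rough_existence c kappa A B Q : 0 < c -> good_coeffs c kappa A B Q ->
  exists2 W, strong b A B Q f (primitive b W) W &
    forall n u u' t s, strong b A B Q (Phi_ n) u u' -> b <= t -> s <= t ->
      `|u s - W s| <= energy_const c kappa (t - b) * l1err b gam (Phi_ n) t.
Proof.
move=> c0 hc; have [_ _ hQ _] := hc.
have [U hU] := choice (fun n => smooth_existence P_skew P_graph c0 hc (hPsi n)).
pose v n := primitive b (U n).
have hU' n : strong b A B Q (Phi_ n) (v n) (U n) := hU n.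
have hv n : ccont b (v n) by case: (hU' n).
have K0 t : 0 <= energy_const c kappa t by exact: energy_const_ge0.
have cv : lucauchy v.
  move=> t0 e e0; pose t := Num.max t0 b.
  have bt : b <= t by rewrite le_max lexx orbT.
  have K1 : 0 < energy_const c kappa (t - b) + 1 by rewrite ltr_wpDl.
  have [N NP] := PsiE t (divr_gt0 (divr_gt0 e0 (ltr0Sn R 1)) K1).
  exists N => n m Nn Nm s st.
  have st' : s <= t by rewrite le_max st.
  rewrite (le_trans (strong_diff_le c0 hc (hU' n) (hU' m) bt st'))//.
  apply: (@le_trans _ _ ((energy_const c kappa (t - b) + 1) *
    (e / 2 / (energy_const c kappa (t - b) + 1) + e / 2 / (energy_const c kappa (t - b) + 1)))).
    apply: ler_pM => //; first by rewrite addr_ge0 ?l1err_ge0.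
      by rewrite lerDl.
    by rewrite lerD ?NP.
  by rewrite le_eqVlt; apply/orP; left; apply/eqP; field; rewrite gt_eqF.
have [W vW] := lucauchy_conv cv; exists W.
  (* Integrated once, [v n] becomes the derivative of a solution with data [I (Phi_ n)], and these
     data tend to [f] pointwise. *)
  have hl n : strong b A B Q (primitive b (Phi_ n)) (primitive b (v n)) (v n).
    exact: strong_lift hQ (hPhi n) (hU' n).
  apply: (@strong_limit _ _ _ _ _ b A B Q (fun n => primitive b (Phi_ n))
    (fun n => primitive b (v n)) v f W hQ hl vW) => t.
  apply/cvg_seqP => e e0; have [N NP] := PsiE t e0; exists N => n Nn.
  by rewrite distrC (le_trans (l1err_primitive gamI hf (hPhi n) fE (lexx t)))// NP.
move=> n u u' t s hu bt st.
have vWs : `|u s - v m s| @[m --> \oo] --> `|u s - W s|.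
  by apply: cvg_norm; apply: cvgB; [exact: cvg_cst|exact: luconv_cvg vW].
have err0 : l1err b gam (Phi_ m) t @[m --> \oo] --> (0 : R).
  apply/cvg_seqP => e /(PsiE t)[N NP]; exists N => m Nm.
  by rewrite subr0 ger0_norm ?l1err_ge0// NP.
have rhs : energy_const c kappa (t - b) * (l1err b gam (Phi_ n) t + l1err b gam (Phi_ m) t)
    @[m --> \oo] --> energy_const c kappa (t - b) * (l1err b gam (Phi_ n) t + 0).
  by apply: cvgM; [exact: cvg_cst|apply: cvgD; [exact: cvg_cst|exact: err0]].
rewrite addr0 in rhs; apply: (ler_cvg_to vWs rhs); apply: nearW => m.
exact: strong_diff_le c0 hc hu (hU' m) bt st.
Qed.

Lemma strong_perturb A B Q dA dB dQ (h : R) g u u' : causal_kernel Q -> causal_kernel dQ ->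
  strong b A B Q g u u' ->
  strong b (A + h *: dA) (B + h *: dB) (fun t => Q t + h *: dQ t)
    (fun t => g t + h *: (dA (u' t) + dB (u t) + convolution dQ u t)) u u'.
Proof.
move=> hQ hdQ [hu hu' du wu]; split; [exact: hu|exact: hu'|exact: du|].
move=> t; have wt := wu t; rewrite (conv_perturb _ _ hQ hdQ (ccont_lbounded hu)).
suff -> : g t + h *: (dA (u' t) + dB (u t) + convolution dQ u t) -
    (A (u' t) + h *: dA (u' t)) - (B (u t) + h *: dB (u t)) -
    (convolution Q u t + h *: convolution dQ u t) =
    g t - A (u' t) - B (u t) - convolution Q u t by exact: wt.
vring.
Qed.

Lemma strong_unperturb A B Q dA dB dQ (h : R) g u u' : causal_kernel Q -> causal_kernel dQ ->
  strong b (A + h *: dA) (B + h *: dB) (fun t => Q t + h *: dQ t) g u u' ->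
  strong b A B Q
    (fun t => g t - h *: (dA (u' t) + dB (u t) + convolution dQ u t)) u u'.
Proof.
move=> hQ hdQ [hu hu' du wu]; split; [exact: hu|exact: hu'|exact: du|].
move=> t; have wt := wu t; rewrite (conv_perturb _ _ hQ hdQ (ccont_lbounded hu)) in wt.
suff -> : g t - h *: (dA (u' t) + dB (u t) + convolution dQ u t) - A (u' t) - B (u t) -
    convolution Q u t = g t - (A (u' t) + h *: dA (u' t)) - (B (u t) + h *: dB (u t)) -
    (convolution Q u t + h *: convolution dQ u t) by exact: wt.
vring.
Qed.

(* The derivatives [W_h = u_h'] of the perturbed solutions converge: compare
   both with solutions for the smooth data [Phi_ n]. *)
Lemma perturbed_derivative_cvg c kappa A B Q dA dB dQ t (e : R) : 0 < c ->
  causal_kernel dQ -> good_coeffs c kappa A B Q -> 0 < e ->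
  exists2 del : R, 0 < del & forall h u u' v v', `|h| <= del ->
    good_coeffs c kappa (A + h *: dA) (B + h *: dB) (fun t => Q t + h *: dQ t) ->
    strong b A B Q f u u' ->
    strong b (A + h *: dA) (B + h *: dB) (fun t => Q t + h *: dQ t) f v v' ->
    forall s, s <= t -> `|v' s - u' s| <= e.
Proof.
move=> c0 hdQ hc e0; have [_ _ hQ _] := hc.
pose t1 := Num.max t b; pose EC := energy_const c kappa (t1 - b).
have bt1 : b <= t1 by rewrite le_max lexx orbT.
have EC0 : 0 <= EC by exact: energy_const_ge0.
have EC1 : 0 < EC + 1 by rewrite ltr_wpDl.
have [N /(_ N (leqnn N)) NP] := PsiE t1 (divr_gt0 (divr_gt0 e0 (ltr0Sn R 2)) EC1).
have [U hU] := smooth_existence P_skew P_graph c0 hc (hPsi N).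
have hU' : strong b A B Q (Phi_ N) (primitive b U) U := hU.
have [_ cU _ _] := hU'.
(* [N] is fixed before [h]: this bound serves all perturbed coefficients, since they share [c] and
   [kappa]. *)
have E3 : EC * l1err b gam (Phi_ N) t1 <= e / 3.
  apply: (@le_trans _ _ ((EC + 1) * (e / 3 / (EC + 1)))).
    by apply: ler_pM => //; [exact: l1err_ge0|rewrite lerDl].
  by rewrite mulrC divfK// gt_eqF.
pose v0 := primitive b U.
have hv0 : ccont b v0 := ccont_primitive cU.
have hX : ccont b (fun s => dA (U s) + dB (v0 s) + convolution dQ v0 s).
  apply: ccont_add; last exact: ccont_conv hdQ hv0.
  by apply: ccont_add; apply: ccont_bop.
have [M M0 XM] := ccont_bounded t1 hX.
have L0 : 0 <= t1 - b by rewrite subr_ge0.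
have D0 : 0 < EC * (M * (t1 - b)) + 1 by rewrite ltr_wpDl// mulr_ge0// mulr_ge0.
exists (e / 3 / (EC * (M * (t1 - b)) + 1)); first by rewrite !divr_gt0.
move=> h u u' v v' hdel hch hu hv s st.
have st1 : s <= t1 by rewrite le_max st.
have [_ _ hQh _] := hch.
have derivative_close A1 B1 Q1 w w' p p' : good_coeffs c kappa A1 B1 Q1 ->
    strong b A1 B1 Q1 f w w' -> strong b A1 B1 Q1 (Phi_ N) p p' -> `|p s - w' s| <= e / 3.
  move=> hc1 hw hp; have [W hW WP] := rough_existence c0 hc1.
  have wE := strong_uniq c0 hc1 hw hW.
  have -> : w' s = W s.
    have [_ _ dw _] := hw; have [_ _ dW _] := hW.
    by rewrite -(is_derive1E (dw s)) wE (is_derive1E (dW s)).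
  by apply: le_trans E3; exact: WP hp bt1 st1.
have [Uh hUh] := smooth_existence P_skew P_graph c0 hch (hPsi N).
have hUh' : strong b (A + h *: dA) (B + h *: dB) (fun t => Q t + h *: dQ t)
  (Phi_ N) (primitive b Uh) Uh := hUh.
have hUp := strong_perturb dA dB h hQ hdQ hU'.
have hd := strong_sub hQh hUh' hUp.
(* Both functions solve the perturbed equation, with data differing by [h] times a fixed function
   bounded by [M]; smoothness of the data makes the derivative [U] available for this. *)
have mid : `|primitive b Uh s - v0 s| <= e / 3.
  have hM0 : 0 <= `|h| * M by rewrite mulr_ge0.
  apply: (le_trans (strong_bound P_skew c0 hch hd bt1 hM0 _ st1)).
    move=> r /andP[_ rt]; rewrite opprD addrA subrr add0r normrN normrZ.
    by rewrite ler_wpM2l// XM.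
  have -> : energy_const c kappa (t1 - b) * (`|h| * M * (t1 - b)) =
     `|h| * (EC * (M * (t1 - b))) by rewrite /EC; ring.
  move: hdel; rewrite ler_pdivlMr// => hdel; apply: le_trans hdel.
  by rewrite ler_wpM2l// lerDl.
have h1 := derivative_close _ _ _ _ _ _ _ hc hu hU'.
have h2 := derivative_close _ _ _ _ _ _ _ hch hv hUh'.
apply: (@le_trans _ _ (e / 3 + (e / 3 + e / 3))); last first.
  by rewrite le_eqVlt; apply/orP; left; apply/eqP; field.
rewrite distrC in h2.
apply: le_trans (ler_distD (primitive b Uh s) _ _) _; apply: lerD; first exact: h2.
apply: le_trans (ler_distD (v0 s) _ _) _; apply: lerD; [exact: mid|exact: h1].
Qed.

End RoughData.

(** * Mollification and weak formulations *)

Section Smooth.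
Variables (R : realType).

Definition smooth (E : normedModType R) (f : R -> E) : Prop :=
  forall n t, derivable (derive1n n f) t 1.

(** Replaces formulas for higher derivatives: it is enough to exhibit a family that contains the
    function and is stable under differentiation. *)
Lemma smooth_coind (E : normedModType R) (S : (R -> E) -> Prop) :
  (forall f, S f -> exists2 f', S f' & forall t : R, is_derive t 1 f (f' t)) ->
  forall f, S f -> smooth f.
Proof.
move=> HS f Sf n; elim: n f Sf => [|n IH] f Sf t; have [f' Sf' df] := HS f Sf.
  by case: (df t).
have d1 : derive1 f = f' by apply/funext => s; exact: is_derive1E.
by rewrite derive1Sn d1; exact: IH.
Qed.

Lemma smooth_is_derive (E : normedModType R) (f : R -> E) : smooth f ->
  forall t : R, is_derive t 1 f (derive1 f t).
Proof. by move=> sf t; apply: DeriveDef; [exact: (sf 0%N t)|rewrite derive1E]. Qed.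

Lemma smooth_derive1 (E : normedModType R) (f : R -> E) : smooth f -> smooth (derive1 f).
Proof. by move=> sf n t; have := sf n.+1 t; rewrite derive1Sn. Qed.

Lemma smooth_continuous (E : normedModType R) (f : R -> E) : smooth f -> continuous f.
Proof. by move=> sf t; exact: (is_derive_continuous (smooth_is_derive sf t)). Qed.

Lemma smooth_primitive (E : normedModType R) (f f' : R -> E) : smooth f' ->
  (forall t : R, is_derive t 1 f (f' t)) -> smooth f.
Proof.
move=> sf' df [|n] t; first by case: (df t).
have d1 : derive1 f = f' by apply/funext => s; exact: is_derive1E.
by rewrite derive1Sn d1.
Qed.

Lemma smooth_add (E : normedModType R) (f g : R -> E) : smooth f -> smooth g ->
  smooth (fun t => f t + g t).
Proof.
move=> sf sg.
apply: (smooth_coind (S := fun h => exists f g, [/\ smooth f, smooth g &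
  h = fun t => f t + g t])); last by exists f, g.
move=> _ [p [q [sp sq ->]]]; exists (fun t => derive1 p t + derive1 q t).
  by exists (derive1 p), (derive1 q); split; [exact: smooth_derive1..|].
by move=> t; apply: is_deriveD; exact: smooth_is_derive.
Qed.

Lemma is_derive_scalel (E : normedModType R) (p : R -> R) (v : E) (t d : R) :
  is_derive t 1 p d -> is_derive t 1 (fun t => p t *: v) (d *: v).
Proof.
move=> /is_derive_epsP dp; apply/is_derive_epsP => e e0.
have v0 : 0 < `|v| + 1 by rewrite ltr_wpDl.
have [del del0 delP] := dp _ (divr_gt0 e0 v0).
exists del => // h /delP; rewrite scalerA -!scalerBl normrZ => hd.
have : `|p (t + h) - p t - h * d| * (`|v| + 1) <= e * `|h|.
  by rewrite -ler_pdivlMr// mulrAC.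
by apply: le_trans; rewrite ler_wpM2l// lerDl.
Qed.

Lemma smooth_scale (E : normedModType R) (f : R -> R) (v : E) : smooth f ->
  smooth (fun t => f t *: v).
Proof.
move=> sf.
apply: (smooth_coind (S := fun h => exists2 f : R -> R, smooth f & h = fun t => f t *: v));
  last by exists f.
move=> _ [p sp ->]; exists (fun t => derive1 p t *: v).
  by exists (derive1 p); [exact: smooth_derive1|].
by move=> t; apply: is_derive_scalel; exact: smooth_is_derive.
Qed.

Lemma is_derive_affine (E : normedModType R) (f f' : R -> E) (c d t : R) :
  (forall s : R, is_derive s 1 f (f' s)) ->
  is_derive t 1 (fun s => f (c * s + d)) (c *: f' (c * t + d)).
Proof.
move=> df; apply/is_derive_epsP => e e0.
have c0 : 0 < `|c| + 1 by rewrite ltr_wpDl.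
have [del del0 delP] := (is_derive_epsP _ _ _).1 (df (c * t + d)) _ (divr_gt0 e0 c0).
exists (del / (`|c| + 1)); first by rewrite divr_gt0.
move=> h; rewrite ler_pdivlMr// => hd.
have : `|c * h| <= del.
  by apply: le_trans hd; rewrite normrM mulrC ler_wpM2l// lerDl.
move=> /delP; rewrite scalerA (mulrC h).
have -> : c * (t + h) + d = c * t + d + c * h by ring.
move=> /le_trans; apply; rewrite mulrAC ler_pdivrMr// normrM.
rewrite -mulrA ler_wpM2l ?(ltW e0)// mulrC ler_wpM2l// lerDl//.
Qed.

Lemma smooth_affine (E : normedModType R) (f : R -> E) (c d : R) : smooth f ->
  smooth (fun t => f (c * t + d)).
Proof.
move=> sf.
apply: (smooth_coind (S := fun h => exists a (f : R -> E), smooth f /\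
   h = fun t => a *: f (c * t + d))); last first.
  by exists 1, f; split => //; apply/funext => t; rewrite scale1r.
move=> _ [a [p [sp ->]]]; exists (fun t => (a * c) *: derive1 p (c * t + d)).
  by exists (a * c), (derive1 p); split; [exact: smooth_derive1|].
move=> t; rewrite -scalerA; apply: is_deriveZ.
exact: is_derive_affine (smooth_is_derive sp).
Qed.

(** Sums of products of smooth functions are stable under differentiation, which stands in for the
    general Leibniz formula. *)
Inductive product_span : (R -> R) -> Prop :=
| Product_span_prod (f g : R -> R) : smooth f -> smooth g -> product_span (fun t => f t * g t)
| Product_span_add (f g : R -> R) : product_span f -> product_span g ->
    product_span (fun t => f t + g t).

Lemma smooth_mul (f g : R -> R) : smooth f -> smooth g -> smooth (fun t => f t * g t).
Proof.
move=> sf sg; apply: (smooth_coind (S := product_span)); last exact: Product_span_prod.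
move=> h hh; elim: h / hh => [p q sp sq|p q _ [p' hp dp] _ [q' hq dq]].
  exists (fun t => p t * derive1 q t + q t * derive1 p t).
    apply: Product_span_add; apply: Product_span_prod;
      [exact: sp|exact: smooth_derive1|exact: sq|exact: smooth_derive1].
  move=> t; have := is_deriveM (smooth_is_derive sp t) (smooth_is_derive sq t).
  by move=> /is_derive_eq; apply.
exists (fun t => p' t + q' t); first exact: Product_span_add.
by move=> t; exact: is_deriveD.
Qed.

Lemma poly_growth (p : {poly R}) : exists2 C : R, 0 <= C &
  exists n, forall y, 1 <= y -> `|p.[y]| <= C * y ^+ n.
Proof.
elim/poly_ind: p => [|p c [C C0 [n IH]]].
  by exists 0 => //; exists 0%N => y _; rewrite horner0 normr0 mul0r.
exists (C + `|c|); first by rewrite addr_ge0.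
exists n.+1 => y y1; have y0 : 0 <= y by rewrite (le_trans _ y1).
rewrite hornerMXaddC (le_trans (ler_normD _ _))// mulrDl lerD//.
  by rewrite normrM (ger0_norm y0) exprSr mulrA ler_wpM2r// IH.
by rewrite ler_peMr// exprn_ege1.
Qed.

(** With [y = 1 / h] the bound reads [e h], which is what differentiability of [flat p] at [0] with
    derivative [0] demands. *)
Lemma flat_decay (p : {poly R}) (e : R) : 0 < e -> exists2 Y : R, 1 <= Y &
  forall y, Y <= y -> `|p.[y]| * expR (- y) <= e / y.
Proof.
move=> e0; have [C C0 [n hC]] := poly_growth p.
(* From [y ^ (n + 2) <= (n + 2)! exp y] the left-hand side is at most [K / y ^ 2], hence at most
   [e / y] once [y >= K / e]. *)
pose K := C * (n.+2)`!%:R.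
exists (Num.max 1 (K / e)); first by rewrite le_max lexx.
move=> y; rewrite ge_max => /andP[y1 Ky].
have y0 : 0 < y by rewrite (lt_le_trans _ y1).
have ey : y ^+ n.+2 <= (n.+2)`!%:R * expR y.
  rewrite mulrC -ler_pdivrMr ?ltr0n ?fact_gt0//.
  by apply: le_trans (expR_ge1Dxn n.+1 (ltW y0)); rewrite lerDr.
rewrite ler_pdivlMr// expRN mulrAC ler_pdivrMr ?expR_gt0//.
apply: (@le_trans _ _ (C * y ^+ n * y)); first by rewrite ler_wpM2r ?hC// ltW.
rewrite ler_pdivrMr// in Ky.
have h1 : C * y ^+ n * y * y <= K * expR y.
  have -> : C * y ^+ n * y * y = C * y ^+ n.+2 by rewrite !exprSr !mulrA.
  by rewrite /K -mulrA ler_wpM2l.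
have h2 : K * expR y <= y * e * expR y by rewrite ler_wpM2r ?expR_ge0.
rewrite -(ler_pM2r y0) (le_trans h1)// (le_trans h2)//.
by rewrite le_eqVlt; apply/orP; left; apply/eqP; ring.
Qed.

(** Carrying a polynomial in [1 / x] makes the family stable under differentiation: [p] becomes
    [X^2 (p - p')]. *)
Definition flat (p : {poly R}) (x : R) : R :=
  if 0 < x then p.[x^-1] * expR (- x^-1) else 0.

Lemma is_derive_flat (p : {poly R}) (x : R) :
  is_derive x 1 (flat p) (flat ('X^2 * (p - p^`())) x).
Proof.
have [x0|x0|->] := ltgtP x 0.
- rewrite /flat ltNge (ltW x0) /=.
  have mx : 0 < - x / 2 by rewrite divr_gt0// oppr_gt0.
  apply: (is_derive_local (w := cst (0 : R)) mx) => s.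
  rewrite ler_norml => /andP[_ h]; rewrite ltNge.
  by have -> // : s <= 0; move: h; lra.
- rewrite {2}/flat x0; have x2 : 0 < x / 2 by rewrite divr_gt0.
  apply: (is_derive_local (w := fun y => p.[y^-1] * expR (- y^-1)) x2).
    move=> s; rewrite ler_norml /flat => /andP[h _].
    by have -> // : 0 < s; move: h x0; lra.
  have xn : x != 0 by rewrite gt_eqF.
  have dV := is_deriveV (f := id) xn (is_derive_id x (1 : R)).
  have d1 := is_derive1_comp (is_derive_poly p x^-1) dV.
  have d2 := @is_derive1_comp R expR (fun y => - y^-1) x _ _ (is_derive_expR _)
    (is_deriveN dV).
  have := is_deriveM d1 d2; move=> /is_derive_eq; apply.
  rewrite hornerM hornerXn hornerD hornerN /GRing.scale /= !mulr1; field.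
  by [].
rewrite {2}/flat ltxx; apply/is_derive_epsP => e e0.
have [Y Y1 hY] := flat_decay p e0.
have Y0 : 0 < Y by rewrite (lt_le_trans _ Y1).
exists Y^-1; first by rewrite invr_gt0.
move=> h hd; rewrite add0r scaler0 subr0 /flat ltxx subr0.
case: ifP => h0; last by rewrite normr0 mulr_ge0// ltW.
rewrite (gtr0_norm h0) in hd *.
have hi : Y <= h^-1 by rewrite -[Y]invrK lef_pV2 ?posrE ?invr_gt0.
by have := hY _ hi; rewrite invrK normrM (ger0_norm (expR_ge0 _)).
Qed.

Lemma smooth_flat (p : {poly R}) : smooth (flat p).
Proof.
apply: (smooth_coind (S := fun f => exists p, f = flat p)); last by exists p.
move=> _ [q ->]; exists (flat ('X^2 * (q - q^`()))); first by eexists.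
exact: is_derive_flat.
Qed.

Definition bump (x : R) : R := flat 1 x * flat 1 (-1 * x + 1).

Lemma smooth_bump : smooth bump.
Proof. by apply: smooth_mul; [|apply: smooth_affine]; exact: smooth_flat. Qed.

Lemma flat1_ge0 x : 0 <= flat 1 x.
Proof. by rewrite /flat; case: ifP => // _; rewrite hornerC mul1r expR_ge0. Qed.

Lemma bump_ge0 x : 0 <= bump x.
Proof. by rewrite mulr_ge0// flat1_ge0. Qed.

Lemma bump_gt0 x : 0 < x < 1 -> 0 < bump x.
Proof.
move=> /andP[x0 x1]; have x1' : 0 < -1 * x + 1 by lra.
by rewrite /bump /flat x0 x1' !hornerC !mul1r mulr_gt0 ?expR_gt0.
Qed.

Lemma bump_eq0 x : ~~ (0 < x < 1) -> bump x = 0.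
Proof.
rewrite negb_and -!leNgt /bump /flat => /orP[x0|x1].
  by rewrite ltNge x0 mul0r.
have -> : (0 < -1 * x + 1) = false by apply/negbTE; rewrite -leNgt; lra.
by rewrite mulr0.
Qed.

(** [s] is the primitive of [bump] divided by its total mass. Keeping [s] next to its derivative [m]
    records that [m] has integral one. *)
Lemma smooth_step_ex : exists s m : R -> R, [/\ smooth m,
  (forall t : R, is_derive t 1 s (m t)), (forall t, 0 <= m t),
  (forall t, t <= 0 -> s t = 0) & (forall t, 1 <= t -> s t = 1)].
Proof.
have cb := smooth_continuous smooth_bump.
pose S (x : R) := \int[@lebesgue_measure R]_(r in `[0 - 1, x]) bump r.
have S0 x : x <= 0 -> S x = 0.
  move=> x0; apply: Rintegral_eq0 => r /=; rewrite in_itv/= => /andP[_ rx].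
  by rewrite bump_eq0// negb_and -!leNgt (le_trans rx).
have dS (x : R) : is_derive x 1 S (bump x).
  have [x0|x0] := leP 0 x; first exact: is_derive_integral.
  rewrite bump_eq0 ?negb_and -?leNgt ?(ltW x0)//.
  have mx : 0 < - x by rewrite oppr_gt0.
  apply: (is_derive_local (w := cst (0 : R)) mx) => s.
  by rewrite ler_norml => /andP[_ h]; rewrite S0//; move: h; lra.
have Smono x y : x <= y -> S x <= S y.
  move=> xy; rewrite -subr_ge0 -(subrr (0 : R)).
  apply: (@derive_le_le R (fun=> 0) (fun=> 0) S bump x y xy) => // z _.
  exact: bump_ge0.
have S1 x : 1 <= x -> S x = S 1.
  move=> x1; apply/le_anti/andP; split; last exact: Smono.
  rewrite -subr_le0 -(subrr (0 : R)).
  apply: (@derive_le_le R S bump (fun=> 0) (fun=> 0) 1 x x1) => // z /andP[z1 _].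
  by rewrite bump_eq0// negb_and -!leNgt z1 orbT.
(* [bump] is positive on [[1/4, 3/4]], so by the mean value theorem [S] increases strictly there. *)
have Spos : 0 < S 1.
  have c14 : (4^-1 : R) < 3 / 4 by lra.
  have [|c] := @MVT R S bump 4^-1 (3 / 4) c14.
    by apply: derivable_within_continuous => z _; case: (dS z).
  rewrite in_itv/= => /andP[c1 c2] Sc.
  have bc : 0 < bump c by apply: bump_gt0; move: c1 c2; lra.
  have : 0 < S (3 / 4) - S 4^-1 by rewrite Sc mulr_gt0// subr_gt0.
  rewrite subr_gt0 => /(le_lt_trans (Smono 0 4^-1 _)); rewrite S0// => h.
  by apply: lt_le_trans (h _) (Smono _ _ _); lra.
exists (fun x => (S 1)^-1 * S x), (fun x => (S 1)^-1 * bump x); split.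
- by have := @smooth_scale R bump ((S 1)^-1) smooth_bump; congr smooth;
    apply/funext => x; rewrite /GRing.scale /= mulrC.
- by move=> t; apply: is_deriveZ.
- by move=> t; rewrite mulr_ge0 ?bump_ge0// invr_ge0 ltW.
- by move=> t /S0 ->; rewrite mulr0.
- by move=> t /S1 ->; rewrite mulVf// gt_eqF.
Qed.

Lemma smooth_step_scaled (eps : R) : 0 < eps -> exists s m : R -> R, [/\ smooth m,
  (forall t : R, is_derive t 1 s (m t)), (forall t, 0 <= m t),
  (forall t, t <= 0 -> s t = 0) & (forall t, eps <= t -> s t = 1)].
Proof.
move=> e0; have [s [m [sm ds m0 s0 s1]]] := smooth_step_ex.
exists (fun t => s (eps^-1 * t + 0)), (fun t => eps^-1 *: m (eps^-1 * t + 0)); split.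
- have := @smooth_scale R _ (eps^-1) (@smooth_affine _ m eps^-1 0 sm); congr smooth.
  by apply/funext => x; rewrite /GRing.scale /= mulrC.
- by move=> t; exact: is_derive_affine.
- by move=> t; rewrite mulr_ge0// invr_ge0 ltW.
- by move=> t t0; rewrite s0// addr0 pmulr_rle0// invr_gt0.
- by move=> t et; rewrite s1// addr0 mulrC ler_pdivlMr// mul1r.
Qed.

End Smooth.

Section CompactIntegrals.
Variables (R : realType) (H : hilbertType R).
Local Notation T := (measurableTypeR R).
Local Notation mu := (@lebesgue_measure R).
Local Notation integrable g := (mu.-integrable setT (EFin \o g)).

Lemma is_derive_locally_cst (E : normedModType R) (F : R -> E) (t w : R) d c : 0 < w ->
  (forall r, `|r - t| <= w -> F r = c) -> is_derive t 1 F d -> d = 0.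
Proof.
move=> w0 Fc /(is_derive_local w0 Fc) dc.
by rewrite -(is_derive1E dc) derive1_cst.
Qed.

Lemma integrable_compact (g : R -> R) (a b : R) : continuous g ->
  (forall t, ~~ (a <= t <= b) -> g t = 0) -> integrable g.
Proof.
move=> cg g0.
have ig : mu.-integrable `[a, b] (EFin \o g).
  apply: continuous_compact_integrable; first exact: segment_compact.
  exact: continuous_subspaceT.
have mD : measurable (`[a, b] : set T) by exact: measurable_itv.
have := (integrable_mkcond (mu := mu) (EFin \o g) mD).1 ig.
congr mu.-integrable; apply/funext => t; rewrite patchE /=; case: ifPn => //.
by rewrite notin_setE /= in_itv/= => /negP /g0 ->.
Qed.

Lemma int_FTC (F g : R -> R) (a b : R) : a < b -> continuous g ->
  (forall t : R, is_derive t 1 F (g t)) ->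
  (forall t, ~~ (a <= t <= b) -> g t = 0) -> \int[mu]_t g t = F b - F a.
Proof.
move=> ab cg dF g0.
have -> : \int[mu]_t g t = \int[mu]_(t in `[a, b]) g t.
  rewrite [RHS]Rintegral_mkcond; apply: eq_Rintegral => t _.
  rewrite patchE; case: ifPn => //.
  by rewrite notin_setE /= in_itv/= => /negP /g0 ->.
rewrite /Rintegral (continuous_FTC2 ab (F := F))//.
- exact: continuous_subspaceT.
- have cF t := is_derive_continuous (dF t).
  split; first by move=> t _; case: (dF t).
  + by apply: cvg_at_right_filter; exact: cF.
  + by apply: cvg_at_left_filter; exact: cF.
- by move=> t _; exact: is_derive1E.
Qed.

Lemma bintegrable_compact (k : R -> R) (F : R -> H) (a b : R) : continuous k ->
  continuous F -> (forall t, ~~ (a <= t <= b) -> k t = 0) ->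
  bintegrable (fun t => k t *: F t).
Proof.
move=> ck cF k0.
have cK : continuous (fun t => k t *: F t) by move=> t; apply: cvgZ; [exact: ck|exact: cF].
have := bintegrable_itv a b cK; congr bintegrable; apply/funext => t; rewrite indicE.
have [|] := boolP (t \in `[a, b]%classic); first by rewrite scale1r.
by rewrite notin_setE /= in_itv/= => /negP /k0 ->; rewrite !scale0r.
Qed.

Lemma bochner_average (k : R -> R) (F : R -> H) (a b e : R) (y : H) : continuous k ->
  continuous F -> (forall t, ~~ (a <= t <= b) -> k t = 0) ->
  (forall t, 0 <= k t) -> \int[mu]_t k t = 1 ->
  (forall t, a <= t <= b -> `|F t - y| <= e) ->
  `|bochner (fun t => k t *: F t) - y| <= e.
Proof.
move=> ck cF k0 kp k1 Fe.
have ik := integrable_compact ck k0.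
have bF := bintegrable_compact ck cF k0.
have by_ : bintegrable (fun t => k t *: y).
  by apply: bintegrable_compact k0 => // t; exact: cvg_cst.
(* A negative [e] would leave no point in [[a, b]], and then [k] could not have integral one. *)
have e0 : 0 <= e.
  rewrite leNgt; apply/negP => e0; have : \int[mu]_t k t = 0.
    apply: Rintegral_eq0 => t _; have [/Fe h|/k0//] := boolP (a <= t <= b).
    by move: (le_lt_trans h e0); rewrite normr_lt0.
  by rewrite k1 => /eqP; rewrite oner_eq0.
have -> : y = bochner (fun t => k t *: y).
  apply: dotp_inj => x; rewrite [RHS](dotp_bochner _ by_).
  under eq_Rintegral do rewrite dotpZl.
  by rewrite RintegralZr// k1 mul1r.
rewrite -[- bochner _]scaleN1r -bochner_scale// -bochner_add//; last exact: bintegrable_scale.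
have bs : bintegrable (fun t => k t *: F t + -1 *: (k t *: y)).
  by apply: bintegrable_add => //; exact: bintegrable_scale.
apply: (le_trans (bochner_norm_le bs)).
rewrite [leRHS](_ : e = \int[mu]_t (k t * e)); last by rewrite RintegralZr// k1 mul1r.
apply: (le_int bs.2 (integrable_mulr e ik)).
move=> t; rewrite scaleN1r -scalerBr normrZ ger0_norm//.
have [/Fe|/k0 ->] := boolP (a <= t <= b); first exact: ler_wpM2l.
by rewrite !mul0r.
Qed.

End CompactIntegrals.

(** * One-sided mollifiers *)

Section Mollifier.
Variables (R : realType) (H : hilbertType R).
Local Notation T := (measurableTypeR R).
Local Notation mu := (@lebesgue_measure R).
Local Notation integrable g := (mu.-integrable setT (EFin \o g)).

(** The step function [s] encodes at once that [m] has integral one and that it vanishes beyond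
    [eps]. The support lies to the right of [0], so that averaging uses past values only. *)
Definition mollifier (eps : R) (m : R -> R) : Prop :=
  [/\ smooth m, forall t, 0 <= m t, forall t, t <= 0 -> m t = 0 &
      exists s : R -> R, [/\ forall t : R, is_derive t 1 s (m t),
        forall t, t <= 0 -> s t = 0 & forall t, eps <= t -> s t = 1]].

Lemma mollifier_ex (eps : R) : 0 < eps -> exists m, mollifier eps m.
Proof.
move=> e0; have e2 : 0 < eps / 2 by rewrite divr_gt0.
have [s [m [sm ds m0 s0 s1]]] := smooth_step_scaled e2.
(* The shift by [eps / 2] leaves a margin: for every [t <= 0], including [0], the step vanishes in a
   whole neighbourhood of [t]. *)
exists (fun t => m (1 * t + - (eps / 2))); split.
- exact: smooth_affine.
- by move=> t; exact: m0.
- move=> t t0; apply: (is_derive_locally_cst (c := 0) e2 _ (ds _)) => r.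
  by rewrite ler_norml => /andP[_ h]; apply: s0; move: h t0; lra.
- exists (fun t => s (1 * t + - (eps / 2))); split=> t.
  + by have := is_derive_affine 1 (- (eps / 2)) t ds; rewrite scale1r.
  + by move=> t0; apply: s0; move: t0 e2; lra.
  + by move=> t0; apply: s1; move: t0; lra.
Qed.

Section Properties.
Variables (eps : R) (m : R -> R).
Hypotheses (e0 : 0 < eps) (hm : mollifier eps m).

Lemma mollifier_support t : ~~ (0 <= t <= eps) -> m t = 0.
Proof.
have [_ _ m0 [s [ds s0 s1]]] := hm.
rewrite negb_and -!ltNge => /orP[/ltW/m0//|et].
have w0 : 0 < t - eps by rewrite subr_gt0.
apply: (is_derive_locally_cst (c := 1 : R) w0 _ (ds t)) => r.
by rewrite ler_norml => /andP[h _]; apply: s1; move: h; lra.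
Qed.

Lemma mollifier_derive_support t : ~~ (0 <= t <= eps) -> derive1 m t = 0.
Proof.
have [sm _ m0 _] := hm; rewrite negb_and -!ltNge => h.
(* For [t < 0] the window reaches exactly to [0], where [m] vanishes by definition although [0]
   belongs to the support interval. *)
have [w w0 wP] : exists2 w : R, 0 < w &
    forall r, `|r - t| <= w -> ~~ (0 <= r <= eps) \/ r = 0.
  case/orP: h => h; [exists (- t); first by rewrite oppr_gt0
    | exists ((t - eps) / 2); first by rewrite divr_gt0// subr_gt0].
    move=> r; rewrite ler_norml => /andP[_ r1].
    have [->|r0] := eqVneq r 0; [by right|left].
    by rewrite negb_and -!ltNge lt_neqAle r0 /= (_ : r <= 0)//; move: r1; lra.
  move=> r; rewrite ler_norml => /andP[r1 _]; left.
  by rewrite negb_and -!ltNge (_ : eps < r) ?orbT//; move: h r1; lra.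
apply: (is_derive_locally_cst (c := 0) w0 _ (smooth_is_derive sm t)) => r /wP[].
  exact: mollifier_support.
by move=> ->; exact: m0.
Qed.

Lemma mollifier_continuous : continuous m.
Proof. by case: hm => sm _ _ _; exact: smooth_continuous. Qed.

Lemma mollifier_derive_continuous : continuous (derive1 m).
Proof. by case: hm => sm _ _ _; apply: smooth_continuous; exact: smooth_derive1. Qed.

Lemma continuous_reflect (k : R -> R) (r : R) : continuous k -> continuous (fun t => k (r - t)).
Proof.
move=> ck t; apply: (@continuous_comp _ _ _ (fun t => r - t) k); last exact: ck.
by apply: cvgB; [exact: cvg_cst|exact: cvg_id].
Qed.

Lemma continuous_translate (k : R -> R) (r : R) : continuous k -> continuous (fun t => k (t - r)).
Proof.
move=> ck t; apply: (@continuous_comp _ _ _ (fun t => t - r) k); last exact: ck.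
by apply: cvgB; [exact: cvg_id|exact: cvg_cst].
Qed.

Lemma is_derive_reflect (E : normedModType R) (f f' : R -> E) (r t : R) :
  (forall s : R, is_derive s 1 f (f' s)) ->
  is_derive t 1 (fun s => f (r - s)) (- f' (r - t)).
Proof.
move=> df; have := is_derive_affine (-1) r t df.
rewrite mulN1r (addrC (- t)) scaleN1r; congr is_derive.
by apply/funext => s; rewrite mulN1r addrC.
Qed.

Lemma is_derive_translate (E : normedModType R) (f f' : R -> E) (r t : R) :
  (forall s : R, is_derive s 1 f (f' s)) ->
  is_derive t 1 (fun s => f (s - r)) (f' (t - r)).
Proof.
move=> df; have := is_derive_affine 1 (- r) t df.
by rewrite mul1r scale1r; congr is_derive; apply/funext => s; rewrite mul1r.
Qed.

Lemma reflect_support (r t : R) : ~~ (r - eps <= t <= r) -> ~~ (0 <= r - t <= eps).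
Proof. by apply: contra => /andP[h1 h2]; apply/andP; split; move: h1 h2; lra. Qed.

Lemma translate_support (r t : R) : ~~ (r <= t <= r + eps) -> ~~ (0 <= t - r <= eps).
Proof. by apply: contra => /andP[h1 h2]; apply/andP; split; move: h1 h2; lra. Qed.

Lemma mollifier_int_reflect r : \int[mu]_t m (r - t) = 1.
Proof.
have [_ _ _ [s [ds s0 s1]]] := hm.
have dF (t : R) : is_derive t 1 (fun t => - s (r - t)) (m (r - t)).
  by have := is_deriveN (is_derive_reflect r t ds); rewrite opprK.
have re : r - eps < r by rewrite ltrBlDr ltrDl.
rewrite [LHS](int_FTC re _ dF); first by rewrite subrr s0// s1 ?subKr// oppr0 sub0r opprK.
  exact/continuous_reflect/mollifier_continuous.
by move=> t /reflect_support /mollifier_support.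
Qed.

Lemma mollifier_int_translate r : \int[mu]_t m (t - r) = 1.
Proof.
have [_ _ _ [s [ds s0 s1]]] := hm.
have dF (t : R) : is_derive t 1 (fun t => s (t - r)) (m (t - r)).
  exact: is_derive_translate.
have re : r < r + eps by rewrite ltrDl.
rewrite [LHS](int_FTC re _ dF).
- by rewrite subrr (s0 0)// s1 ?subr0 1?addrAC ?subrr ?add0r//.
- exact/continuous_translate/mollifier_continuous.
- by move=> t /translate_support /mollifier_support.
Qed.

End Properties.
End Mollifier.

Section Regularization.
Variables (R : realType) (H : hilbertType R).
Local Notation T := (measurableTypeR R).
Local Notation mu := (@lebesgue_measure R).
Local Notation integrable g := (mu.-integrable setT (EFin \o g)).

Fact idbop_linear : linear (fun x : H => x). Proof. by []. Qed.
Fact idbop_bounded : exists M : R, forall x : H, `|x| <= M * `|x|.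
Proof. by exists 1 => x; rewrite mul1r. Qed.
Definition idbop : bop H := Bop idbop_linear idbop_bounded.

(** Mollification becomes a convolution with a causal kernel, so its continuity and support
    properties are those of convolutions. *)
Definition scalar_kernel (k : R -> R) (t : R) : bop H := k t *: idbop.

Lemma scalar_causal_kernel (k : R -> R) (eps : R) : continuous k ->
  (forall t, ~~ (0 <= t <= eps) -> k t = 0) -> causal_kernel (scalar_kernel k).
Proof.
move=> ck k0; split.
- by apply: sm_scale; [exact: sm_continuous|exact: sm_cst].
- have := integrable_mulr `|idbop| (integrable_norm (integrable_compact ck k0)).
  congr mu.-integrable; apply/funext => t /=; rewrite normrZ//.
- by move=> t t0; rewrite /scalar_kernel k0 ?scale0r// leNgt t0.
Qed.

Lemma dotp_regularized (k : R -> R) (eps b t : R) (u : R -> H) x : continuous k ->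
  (forall t, ~~ (0 <= t <= eps) -> k t = 0) -> ccont b u ->
  dotp (convolution (scalar_kernel k) u t) x = \int[mu]_s (k (t - s) * dotp (u s) x).
Proof.
move=> ck k0 [cu _]; rewrite dotp_bochner.
  by apply: eq_Rintegral => s _; rewrite dotpZl.
apply: (@bintegrable_compact R H (fun s => k (t - s)) u (t - eps) t _ cu).
  exact: continuous_reflect.
by move=> s /reflect_support; exact: k0.
Qed.

Section ByMollifier.
Variables (eps : R) (m : R -> R).
Hypotheses (e0 : 0 < eps) (hm : mollifier eps m).
Local Notation Rm := (convolution (scalar_kernel m)).
Local Notation Rm' := (convolution (scalar_kernel (derive1 m))).

Lemma mollifier_kernel : causal_kernel (scalar_kernel m).
Proof.
by apply: (@scalar_causal_kernel m eps); [exact: mollifier_continuous hm|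
  exact: mollifier_support hm].
Qed.

Lemma mollifier_derive_kernel : causal_kernel (scalar_kernel (derive1 m)).
Proof.
by apply: (@scalar_causal_kernel _ eps); [exact: mollifier_derive_continuous hm|
  exact: mollifier_derive_support hm].
Qed.

Lemma mollify_le (u : R -> H) (t e : R) : continuous u ->
  (forall s, t - eps <= s <= t -> `|u s - u t| <= e) -> `|Rm u t - u t| <= e.
Proof.
move=> cu ue.
apply: (@bochner_average R H (fun s => m (t - s)) u (t - eps) t e (u t)) => //.
- exact/continuous_reflect/(mollifier_continuous hm).
- by move=> s /reflect_support; exact: mollifier_support hm _.
- by case: hm.
- exact: mollifier_int_reflect e0 hm _.
Qed.

(** Integration by parts in [s]; the product of [m (t - s)] with the primitive vanishes at both ends
    of the interval. *)
Lemma mollify_parts b (u : R -> H) : ccont b u -> Rm' (primitive b u) = Rm u.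
Proof.
move=> hu; apply/funext => t; apply: dotp_inj => x.
have hU := ccont_primitive hu; have [cu u0] := hu; have [cU U0] := hU.
have cm := mollifier_continuous hm; have cm' := mollifier_derive_continuous hm.
rewrite [LHS](dotp_regularized _ _ cm' (mollifier_derive_support hm) hU).
rewrite [RHS](dotp_regularized _ _ cm (mollifier_support hm) hu).
have cd (w : R -> H) : continuous w -> continuous (fun s => dotp (w s) x).
  by move=> cw; apply: continuous_dotp => // ?; exact: cvg_cst.
have supp (k : R -> R) (g : R -> R) : (forall t, ~~ (0 <= t <= eps) -> k t = 0) ->
    forall s, ~~ (t - eps <= s <= t) -> k (t - s) * g s = 0.
  by move=> k0 s /reflect_support /k0 ->; rewrite mul0r.
have cc (k g : R -> R) : continuous k -> continuous g ->
    continuous (fun s => k (t - s) * g s).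
  by move=> ck cg s; apply: cvgM; [exact: continuous_reflect|exact: cg].
have c1 := cc _ _ cm' (cd _ cU); have c2 := cc _ _ cm (cd _ cu).
have s1 := supp _ (fun s => dotp (primitive b u s) x) (mollifier_derive_support hm).
have s2 := supp _ (fun s => dotp (u s) x) (mollifier_support hm).
have i1 := integrable_compact c1 s1; have i2 := integrable_compact c2 s2.
apply/eqP; rewrite -subr_eq0 -opprB oppr_eq0 -RintegralB//.
pose F s := m (t - s) * dotp (primitive b u s) x.
have F0 s : m (t - s) = 0 -> F s = 0 by rewrite /F => ->; rewrite mul0r.
have dF (s : R) : is_derive s 1 F
    (m (t - s) * dotp (u s) x - derive1 m (t - s) * dotp (primitive b u s) x).
  have sm : smooth m by case: hm.
  have d1 := is_derive_reflect t s (smooth_is_derive sm).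
  have d2 := is_derive_dotpl x (is_derive_primitive hu s).
  have := is_deriveM d1 d2; move=> /is_derive_eq; apply.
  by rewrite /GRing.scale /= mulrN [X in _ - X]mulrC.
(* The left end is moved out by [1] because [mollifier_support] speaks only of points strictly
   outside [[0, eps]]. *)
have te : t - eps - 1 < t by move: e0; lra.
have cF : continuous (fun s => m (t - s) * dotp (u s) x -
    derive1 m (t - s) * dotp (primitive b u s) x).
  by move=> s; apply: cvgB; [exact: c2|exact: c1].
have -> := int_FTC te cF dF; last first.
  move=> s h; have {}h : ~~ (t - eps <= s <= t).
    by apply: contra h => /andP[h1 ->]; rewrite andbT; move: h1; lra.
  by rewrite s1// s2// subrr.
rewrite (F0 t) ?(F0 (t - eps - 1)) ?subrr//.
  apply: (mollifier_support hm).
  by rewrite negb_and -!ltNge (_ : eps < _) ?orbT//; lra.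
by case: hm => _ _ h _; exact: h.
Qed.

(** [u] is only continuous, but its mollification equals the convolution of [m'] with the primitive
    of [u], which is differentiable. *)
Lemma is_derive_mollify b (u : R -> H) : ccont b u ->
  forall t : R, is_derive t 1 (Rm u) (Rm' u t).
Proof.
move=> hu; rewrite -(mollify_parts hu).
exact: is_derive_conv mollifier_derive_kernel (ccont_primitive hu) hu (is_derive_primitive hu).
Qed.

End ByMollifier.
End Regularization.

(** * Fubini for integrands dominated by a product *)

Section DominatedFubini.
Variable R : realType.
Local Notation T := (measurableTypeR R).
Local Notation mu := (@lebesgue_measure R).
Local Notation integrable g := (mu.-integrable setT (EFin \o g)).

(** The majorant is a product of integrable functions, which gives integrability on the plane and of
    every section, as needed to pass between real and extended integrals. *)
Lemma Rintegral_Fubini (f : T -> T -> R) (g h : T -> R) :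
  measurable_fun setT (fun p : T * T => f p.1 p.2) ->
  integrable g -> integrable h -> (forall t r, `|f t r| <= `|g t| * `|h r|) ->
  \int[mu]_t \int[mu]_r f t r = \int[mu]_r \int[mu]_t f t r.
Proof.
move=> mf ig ih fgh.
have mg : measurable_fun setT g by case/integrableP: ig => /measurable_EFinP.
have mh : measurable_fun setT h by case/integrableP: ih => /measurable_EFinP.
have igh : (mu \x mu)%E.-integrable setT (fun p : T * T => (g p.1 * h p.2)%:E).
  apply/integrable12ltyP.
    apply/measurable_EFinP/measurable_funM; first exact: measurableT_comp.
    exact: measurableT_comp.
  pose Ih : R := \int[mu]_r `|h r|.
  have Ih0 : 0 <= Ih by apply: Rintegral_ge0.
  have IhE : Ih%:E = (\int[mu]_r `|(h r)%:E|)%E.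
    rewrite /Ih /Rintegral fineK//.
    by apply: integrable_fin_num => //; exact: integrable_norm.
  have -> : (\int[mu]_t \int[mu]_r `|(g t * h r)%:E| = \int[mu]_t `|(g t * Ih)%:E|)%E.
    apply: eq_integral => t _; rewrite /= normrM (ger0_norm Ih0) EFinM IhE.
    rewrite -ge0_integralZl//; last by do 2 apply: measurableT_comp => //.
    by apply: eq_integral => r _; rewrite /= normrM.
  by case/integrableP: (integrable_mulr Ih ig).
have If : (mu \x mu)%E.-integrable setT (fun p : T * T => (f p.1 p.2)%:E).
  apply: le_integrable igh => //; first exact/measurable_EFinP.
  by move=> [t r] _ /=; rewrite lee_fin (le_trans (fgh _ _))// normrM.
have i1 t : integrable (f t).
  apply: (@integrable_le R _ (fun r => `|h r| * `|g t|)).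
  - exact: (measurableT_comp mf (pair1_measurable t)).
  - by move=> r; rewrite mulrC.
  - by apply: integrable_mulr; exact: integrable_norm.
have i2 r : integrable (fun t => f t r).
  apply: (@integrable_le R _ (fun t => `|g t| * `|h r|)) => //.
  - exact: (measurableT_comp mf (pair2_measurable r)).
  - by apply: integrable_mulr; exact: integrable_norm.
have := Fubini If => /= E.
have -> : \int[mu]_t \int[mu]_r f t r = fine (\int[mu]_t \int[mu]_r (f t r)%:E)%E.
  rewrite {1}/Rintegral; congr fine; apply: eq_integral => t _.
  by rewrite /= /Rintegral fineK//; exact: (integrable_fin_num measurableT (i1 t)).
rewrite E {1}/Rintegral; congr fine; apply: eq_integral => t _.
by rewrite /= /Rintegral fineK//; exact: (integrable_fin_num measurableT (i2 t)).
Qed.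

End DominatedFubini.

(** * The adjoint convolution on reflected test functions *)

Section AdjointConvolution.
Variables (R : realType) (H : hilbertType R).
Local Notation T := (measurableTypeR R).
Local Notation mu := (@lebesgue_measure R).
Local Notation integrable g := (mu.-integrable setT (EFin \o g)).
Implicit Types (Q : R -> bop H) (u : R -> H).

Lemma bochner_reflect (F : R -> H) (t : R) : bintegrable (F : T -> H) ->
  bochner (fun s : T => F (t - s)) = bochner (F : T -> H).
Proof.
move=> bF; have [mF iF] := bF.
have bF' : bintegrable (fun s : T => F (t - s)).
  split; first exact: (sm_precomp (@measurable_reflect R t) mF).
  exact: (reflect_integrable t iF).
apply: dotp_inj => x; rewrite [LHS](dotp_bochner _ bF') [RHS](dotp_bochner _ bF).
exact: (reflect_Rintegral t (dotp_integrable x bF)).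
Qed.

(** Reflection exchanges past and future, so the anticausal adjoint becomes the causal convolution,
    to which the earlier estimates apply. *)
Lemma convolution_adj_reflect Q (w : R -> H) (r t : R) : causal_kernel Q -> lbounded w ->
  convolution_adj Q (fun s => w (r - s)) t = convolution Q w (r - t).
Proof.
move=> hQ lw; rewrite /convolution_adj /convolution.
rewrite -(bochner_reflect r (conv_bintegrable (r - t) hQ lw)).
by congr bochner; apply/funext => s; rewrite (_ : r - t - (r - s) = s - t)//; ring.
Qed.

(** Strong measurability is defined on the line only; on the plane the simple approximants of [Q]
    and [u] are paired directly. *)
Lemma measurable_pairing Q u x : strongly_measurable Q -> continuous u ->
  measurable_fun setT (fun p : T * T => dotp (Q p.2 (u p.1)) x).
Proof.
move=> [Q_ sQ cQ] /sm_continuous[u_ su cu]; apply/measurable_EFinP.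
pose s_ n (p : T * T) := dotp (Q_ n p.2 (u_ n p.1)) x.
apply: (emeasurable_fun_cvg (fun n => EFin \o s_ n)) => [n|p _].
  apply/measurable_EFinP => _ Y mY; rewrite setTI.
  have h1 := fsimple_precomp (@measurable_snd _ _ T T) (sQ n).
  have h2 := fsimple_precomp (@measurable_fst _ _ T T) (su n).
  exact: (fsimple_preimage Y (fsimple_comp (fun q => dotp (bop_fun q.1 q.2) x) (fsimple_pair h1 h2))).
apply/fine_cvgP; split; first by near=> n.
apply: cvg_dotp; last exact: cvg_cst.
exact: cvg_bop (cQ _) (cu _).
Unshelve. all: by end_near. Qed.

(** Both sides are iterated integrals of [k (r - t - s) <Q(s) u(t), x>], in opposite orders.
    Self-adjointness of [Q(s)] moves the operator from the test vector to [u]. *)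
Lemma convolution_adj_pairing Q u (k : R -> R) (eps b r : R) x : causal_kernel Q ->
  (forall t, selfadjoint (Q t)) -> ccont b u -> continuous k ->
  (forall t, ~~ (0 <= t <= eps) -> k t = 0) -> k 0 = 0 ->
  integrable (fun t => dotp (u t) (convolution_adj Q (fun s => k (r - s) *: x) t)) /\
  \int[mu]_t dotp (u t) (convolution_adj Q (fun s => k (r - s) *: x) t) =
  dotp (convolution Q (convolution (scalar_kernel H k) u) r) x.
Proof.
move=> hQ sQ hu ck k0 k00; have [cu u0] := hu.
pose w t := k t *: x.
have hw : ccont 0 w.
  split=> t; first by apply: cvgZ; [exact: ck|exact: cvg_cst].
  rewrite le_eqVlt => /predU1P[->|t0]; rewrite /w ?k00 ?scale0r// k0 ?scale0r//.
  by rewrite leNgt t0.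
have lw := ccont_lbounded hw.
have adjE t : convolution_adj Q (fun s => k (r - s) *: x) t = convolution Q w (r - t).
  exact: convolution_adj_reflect.
have [cg g0] := ccont_conv hQ hw.
split.
  apply: (@integrable_compact R _ b r) => [t|t].
    under eq_fun do rewrite adjE; apply: cvg_dotp; first exact: cu.
    apply: (@continuous_comp _ _ _ (fun t => r - t) (convolution Q w)); last exact: cg.
    by apply: cvgB; [exact: cvg_cst|exact: cvg_id].
  rewrite negb_and -!ltNge => /orP[tb|rt]; first by rewrite u0 ?dotp0l// ltW.
  by rewrite adjE g0 ?dotp0r// subr_le0 ltW.
have [mQ iQ Q0] := hQ.
have hk := scalar_causal_kernel H ck k0.
have huk := ccont_conv hk hu.
rewrite [RHS](dotp_conv _ _ hQ (ccont_lbounded huk)).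
have [U U0 UP] := ccont_bounded r hu.
have [K' K'0 K'P] : exists2 K' : R, 0 <= K' & forall t, `|k t| <= K'.
  have [K' K'0 K'P] := continuous_bounded 0 eps ck; exists K' => // t.
  by have [/K'P//|/k0 ->] := boolP (0 <= t <= eps); rewrite normr0.
pose f t s := k (r - t - s) * dotp (Q s (u t)) x.
have LE t : dotp (u t) (convolution_adj Q (fun s => k (r - s) *: x) t) = \int[mu]_s f t s.
  rewrite adjE dotpC [LHS](dotp_conv _ _ hQ lw); apply: eq_Rintegral => s _.
  by rewrite sQ dotpZl /f dotpC.
have RE s : dotp (Q s (convolution (scalar_kernel H k) u (r - s))) x = \int[mu]_t f t s.
  rewrite sQ [LHS](dotp_regularized _ _ ck k0 hu); apply: eq_Rintegral => t _.
  by rewrite /f sQ addrAC.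
under eq_Rintegral do rewrite LE.
under [RHS]eq_Rintegral do rewrite RE.
(* The integrand vanishes off [[b, r]] in [t]: before [b] because [u] does, and after [r] because
   either [s < 0] and [Q s = 0], or the argument of [k] is negative. *)
apply: (@Rintegral_Fubini R f (fun t => \1_(`[b, r] : set R) t * (K' * (U * `|x|)))
  (fun s => `|Q s|)).
- apply: measurable_funM; last exact: measurable_pairing.
  have mk : measurable_fun setT (k : T -> R) by exact: continuous_measurable_fun.
  apply: (measurableT_comp mk); apply: measurable_funB; last exact: measurable_snd.
  by apply: measurable_funB; [exact: measurable_cst|exact: measurable_fst].
- by apply: integrable_mulr; exact: integrable_indic_itv.
- exact: iQ.
move=> t s; rewrite indicE.
have [|] := boolP (t \in `[b, r]%classic).
  rewrite inE /= in_itv/= => /andP[_ tr].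
  rewrite mul1r normr_id [X in _ <= X * _]ger0_norm ?mulr_ge0// /f normrM -mulrA ler_pM//.
  rewrite (le_trans (cauchy_schwarz _ _))// mulrAC ler_wpM2r//.
  by rewrite (le_trans (bop_le _ _))// mulrC ler_wpM2r// UP.
rewrite notin_setE /= in_itv/= => /negP; rewrite mul0r normr0 mul0r normr_le0 /f.
rewrite negb_and -!ltNge => /orP[tb|rt]; first by rewrite (u0 _ (ltW tb)) bop_zero dotp0l mulr0.
have [s0|s0] := ltP s 0; first by rewrite Q0// /= dotp0l mulr0.
by rewrite k0 ?mul0r// negb_and -!ltNge (_ : _ < 0)//; move: rt s0; lra.
Qed.

End AdjointConvolution.

(** * From weak to strong solutions by mollification *)

Section WeakToStrong.
Variables (R : realType) (H V : hilbertType R) (j P : {linear V -> H}).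
Local Notation T := (measurableTypeR R).
Local Notation mu := (@lebesgue_measure R).

(* Testing with [t |-> m (r - t) v] turns the weak formulation of an equation
   into the strong one for the mollified solution. *)
Lemma weak_mollify (A B : bop H) Q (F w : R -> H) (b eps : R) (m : R -> R) :
  causal_kernel Q -> (forall t, selfadjoint (Q t)) -> selfadjoint A ->
  ccont b F -> ccont b w -> weak_solution j P A B Q F w ->
  0 < eps -> mollifier eps m ->
  strong j P b A B Q (convolution (scalar_kernel H m) F)
    (convolution (scalar_kernel H m) w)
    (convolution (scalar_kernel H (derive1 m)) w).
Proof.
move=> hQ sQ sA hF hw [_ wk] e0 hm.
have hk := mollifier_kernel H hm; have hk' := mollifier_derive_kernel H hm.
have dw := is_derive_mollify e0 hm hw.
split; [exact: ccont_conv|exact: ccont_conv|exact: dw|].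
move=> r v.
have [cw _] := hw; have [cF _] := hF.
have sm : smooth m by case: hm.
pose phi t : V := m (r - t) *: v.
have dphi (t : R) : is_derive t 1 phi (- derive1 m (r - t) *: v).
  by apply: is_derive_scalel; exact: is_derive_reflect (smooth_is_derive sm).
have tphi : test_fun phi.
  split; first by have := @smooth_scale R V _ v (smooth_affine (c := -1) (d := r) sm); congr smooth;
    apply/funext => t; rewrite /phi mulN1r addrC.
  exists (`|r| + eps) => t ht; rewrite /phi (mollifier_support hm) ?scale0r//.
  rewrite negb_and -!ltNge; move: ht; rewrite ltr_normr.
  have := ler_norm r; have := ler_norm (- r); rewrite normrN => h1 h2.
  by case/orP => h3; apply/orP; [left|right]; move: h1 h2 h3 e0; lra.
have := wk _ tphi.
pose G1 t := derive1 m (r - t) *: w t; pose G2 t := m (r - t) *: w t.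
pose G3 t := m (r - t) *: F t.
have b1 : bintegrable G1.
  apply: (@bintegrable_compact R H _ _ (r - eps) r _ cw).
    exact/continuous_reflect/(mollifier_derive_continuous hm).
  by move=> t /reflect_support; exact: mollifier_derive_support hm _.
have b2 : bintegrable G2.
  apply: (@bintegrable_compact R H _ _ (r - eps) r _ cw).
    exact/continuous_reflect/(mollifier_continuous hm).
  by move=> t /reflect_support; exact: mollifier_support hm _.
have b3 : bintegrable G3.
  apply: (@bintegrable_compact R H _ _ (r - eps) r _ cF).
    exact/continuous_reflect/(mollifier_continuous hm).
  by move=> t /reflect_support; exact: mollifier_support hm _.
have m0 : m 0 = 0 by case: hm => _ _ h _; exact: h.
have [i4 E4] := convolution_adj_pairing r (j v) hQ sQ hw (mollifier_continuous hm)
  (mollifier_support hm) m0.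
pose p4 t := dotp (w t) (convolution_adj Q (fun s => m (r - s) *: j v) t).
pose y1 := - A (j v); pose y2 := P v - adjoint B (j v).
have i1 := dotp_integrable y1 b1; have i2 := dotp_integrable y2 b2.
have i12 := integrable_add i1 i2.
(* As [phi] is a scalar function times the fixed vector [v], the left-hand side splits into pairings
   of mollifications with fixed vectors. The minus sign in [y1] comes from differentiating
   [m (r - t)]. *)
have EL : \int[mu]_t dotp (w t) (A (j (derive1 phi t)) + P (phi t)
    - adjoint B (j (phi t)) - convolution_adj Q (j \o phi) t) =
    dotp (bochner G1) y1 + dotp (bochner G2) y2 - \int[mu]_t p4 t.
  rewrite [X in X + _ - _](dotp_bochner _ b1) [X in _ + X - _](dotp_bochner _ b2).
  rewrite -(RintegralD measurableT i1 i2) -(RintegralB measurableT i12 i4).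
  apply: eq_Rintegral => t _.
  have -> : j \o phi = (fun s => m (r - s) *: j v).
    by apply/funext => s; rewrite /= linearZ.
  rewrite -/(p4 t) (is_derive1E (dphi t)) /phi !linearZ /= /G1 /G2 /y1 /y2.
  rewrite !dotpBr !dotpDr -adjointE -/(p4 t) !dotpZr !dotpZl dotpNr -adjointE; ring.
have ER : \int[mu]_t dotp (F t) (j (phi t)) = dotp (bochner G3) (j v).
  rewrite [RHS](dotp_bochner _ b3); apply: eq_Rintegral => t _.
  by rewrite /phi linearZ dotpZr dotpZl.
rewrite EL ER -/p4 in i4 E4 *; rewrite [X in _ - X]E4.
set c1 := bochner G1; set c2 := bochner G2; set c3 := bochner G3 => E.
suff h : dotp c2 (P v) = - dotp (j v) (c3 - A c1 - B c2 -
    convolution Q (convolution (scalar_kernel H m) w) r).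
  exact: (etrans (dotpC _ _) h).
move: E; clearbody c1 c2 c3.
move: (convolution Q _ r) => c4 E.
have q1 : dotp c1 y1 = - dotp (A c1) (j v) by rewrite /y1 dotpNr sA.
have q2 : dotp c2 y2 = dotp c2 (P v) - dotp (B c2) (j v).
  by rewrite /y2 dotpBr adjointE.
rewrite q1 q2 in E; rewrite [dotp (j v) _]dotpC !dotpBl.
move: (dotp c2 (P v)) (dotp (A c1) (j v)) (dotp (B c2) (j v)) (dotp c3 (j v))
  (dotp c4 (j v)) E; clear => a1 a2 a3 a4 a5; lra.
Qed.

End WeakToStrong.

(** * Functions in [H^1] as integrals of their weak derivative *)

Section WeakDerivative.
Variables (R : realType) (H : hilbertType R).
Local Notation T := (measurableTypeR R).
Local Notation mu := (@lebesgue_measure R).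
Local Notation integrable g := (mu.-integrable setT (EFin \o g)).

Lemma Lp2_integrable (g : R -> H) : Lp 2%:E g -> integrable (fun t => `|g t| ^+ 2).
Proof.
move=> [mg fg]; apply/integrableP; split.
  apply/measurable_EFinP; apply: measurable_funX; exact: sm_measurable_norm.
have : (vLnorm 2%:E g `^ 2 < +oo)%E by rewrite poweRE pnatr_eq0 /=; case: (vLnorm _ _) fg => [r _|//|_] /=; rewrite ltry.
rewrite /vLnorm poweR_Lnorm//; apply: le_lt_trans; rewrite le_eqVlt; apply/orP; left.
apply/eqP; apply: eq_integral => t _ /=.
by rewrite normr_id powR_mulrn// ger0_norm// sqr_ge0.
Qed.

Lemma int_indic (a b : R) : a <= b -> \int[mu]_t (\1_(`[a, b] : set T) t) = b - a.
Proof.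
move=> ab; have mD : measurable (`[a, b] : set T) by exact: measurable_itv.
have E : (\int[mu]_t (\1_(`[a, b] : set T) t)%:E = mu (`[a, b] : set T))%E.
  by rewrite integral_indic// setIT.
have F : mu (`[a, b] : set T) = (b - a)%:E.
  rewrite lebesgue_measure_itv /= lte_fin; case: ltP => // ba.
  by rewrite (@le_anti _ _ a b) ?subrr// ab.
by rewrite /Rintegral E F.
Qed.

(** The inequality [y <= K + y ^ 2 / K] replaces Cauchy-Schwarz; with [K] free, a short interval
    makes the bound as small as desired. *)
Lemma Lp2_itv (g : R -> H) (a b K : R) : Lp 2%:E g -> a <= b -> 0 < K ->
  integrable (fun t => \1_(`[a, b] : set T) t * `|g t|) /\
  \int[mu]_t (\1_(`[a, b] : set T) t * `|g t|) <=
    (b - a) * K + (\int[mu]_t `|g t| ^+ 2) * K^-1.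
Proof.
move=> hg ab K0; have i2 := Lp2_integrable hg; have [mg _] := hg.
have mD : measurable (`[a, b] : set T) by exact: measurable_itv.
have i1 : integrable (fun t => \1_(`[a, b] : set T) t) := integrable_indic_itv a b true false.
have iK := integrable_mulr K i1; have i2K := integrable_mulr K^-1 i2.
have le t : \1_(`[a, b] : set T) t * `|g t| <= \1_(`[a, b] : set T) t * K + `|g t| ^+ 2 * K^-1.
  rewrite indicE; case: (_ \in _); last by rewrite !mul0r add0r mulr_ge0 ?sqr_ge0// invr_ge0 ltW.
  rewrite !mul1r -(ler_pM2r K0) mulrDl mulfVK ?gt_eqF//.
  have := normr_ge0 (g t); move: (`|g t|) => y y0.
  by move: K0 y0; clear => K0 y0; nra.
have ig : integrable (fun t => \1_(`[a, b] : set T) t * `|g t|).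
  apply: integrable_le (integrable_add iK i2K) => [|t]; last by rewrite ger0_norm ?mulr_ge0.
  by apply: measurable_funM; [exact: measurable_indic|exact: sm_measurable_norm].
split=> //; rewrite (le_trans (le_int ig (integrable_add iK i2K) le))//.
rewrite (RintegralD measurableT iK i2K) (RintegralZr _ measurableT i1).
by rewrite (RintegralZr _ measurableT i2) int_indic.
Qed.

Lemma Lp2_bintegrable (g : R -> H) (a b : R) : Lp 2%:E g ->
  bintegrable (fun t => \1_(`[a, b] : set T) t *: g t).
Proof.
move=> hg; have [mg _] := hg.
have mD : measurable (`[a, b] : set T) by exact: measurable_itv.
have [ab|ba] := leP a b; last first.
  have -> : (fun t => \1_(`[a, b] : set T) t *: g t) = (fun=> 0).
    apply/funext => t; rewrite indicE memNset ?scale0r//= in_itv/= => /andP[h1 h2].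
    by move: (le_lt_trans (le_trans h1 h2) ba); rewrite ltxx.
  have := bintegrable_compact (k := fun=> 0) (a := 0) (b := 0) _ (fun t => cvg_cst (0 : H)).
  under [X in bintegrable X]eq_fun do rewrite scaler0.
  by apply=> // t; exact: cvg_cst.
have [ig _] := Lp2_itv hg ab ltr01.
split; first by apply: sm_scale => //; exact: sm_indic.
by under eq_fun do rewrite normrZ ger0_norm//.
Qed.

(** The smoothed indicator rises on [[a - eps, a]] and falls on [[s, s + eps]]; only in these two
    windows can it differ from the sharp one. *)
Lemma step_window (S : R -> R) (eps a s t : R) : 0 < eps -> a <= s ->
  (forall x y, x <= y -> S x <= S y) -> (forall x, x <= 0 -> S x = 0) ->
  (forall x, eps <= x -> S x = 1) ->
  `|S (t - (a - eps)) - S (t - s) - \1_(`[a, s] : set T) t| <=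
    \1_(`[a - eps, a] : set T) t + \1_(`[s, s + eps] : set T) t.
Proof.
move=> eps0 as_ Smono S0 S1.
have S01 x : 0 <= S x <= 1.
  rewrite -(S0 (Num.min 0 x)) ?ge_min ?lexx// -[X in _ && (_ <= X)](S1 (Num.max eps x)).
    by rewrite !Smono// ?ge_min ?le_max lexx orbT.
  by rewrite le_max lexx.
pose psi := S (t - (a - eps)) - S (t - s).
rewrite -/psi.
have /andP[l1 u1] := S01 (t - (a - eps)); have /andP[l2 u2] := S01 (t - s).
have p1 : `|psi| <= 1 by rewrite ler_norml /psi; apply/andP; split; lra.
have pp : 0 <= psi.
  rewrite subr_ge0; apply: Smono; move: as_ eps0; clear; lra.
have p2 : psi <= 1 by rewrite /psi; lra.
have inI x y z : \1_(`[x, y] : set T) z = (x <= z <= y)%R%:R :> R.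
  by rewrite indicE mem_setE in_itv.
rewrite !inI.
have b01 (c : bool) : ((0 : R) <= (c%:R : R)) && ((c%:R : R) <= 1) by case: c; rewrite ?lexx ler01.
have /andP[l3 u3] := b01 (a <= t <= s); have /andP[l4 u4] := b01 (s <= t <= s + eps).
have [h1|h1] := boolP (a - eps <= t <= a).
  by rewrite /= ler_norml; apply/andP; split; move: pp p2 l3 u3 l4; clear; lra.
have [h2|h2] := boolP (s <= t <= s + eps).
  by rewrite /= ler_norml; apply/andP; split; move: pp p2 l3 u3; clear; lra.
rewrite /= addr0 normr_le0 subr_eq0 /psi.
have [ta|ta] := leP t (a - eps).
  rewrite S0 ?subr_le0// S0 ?subr_le0; last by move: ta eps0 as_; clear; lra.
  by rewrite (_ : a <= t = false) ?subrr//; apply/negbTE; rewrite -ltNge; move: ta eps0; clear; lra.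
have {}h1 : a < t by move: h1; rewrite negb_and -!ltNge => /orP[] //; rewrite ltNge (ltW ta).
rewrite S1; last by move: h1; clear; lra.
rewrite (ltW h1) /=; have [ts|ts] := leP t s; first by rewrite S0 ?subr_le0// subr0.
move: h2; rewrite (ltW ts) /= -ltNge => h2.
by rewrite S1 ?subrr//; move: h2; clear; lra.
Qed.

(** Testing with a smoothed indicator of [[a, s]] yields an average of [f] just after [s] on one
    side and nearly the integral of [g] over [[a, s]] on the other. *)
Lemma weak_derivative_integral (f g : R -> H) (a s : R) : ccont a f -> Lp 2%:E g ->
  weak_derivative f g -> a <= s ->
  f s = bochner (fun t => \1_(`[a, s] : set T) t *: g t).
Proof.
move=> hf hg wd as_; have [cf f0] := hf; have [mg _] := hg.
have mD x y : measurable (`[x, y] : set T) by exact: measurable_itv.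
apply/eqP; rewrite -subr_eq0 -normr_le0; apply/ler_addgt0Pr => e e0; rewrite add0r.
pose G := \int[mu]_t `|g t| ^+ 2.
have G0 : 0 <= G by apply: Rintegral_ge0 => t _; exact: sqr_ge0.
have e4 : 0 < e / 4 by rewrite divr_gt0.
(* First [K] makes [G / K <= e / 4], then [eps] makes [eps K <= e / 8]. The total error is
   [e / 4 + 2 (e / 8 + e / 4) = e]. *)
pose K := 4 * (G + 1) / e.
have K0 : 0 < K by rewrite divr_gt0// mulr_gt0// ltr_wpDl.
have GK : G * K^-1 <= e / 4.
  rewrite /K invf_div mulrA ler_pdivrMr ?mulr_gt0 ?ltr_wpDl//.
  by move: G0 e0; clear => G0 e0; nra.
have [del del0 delP] := ccont_heine s hf e4.
pose eps := Num.min del ((e / 8) / K).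
have eps0 : 0 < eps by rewrite lt_min del0 /= divr_gt0// divr_gt0.
have [epsd epsK] : eps <= del /\ eps * K <= e / 8.
  by rewrite -ler_pdivlMr// !ge_min !lexx orbT.
clearbody eps K.
have [m hm] := mollifier_ex eps0.
have [sm mp m0 [S [dS S0 S1]]] := hm.
have cm := mollifier_continuous hm.
have Smono x y : x <= y -> S x <= S y.
  move=> xy; rewrite -subr_ge0 -(subrr (0 : R)).
  by apply: (@derive_le_le R (fun=> 0) (fun=> 0) S m x y xy).
pose psi t := S (t - (a - eps)) - S (t - s).
have dpsi (t : R) : is_derive t 1 psi (m (t - (a - eps)) - m (t - s)).
  by apply: is_deriveB; exact: is_derive_translate dS.
have tpsi : test_fun psi.
  split.
    apply: (smooth_primitive _ dpsi).
    have s1 := smooth_affine (c := 1) (d := - (a - eps)) sm.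
    have s2 := @smooth_scale R R _ (-1 : R) (smooth_affine (c := 1) (d := - s) sm).
    have := smooth_add s1 s2; congr smooth; apply/funext => t.
    by rewrite !mul1r /GRing.scale /= mulrN1.
  exists (`|a| + `|s| + eps + eps) => t; rewrite ltr_normr => ht; rewrite /psi.
  have := ler_norm a; have := ler_norm (- a); have := ler_norm s; have := ler_norm (- s).
  rewrite !normrN => h1 h2 h3 h4.
  case/orP: ht => ht; [rewrite !S1 ?subrr//|rewrite !S0 ?subrr//];
    by move: h1 h2 h3 h4 ht eps0; clear; lra.
have := wd psi tpsi.
have cB : continuous (fun t => m (t - s)) := continuous_translate (r := s) cm.
have suppB t : ~~ (s <= t <= s + eps) -> m (t - s) = 0.
  by move=> /translate_support; exact: mollifier_support hm _.
have bB := bintegrable_compact cB cf suppB.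
(* The rising edge of [psi] lies where [f] vanishes, so only the falling edge at [s] survives. *)
have -> : (fun t => derive1 psi t *: f t) = (fun t => -1 *: (m (t - s) *: f t)).
  apply/funext => t; rewrite (is_derive1E (dpsi t)).
  have [/f0->|at_] := leP t a; first by rewrite !scaler0.
  rewrite (mollifier_support hm (t := t - (a - eps))) ?sub0r ?scaleN1r ?scaleNr//.
  by rewrite negb_and -!ltNge (_ : eps < _) ?orbT//; move: at_; lra.
rewrite [LHS](bochner_scale (-1) bB) scaleN1r => /oppr_inj E.
pose r t := \1_(`[a - eps, a] : set T) t + \1_(`[s, s + eps] : set T) t : R.
have psiE t : `|psi t - \1_(`[a, s] : set T) t| <= r t.
  exact: step_window.
have mpsi : strongly_measurable psi.
  by apply: sm_continuous => t; exact: is_derive_continuous (dpsi t).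
have intB := mollifier_int_translate eps0 hm s.
clear tpsi wd dpsi hm sm dS hf.
have bD x y := Lp2_bintegrable x y hg.
have [iA leA] := Lp2_itv (a := a - eps) (b := a) hg (ltac:(rewrite gerBl; exact: ltW eps0)) K0.
have [iB leB] := Lp2_itv (a := s) (b := s + eps) hg (ltac:(rewrite lerDl; exact: ltW eps0)) K0.
have bP : bintegrable (fun t => (psi t - \1_(`[a, s] : set T) t) *: g t).
  apply: (bintegrable_le _ _ (integrable_add iA iB)) => [|t].
    apply: sm_scale mg; apply: (sm_op2 (op := fun x y : R => x - y)) mpsi (sm_indic (mD a s)).
    by move=> x_ y_ x y; exact: cvgB.
  by rewrite normrZ /= -mulrDl ler_wpM2r//; exact: psiE.
have E' : bochner (fun t => psi t *: g t) - bochner (fun t => \1_(`[a, s] : set T) t *: g t) =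
    bochner (fun t => (psi t - \1_(`[a, s] : set T) t) *: g t).
  apply/eqP; rewrite subr_eq -(bochner_add bP (bD a s)); apply/eqP.
  by congr bochner; apply/funext => t; rewrite -scalerDl subrK.
have n1 : `|bochner (fun t => m (t - s) *: f t) - f s| <= e / 4.
  apply: (bochner_average cB cf suppB (fun t => mp (t - s)) intB) => t /andP[st ts].
  apply: (delP s t (lexx s)); rewrite ger0_norm; last by (rewrite subr_ge0; exact: st).
  rewrite lerBlDl; apply: (le_trans ts); rewrite lerD2l; exact: epsd.
have n2 : `|bochner (fun t => (psi t - \1_(`[a, s] : set T) t) *: g t)| <=
    eps * K + G * K^-1 + (eps * K + G * K^-1).
  apply: (le_trans (bochner_norm_le bP)).
  have le1 : \int[mu]_t `|(psi t - \1_(`[a, s] : set T) t) *: g t| <=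
      \int[mu]_t (\1_(`[a - eps, a] : set T) t * `|g t| + \1_(`[s, s + eps] : set T) t * `|g t|).
    apply: (le_int bP.2 (integrable_add iA iB)) => t.
    by rewrite normrZ /= -mulrDl ler_wpM2r//; exact: psiE.
  apply: (le_trans le1); rewrite (RintegralD measurableT iA iB); apply: lerD.
    by move: leA; rewrite subKr; exact.
  by move: leB; rewrite addrAC subrr add0r; exact.
have -> : f s - bochner (fun t => \1_(`[a, s] : set T) t *: g t) =
    - (bochner (fun t => m (t - s) *: f t) - f s) +
    bochner (fun t => (psi t - \1_(`[a, s] : set T) t) *: g t).
  by rewrite -E' E opprB addrA subrK.
apply: (le_trans (ler_normD _ _)); rewrite normrN.
by move: n1 n2 epsK GK e0; clear; lra.
Qed.

(** The weak derivative is known only through integrals, so it is replaced by [0] before [a].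
    Starting the integrals at [a - 1] leaves the gap of length one in which [cutoff_dense] places
    its ramp. *)
Lemma H1_integral (f : R -> H) (a : R) : H1 f -> ccont a f ->
  exists gam : R -> H, [/\ forall r, r < a -> gam r = 0,
    forall t, bintegrable (fun r => \1_(`[a - 1, t] : set T) r *: gam r) &
    forall s, a - 1 <= s -> f s = bochner (fun r => \1_(`[a - 1, s] : set T) r *: gam r)].
Proof.
move=> [_ _ [g hg wd]] hf; exists (fun r => if a <= r then g r else 0).
have E t : (fun r => \1_(`[a - 1, t] : set T) r *: (if a <= r then g r else 0)) =
    (fun r => \1_(`[a, t] : set T) r *: g r).
  apply/funext => r; rewrite !indicE !mem_setE !in_itv/=.
  have [ar|ra] := leP a r; last by rewrite scaler0 scale0r.
  by rewrite (_ : a - 1 <= r)//; move: ar; clear; lra.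
split=> [r|t|s _]; first by rewrite ltNge => /negbTE ->.
  by rewrite E; exact: Lp2_bintegrable.
rewrite E; have [as_|sa] := leP a s; first exact: weak_derivative_integral.
have [_ f0] := hf; rewrite f0 ?ltW//.
rewrite -[LHS](scale0r (bochner (fun r => \1_(`[a, s] : set T) r *: g r))).
rewrite -(bochner_scale 0 (Lp2_bintegrable a s hg)); congr bochner; apply/funext => r.
rewrite scale0r indicE mem_setE in_itv/= (_ : a <= r <= s = false) ?scale0r//.
by apply/negbTE; rewrite negb_and -!ltNge orbC; case: ltP => //= rs; exact: le_lt_trans sa.
Qed.

End WeakDerivative.

(** * Perturbation of the coefficients *)

Section EssentialBounds.
Variables (R : realType) (E : normedModType R).
Local Notation T := (measurableTypeR R).
Local Notation mu := (@lebesgue_measure R).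

(** Causality is an almost everywhere statement. A nonzero value before [t0] would persist on an
    interval of positive measure by continuity. *)
Lemma causal_continuous_ccont (u : R -> E) : continuous u -> causal (u : T -> E) ->
  exists a, forall b, b <= a -> ccont b u.
Proof.
move=> cu [t0 hN].
have u0 t : t < t0 -> u t = 0.
  move=> tt0; apply/eqP; apply/negPn/negP => ut0.
  have n0 : 0 < `|u t| by rewrite normr_gt0.
  have [del /= del0 delP] := ((cvgrPdist_lt _ _).1 (cu t)) _ n0.
  pose c := Num.min del (t0 - t).
  have c0 : 0 < c by rewrite lt_min del0 subr_gt0.
  have [cd ct] : c <= del /\ c <= t0 - t by rewrite !ge_min !lexx orbT.
  clearbody c.
  have mI : measurable (`]t, t + c[ : set T) by exact: measurable_itv.
  have : mu (`]t, t + c[ : set T) = 0%E.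
    apply: measure_negligible => //; apply: negligibleS hN => s /=.
    rewrite in_itv/= => /andP[ts sc] us0.
    have /delP : ball t del s.
      rewrite /ball /= distrC gtr0_norm ?subr_gt0//.
      by move: sc cd; clear; lra.
    by rewrite us0 ?subr0 ?ltxx//; move: sc ct; clear; lra.
  rewrite lebesgue_measure_itv /= lte_fin ltrDl c0 -EFinB => -[].
  by move: c0; clear; lra.
exists (t0 - 1) => b bt; split=> // t tb; apply: u0.
by move: bt tb; lra.
Qed.

Lemma Linfty_norm_le (D : set T) (F : R -> E) (e : R) : 0 <= e ->
  (forall t, D t -> `|F t| <= e) -> (Linfty_norm D F <= e%:E)%E.
Proof.
move=> e0 Fe; rewrite /Linfty_norm /vLnorm Lnorm.unlock /=.
case: ifP => _; last by rewrite lee_fin.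
apply/ess_sup_inf.ess_supP; apply: aeW => t /=; rewrite normr_id lee_fin /patch.
by case: ifPn => [/set_mem/Fe//|_]; rewrite /cst normr0.
Qed.

Lemma vLnorm_infty_fin (F G : R -> E) (h M : R) : (vLnorm +oo%E F < +oo)%E ->
  (forall t, `|G t| <= M) -> (vLnorm +oo%E (fun t => (F t + h *: G t)%R) < +oo)%E.
Proof.
move=> FM GM; have := FM; rewrite /vLnorm Lnorm.unlock /=.
case: ifP => // _ FN.
have FN' : (ess_sup_inf.ess_sup mu (EFin \o (fun t => `|F t|%R)) < +oo)%E.
  apply: le_lt_trans FN; apply: ess_sup_inf.le_ess_sup; apply: aeW => t /=; by rewrite normr_id.
have [K hK] := ess_sup_inf.ess_supr_bounded FN'.
apply: (@le_lt_trans _ _ (K + `|h| * M)%:E); last exact: ltry.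
apply/ess_sup_inf.ess_supP; apply: filterS hK => t Ft /=; rewrite normr_id lee_fin.
by rewrite (le_trans (ler_normD _ _))// lerD// normrZ ler_wpM2l.
Qed.

Lemma Lp1_integrable (F : R -> E) : Lp 1%:E F <->
  strongly_measurable (F : T -> E) /\ mu.-integrable setT (EFin \o (fun t => `|F t|)).
Proof.
rewrite /Lp /vLnorm Lnorm1; split=> -[mF iF]; split=> //.
  apply/integrableP; split; last by move: iF; congr (_ < _)%E; apply: eq_integral.
  by apply/measurable_EFinP; exact: sm_measurable_norm.
case/integrableP: iF => _; congr (_ < _)%E; exact: eq_integral.
Qed.

End EssentialBounds.

(** * Uniform bounds for the perturbed coefficients *)

Section PerturbedCoefficients.
Variables (R : realType) (H : hilbertType R).
Implicit Types (A B : bop H) (Q : R -> bop H).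

Lemma L1_causal_kernel Q : L1_symm Q -> (forall t, t < 0 -> Q t = 0) -> causal_kernel Q.
Proof. by move=> [/Lp1_integrable[mQ iQ] _] Q0; split. Qed.

Lemma selfadjoint_perturb A dA (h : R) : selfadjoint A -> selfadjoint dA ->
  selfadjoint (A + h *: dA).
Proof. by move=> sA sdA x y /=; rewrite dotpDl dotpDr dotpZl dotpZr sA sdA. Qed.

Lemma form_bound A x : `|dotp (A x) x| <= `|A| * dotp x x.
Proof.
rewrite (le_trans (cauchy_schwarz _ _))// dotp_norm expr2 mulrA ler_wpM2r//.
exact: bop_le.
Qed.

(** What matters later is the order of quantifiers: [c] and [kappa] are chosen before [h]. *)
Lemma coefficients_perturb A B Q dA dB dQ : coefficients A B Q -> selfadjoint dA ->
  L1_symm dQ -> {within `[0, +oo[, continuous dQ} ->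
  (exists M : R, forall t : R, `|dQ t| <= M) -> (forall t : R, t < 0 -> dQ t = 0) ->
  exists c kappa del : R, [/\ 0 < c, 0 < del & forall h, `|h| <= del ->
    coefficients (A + h *: dA) (B + h *: dB) (fun t => Q t + h *: dQ t) /\
    good_coeffs c kappa (A + h *: dA) (B + h *: dB) (fun t => Q t + h *: dQ t)].
Proof.
move=> [Cl [Cu [CB [CQ [[Cl0 CluU CB0 CQ0] [[sA cA BCB] [hQ cQ Q0 nQ]]]]]]] sdA hdQ cdQ
  [M dQM] dQ0.
have kQ := L1_causal_kernel hQ Q0; have kdQ := L1_causal_kernel hdQ dQ0.
(* The second bound lets [h dA] change the form of [A] by at most half its coercivity constant;
   [|h| <= 1] bounds the perturbations of [B] and [Q]. *)
pose del := Num.min 1 (Cl / 2 / (`|dA| + 1)).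
have a0 : 0 < `|dA| + 1 by rewrite ltr_wpDl.
have del0 : 0 < del by rewrite lt_min ltr01 /= divr_gt0// divr_gt0.
have [del1 delA] : del <= 1 /\ del * (`|dA| + 1) <= Cl / 2.
  by rewrite -ler_pdivlMr// !ge_min !lexx orbT.
clearbody del.
exists (Cl / 2), (`|B| + `|dB| + (kmass Q + kmass dQ)), del; split=> //.
  by rewrite divr_gt0.
move=> h hdel; have h1 : `|h| <= 1 := le_trans hdel del1.
have sAh := selfadjoint_perturb h sA sdA.
have hdA x : `|h * dotp (dA x) x| <= Cl / 2 * dotp x x.
  rewrite normrM (le_trans (ler_pM _ _ hdel (form_bound _ _)))// mulrA ler_wpM2r ?dotp_ge0//.
  by rewrite (le_trans _ delA)// ler_wpM2l ?(ltW del0)// lerDl.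
have low x : Cl / 2 * dotp x x <= dotp ((A + h *: dA) x) x <= (Cu + Cl / 2) * dotp x x.
  have /andP[l u] := cA x; have := hdA x; rewrite ler_norml => /andP[l' u'] /=.
  rewrite dotpDl dotpZl; apply/andP; split; rewrite ?mulrDl.
    by move: l l'; clear; move: (dotp _ _) (dotp _ _) (h * _) => p q r; lra.
  by rewrite lerD.
have kQh := kernel_perturb h kQ kdQ; have [mQh iQh Q0h] := kQh.
have Bh : `|B + h *: dB| <= `|B| + `|dB|.
  by rewrite (le_trans (ler_normD _ _))// lerD2l normrZ ler_piMl.
have L1h : Lp 1%:E (fun t => Q t + h *: dQ t) by apply/Lp1_integrable.
have Looh : (vLnorm +oo%E (fun t => (Q t + h *: dQ t)%R) < +oo)%E.
  apply: vLnorm_infty_fin dQM; apply: le_lt_trans (ltry CQ); apply: le_trans nQ.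
  by rewrite leeDr// Lnorm_ge0.
have n1 : (0 <= vLnorm 1%:E (fun t => (Q t + h *: dQ t)%R))%E := Lnorm_ge0 _ _ _.
have noo : (0 <= vLnorm +oo%E (fun t => (Q t + h *: dQ t)%R))%E := Lnorm_ge0 _ _ _.
split; last first.
  split=> // [x|]; first by case/andP: (low x).
  rewrite lerD// (le_trans (kmass_perturb h kQ kdQ))// lerD2l ler_piMr//.
  exact: kmass_ge0.
(* The bound for the kernel is its actual norm and may depend on [h]; only its finiteness has to be
   shown. *)
exists (Cl / 2), (Cu + Cl / 2), (`|B| + `|dB|),
  (fine (vLnorm 1%:E (fun t => (Q t + h *: dQ t)%R) +
         vLnorm +oo%E (fun t => (Q t + h *: dQ t)%R))%E).
split; [split|split; split=> //].
- by rewrite divr_gt0.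
- by rewrite lerDr (le_trans (ltW Cl0)).
- by rewrite addr_ge0.
- by rewrite fine_ge0// adde_ge0.
- split=> // t; apply: selfadjoint_perturb; [by case: hQ|by case: hdQ].
- move=> t; apply: cvgD; first exact: cQ.
  by apply: cvgZ; [exact: cvg_cst|exact: cdQ].
- rewrite fineK// ge0_fin_numE ?adde_ge0// lte_add_pinfty//.
  by case: L1h.
Qed.

End PerturbedCoefficients.

(** * Correspondence between [strong_solution] and [strong] *)

Section SolutionsAndStrong.
Variables (R : realType) (H V : hilbertType R) (j P : {linear V -> H}).
Hypothesis P_skew : skew_adjoint j P.
Hypothesis P_graph : exists c C : R, 0 < c /\
  forall v, c * `|v| <= `|j v| + `|P v| <= C * `|v|.
Local Notation T := (measurableTypeR R).
Local Notation mu := (@lebesgue_measure R).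
Local Notation strong := (strong j P).
Implicit Types (A B : bop H) (Q : R -> bop H).

Lemma strong_of_solution A B Q f u : strong_solution j P A B Q f u -> causal u ->
  exists a, forall b, b <= a -> strong b A B Q f u (derive1 u).
Proof.
move=> [[du cu'] _ [v [cv uv eqn]]] hu.
have cu : continuous u by move=> t; apply/differentiable_continuous/derivable1_diffP.
have [a ua] := causal_continuous_ccont cu hu.
exists (a - 1) => b ba.
have ba' : b <= a by move: ba; lra.
have d (t : R) : is_derive t 1 u (derive1 u t).
  by apply: DeriveDef; [exact: du|rewrite derive1E].
split; [exact: ua| |exact: d|].
  (* As [b <= a - 1], the function [u] vanishes in the window of radius [1] around [t]. *)
  split=> // t tb; apply: (is_derive_locally_cst (c := 0 : H) ltr01 _ (d t)) => r.
  rewrite ler_norml => /andP[_ rt]; have [_] := ua a (lexx a); apply.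
  by move: rt tb ba; lra.
move=> t.
have -> : f t - A (derive1 u t) - B (u t) - convolution Q u t = P (v t).
  rewrite -(eqn t); vring.
by rewrite uv; exact: weakP_range.
Qed.

Lemma ccont_L2plus b (u : R -> H) : ccont b u -> L2plus u.
Proof.
move=> hu; have [cu u0] := hu; split; first exact: sm_continuous.
move=> t; have [M M0 uM] := ccont_bounded t hu.
have mt : measurable (`]-oo, t] : set T) by exact: measurable_itv.
have mq : measurable_fun setT (fun s : T => (`|u s| ^+ 2)%:E).
  apply/measurable_EFinP; apply: measurable_funX.
  by apply: sm_measurable_norm; exact: sm_continuous.
apply: (@le_lt_trans _ _ (\int[mu]_s (\1_(`[b, t] : set T) s * M ^+ 2)%:E)%E); last first.
  apply: integrable_lty => //; apply: integrable_mulr; exact: integrable_indic_itv.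
rewrite [leLHS]integral_mkcond; apply: ge0_le_integral => //.
- move=> s _; rewrite patchE; case: ifP => // _; rewrite lee_fin; exact: sqr_ge0.
- by apply/(measurable_restrictT _ mt); exact: measurable_funTS mq.
- apply/measurable_EFinP; apply: measurable_funM; last exact: measurable_cst.
  by apply: measurable_indic; exact: measurable_itv.
- move=> s _; rewrite patchE indicE !mem_setE !in_itv/=.
  case: ifP => [st|_]; last by rewrite lee_fin mulr_ge0 ?sqr_ge0.
  rewrite andbT lee_fin.
  have [bs|sb] := leP b s; first by rewrite mul1r lerXn2r ?nnegrE// uM.
  by rewrite u0 ?(ltW sb)// normr0 expr0n mul0r.
Qed.

Lemma solution_of_strong b A B Q f u u' : causal_kernel Q -> ccont b f ->
  strong b A B Q f u u' -> strong_solution j P A B Q f u /\ causal u.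
Proof.
move=> hQ hf [hu hu' du wu]; have [cu u0] := hu.
have [cp _] : ccont b (fun t => f t - A (u' t) - B (u t) - convolution Q u t).
  apply: ccont_sub; last exact: ccont_conv.
  by apply: ccont_sub; [apply: ccont_sub => //|]; exact: ccont_bop.
have [v [cv uv pv]] := weakP_lift P_skew P_graph cu cp wu.
have u'E : derive1 u = u' by apply/funext => t; exact: is_derive1E.
split; last by exists b; apply: aeW => t tb; apply: u0; exact: ltW.
split; [split|exact: ccont_L2plus hu|exists v; split=> // t].
- by move=> t; case: (du t).
- by rewrite u'E; case: hu'.
- rewrite u'E -(pv t); vring.
Qed.

Lemma H1_strong_exists c kappa a A B Q f : 0 < c -> good_coeffs c kappa A B Q ->
  H1 f -> ccont a f ->
  exists W, strong (a - 1) A B Q f (primitive (a - 1) W) W.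
Proof.
move=> c0 hc hf ca; have [gam [g0 gI fE]] := H1_integral hf ca.
have [|Psi [hPsi PsiE]] := @approx_sequence R H (a - 1) gam _ gI.
  by move=> r; rewrite subrK; exact: g0.
have cf : ccont (a - 1) f by apply: ccont_le ca; rewrite gerBl.
have [W hW _] := rough_existence P_skew P_graph gI cf fE hPsi PsiE c0 hc.
by exists W.
Qed.

Lemma strong_shrink b b' A B Q f u u' : b' <= b -> strong b A B Q f u u' ->
  strong b' A B Q f u u'.
Proof.
by move=> bb [hu hu' du wu]; split; [exact: ccont_le hu|exact: ccont_le hu'|exact: du|exact: wu].
Qed.

(** The starting time of a causal solution is a priori arbitrary and could vary with [h]. Uniqueness
    identifies the solution with the constructed one, whose starting time depends only on [f]. *)
Lemma strong_of_solution_at c kappa a A B Q f u : 0 < c -> good_coeffs c kappa A B Q ->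
  H1 f -> ccont a f -> strong_solution j P A B Q f u -> causal u ->
  exists u', strong (a - 1) A B Q f u u'.
Proof.
move=> c0 hc hf ca us uc; have [W hW] := H1_strong_exists c0 hc hf ca.
have [b ub] := strong_of_solution us uc.
have [h1 h2] : Num.min (a - 1) b <= a - 1 /\ Num.min (a - 1) b <= b.
  by rewrite !ge_min !lexx orbT.
rewrite (strong_uniq P_skew c0 hc (ub _ h2) (strong_shrink h1 hW)).
by exists W.
Qed.

Lemma strong_solution_exists_unique c kappa a A B Q f : 0 < c ->
  good_coeffs c kappa A B Q -> H1 f -> ccont a f ->
  exists! u, strong_solution j P A B Q f u /\ causal u.
Proof.
move=> c0 hc hf ca; have [W hW] := H1_strong_exists c0 hc hf ca; have [_ _ hQ _] := hc.
have cf : ccont (a - 1) f by apply: ccont_le ca; rewrite gerBl.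
exists (primitive (a - 1) W); split; first exact: solution_of_strong hW.
move=> v [vs vc]; have [v' hv] := strong_of_solution_at c0 hc hf ca vs vc.
by have := strong_uniq P_skew c0 hc hW hv.
Qed.

End SolutionsAndStrong.

(** * Convergence of the difference quotients *)

Section DifferenceQuotient.
Variables (R : realType) (H V : hilbertType R) (j P : {linear V -> H}).
Hypothesis P_skew : skew_adjoint j P.
Hypothesis P_graph : exists c C : R, 0 < c /\
  forall v, c * `|v| <= `|j v| + `|P v| <= C * `|v|.
Local Notation strong := (strong j P).
Implicit Types (A B dA dB : bop H) (Q dQ : R -> bop H).

Lemma strong_scale b A B Q (c : R) g u u' : causal_kernel Q -> strong b A B Q g u u' ->
  strong b A B Q (fun t => c *: g t) (fun t => c *: u t) (fun t => c *: u' t).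
Proof.
move=> hQ [hu hu' du wu]; split.
- exact: ccont_scale.
- exact: ccont_scale.
- by move=> t; exact: is_deriveZ.
move=> t; have wt := weakP_scale c (wu t).
suff -> : c *: g t - A (c *: u' t) - B (c *: u t) - convolution Q (fun s => c *: u s) t =
    c *: (g t - A (u' t) - B (u t) - convolution Q u t) by exact: wt.
rewrite (conv_scale c t hQ (ccont_lbounded hu)) !bop_scale; vring.
Qed.

Lemma difference_quotient_cvg c kappa a A B Q dA dB dQ f u u' w (t e : R) : 0 < c ->
  good_coeffs c kappa A B Q -> (forall t, selfadjoint (Q t)) -> causal_kernel dQ ->
  H1 f -> ccont a f -> strong (a - 1) A B Q f u u' ->
  weak_solution j P A B Q (fun t => - dA (u' t) - dB (u t) - convolution dQ u t) w ->
  ccont (a - 1) w -> 0 < e ->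
  exists2 del : R, 0 < del & forall h v v', h != 0 -> `|h| <= del ->
    good_coeffs c kappa (A + h *: dA) (B + h *: dB) (fun t => Q t + h *: dQ t) ->
    strong (a - 1) (A + h *: dA) (B + h *: dB) (fun t => Q t + h *: dQ t) f v v' ->
    forall s, s <= t -> `|h^-1 *: (v s - u s) - w s| <= e.
Proof.
move=> c0 hc sQ hdQ hf ca hu hw cw e0.
have [gam [g0 gI fE]] := H1_integral hf ca.
have [|Psi [hPsi PsiE]] := @approx_sequence R H (a - 1) gam _ gI.
  by move=> r; rewrite subrK; exact: g0.
have cf : ccont (a - 1) f by apply: ccont_le ca; rewrite gerBl.
have [sA _ hQ _] := hc.
move: (a - 1) gI fE hPsi PsiE cf hu cw => b gI fE hPsi PsiE cf hu cw {g0 ca}.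
pose T := Num.max b t.
have [bT tT] : b <= T /\ t <= T by rewrite !le_max !lexx orbT.
clearbody T.
pose EC := energy_const c kappa (T - b).
have EC0 : 0 <= EC by exact: energy_const_ge0.
have Tb0 : 0 <= T - b by rewrite subr_ge0.
pose L := EC * (T - b).
have L0 : 0 <= L by rewrite mulr_ge0.
pose C := `|dA| + (`|dB| + kmass dQ) * (T - b).
have C0 : 0 <= C by rewrite addr_ge0// mulr_ge0// addr_ge0// kmass_ge0.
(* Three errors of size [e'] arise: in the data, from mollifying [F], and from mollifying [w]. The
   first two pass through the energy estimate and acquire the factor [L]. *)
pose e' := e / (2 * (L + 1)).
have e'0 : 0 < e' by rewrite divr_gt0// mulr_gt0// ltr_wpDl.
pose eta := e' / (C + 1).
have eta0 : 0 < eta by rewrite divr_gt0// ltr_wpDl.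
have Ceta : C * eta <= e'.
  by rewrite /eta mulrCA ler_piMr ?(ltW e'0)// ler_pdivrMr ?ltr_wpDl// mul1r lerDl.
have Le : EC * ((e' + e') * (T - b)) + e' <= e.
  have -> : EC * ((e' + e') * (T - b)) + e' = e' * (2 * L + 1) by rewrite /L; ring.
  rewrite /e' mulrAC ler_pdivrMr ?mulr_gt0 ?ltr_wpDl// ler_wpM2l ?(ltW e0)//.
  by rewrite mulrDr lerD2l mulr1 ler1n.
have [del del0 delP] := perturbed_derivative_cvg P_skew P_graph gI cf fE hPsi PsiE
  (A := A) (B := B) (Q := Q) dA dB T c0 hdQ hc eta0.
exists del => // h v v' hn0 hdel hch hv s st.
have sT : s <= T := le_trans st tT.
have close := delP h u u' v v' hdel hch hu hv.
have [hu0 hu'0 du0 _] := hu; have [hv0 hv'0 dv0 _] := hv.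
pose F r := - dA (u' r) - dB (u r) - convolution dQ u r.
have hF : ccont b F.
  apply: ccont_sub; last exact: ccont_conv.
  apply: ccont_sub; last exact: ccont_bop.
  by apply: ccont_opp; exact: ccont_bop.
have hd0 : ccont b (fun r => v r - u r) := ccont_sub hv0 hu0.
have hd'0 : ccont b (fun r => v' r - u' r) := ccont_sub hv'0 hu'0.
have dE : (fun r => v r - u r) = primitive b (fun r => v' r - u' r).
  exact: primitive_unique hd'0 hd0.2 (fun r => is_deriveB (dv0 r) (du0 r)).
(* The difference is the primitive of the difference of the derivatives, so closeness of the latter
   suffices; this is the factor [T - b] in [C]. *)
have vu r : r <= T -> `|v r - u r| <= (T - b) * eta.
  move=> rT; have [rb|/ltW br] := leP r b.
    have -> : v r - u r = 0 by exact: (hd0.2 r rb).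
    by rewrite normr0; apply: mulr_ge0; [exact: Tb0|exact: ltW].
  rewrite -[v r - u r]/((fun r => v r - u r) r) dE.
  apply: (le_trans (primitive_bound (M := eta) hd'0 br _)).
    by move=> q /andP[_ qr]; apply: close; exact: le_trans rT.
  by rewrite mulrC ler_wpM2r ?(ltW eta0)// lerD2r.
pose G r := h^-1 *: ((f r - h *: (dA (v' r) + dB (v r) + convolution dQ v r)) - f r).
have hG : strong b A B Q G (fun r => h^-1 *: (v r - u r)) (fun r => h^-1 *: (v' r - u' r)).
  apply: (strong_scale _ hQ); apply: (strong_sub hQ _ hu).
  exact: strong_unperturb hQ hdQ hv.
have GF r : r <= T -> `|G r - F r| <= C * eta.
  move=> rT.
  have -> : G r - F r = - (dA (v' r - u' r) + dB (v r - u r) +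
      convolution dQ (fun q => v q - u q) r).
    rewrite (conv_sub r hdQ (ccont_lbounded hv0) (ccont_lbounded hu0)).
    rewrite /G [f r - _]addrC addrK scalerN scalerA mulVf// scale1r /F !bop_sub; vring.
  rewrite normrN; apply: (le_trans (ler_normD _ _)); rewrite /C mulrDl mulrDl mulrDl -!mulrA addrA.
  apply: lerD; [apply: (le_trans (ler_normD _ _)); apply: lerD|].
  - apply: (le_trans (bop_le _ _)); rewrite ler_wpM2l//; exact: close.
  - apply: (le_trans (bop_le _ _)); rewrite ler_wpM2l//; exact: vu.
  - apply: (convolution_le hdQ (ccont_lbounded hd0)); last first.
      by move=> q qr; apply: vu; exact: le_trans rT.
    by apply: mulr_ge0 => //; exact: ltW.
(* The mollification scale is auxiliary: it is dictated by the moduli of continuity of [F] and [w],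
   and the final bound does not contain it. *)
have [d1 d10 d1P] := ccont_heine T hF e'0.
have [d2 d20 d2P] := ccont_heine T cw e'0.
pose eps := Num.min d1 d2.
have eps0 : 0 < eps by rewrite lt_min d10.
have [ed1 ed2] : eps <= d1 /\ eps <= d2 by rewrite !ge_min !lexx orbT.
clearbody eps.
have [m hm] := mollifier_ex eps0.
have hz := strong_sub hQ hG (weak_mollify hQ sQ sA hF cw hw eps0 hm).
clearbody F G.
have near (y : R -> H) (d : R) : ccont b y -> eps <= d ->
    (forall s t, s <= T -> `|t - s| <= d -> `|y t - y s| <= e') ->
    forall r, r <= T -> `|convolution (scalar_kernel H m) y r - y r| <= e'.
  move=> [cy _] ed yP r rT; apply: (mollify_le eps0 hm cy) => q /andP[q1 q2].
  apply: yP => //; rewrite distrC ger0_norm ?subr_ge0//.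
  by rewrite lerBlDr -lerBlDl; apply: le_trans q1; rewrite lerB.
have zb : `|h^-1 *: (v s - u s) - convolution (scalar_kernel H m) w s| <=
    EC * ((e' + e') * (T - b)).
  apply: (strong_bound P_skew c0 hc hz bT _ _ sT).
    by apply: addr_ge0; exact: ltW.
  move=> r /andP[_ rT].
  have -> : G r - convolution (scalar_kernel H m) F r =
      (G r - F r) - (convolution (scalar_kernel H m) F r - F r).
    by rewrite opprB addrA subrK.
  apply: (le_trans (ler_normB _ _)); apply: lerD; last exact: near hF ed1 d1P r rT.
  exact: le_trans (GF r rT) Ceta.
have -> : h^-1 *: (v s - u s) - w s =
    (h^-1 *: (v s - u s) - convolution (scalar_kernel H m) w s) +
    (convolution (scalar_kernel H m) w s - w s) by rewrite addrA subrK.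
apply: (le_trans (ler_normD _ _)); apply: (le_trans _ Le); apply: lerD; first exact: zb.
exact: near cw ed2 d2P s sT.
Qed.

End DifferenceQuotient.

Theorem theorem8 (R : realType) (H V : hilbertType R)
    (j P : {linear V -> H})
    (sepH : separable H) (sepV : separable V)
    (j_inj : injective j) (j_dense : dense (range j)) (j_cont : continuous j)
    (P_skew : skew_adjoint j P)
    (P_graph : exists c C : R, 0 < c /\
       forall v, c * `|v| <= `|j v| + `|P v| <= C * `|v|)
    (A B : bop H) (Q : R -> bop H) (f : R -> H)
    (ABQ : coefficients A B Q)
    (f_H1 : H1 f) (f_causal : causal f)
    (u : R -> H)
    (u_strong : strong_solution j P A B Q f u) (u_causal : causal u)
    (dA dB : bop H) (dQ : R -> bop H)
    (dA_symm : selfadjoint dA)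
    (dQ_L1 : L1_symm dQ) (dQ_C0 : {within `[0, +oo[, continuous dQ})
    (dQ_bounded : exists M : R, forall t : R, `|dQ t| <= M)
    (dQ_neg : forall t : R, t < 0 -> dQ t = 0)
    (du : R -> H) (du_cont : continuous du)
    (du_weak : weak_solution j P A B Q
       (fun t => - dA (derive1 u t) - dB (u t) - convolution dQ u t) du)
    (du_causal : causal du) :
  (\forall h \near (0 : R),
     coefficients (A + h *: dA) (B + h *: dB) (fun t => Q t + h *: dQ t) /\
     exists! uh : R -> H,
       strong_solution j P (A + h *: dA) (B + h *: dB)
         (fun t => Q t + h *: dQ t) f uh /\ causal uh) /\
  (forall uh : R -> R -> H,
     (\forall h \near 0^',
        strong_solution j P (A + h *: dA) (B + h *: dB)
          (fun t => Q t + h *: dQ t) f (uh h) /\ causal (uh h)) ->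
     forall T0 T : R, T0 <= T ->
       Linfty_norm `[T0, T] (fun t => h^-1 *: (uh h t - u t) - du t)
         @[h --> 0^'] --> 0%E).
Proof.
have [c [kappa [del [c0 del0 pert]]]] :=
  coefficients_perturb dB ABQ dA_symm dQ_L1 dQ_C0 dQ_bounded dQ_neg.
have hdQ := L1_causal_kernel dQ_L1 dQ_neg.
(* The case [h = 0] gives the unperturbed coefficients the same constants. *)
have hc : good_coeffs c kappa A B Q.
  have [|_] := pert 0; first by rewrite normr0 ltW.
  rewrite !scale0r !addr0; congr good_coeffs.
  by apply/funext => t; rewrite scale0r addr0.
have [sA _ hQ _] := hc.
have sQ t : selfadjoint (Q t).
  by case: ABQ => ? [? [? [? [_ [_ [[_ h] _ _ _]]]]]]; exact: h.
have [cf _ _] := f_H1.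
have [af hf] := causal_continuous_ccont cf f_causal.
have [aw hw] := causal_continuous_ccont du_cont du_causal.
(* A common starting time for [f] and [du]; the strong solutions then all start at [a - 1] by
   uniqueness. *)
pose a := Num.min af aw.
have [/hf ca /hw cw] : a <= af /\ a <= aw by rewrite !ge_min !lexx orbT.
have {}cw : ccont (a - 1) du by apply: ccont_le cw; rewrite gerBl.
split.
  apply: filterS (nbhs0_le del0) => h hdel.
  have [coef good] := pert h hdel; split; first exact: coef.
  by have := strong_solution_exists_unique P_skew P_graph c0 good f_H1 ca.
move=> uh uhP T0 T T0T.
have [u' hu] := strong_of_solution_at P_skew P_graph c0 hc f_H1 ca u_strong u_causal.
have u'E : derive1 u = u'.
  by apply/funext => t; case: hu => _ _ d _; exact: is_derive1E (d t).
have hdu : weak_solution j P A B Q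
    (fun t => - dA (u' t) - dB (u t) - convolution dQ u t) du by rewrite -u'E.
have key (e : R) : 0 < e -> \forall h \near 0^',
    (Linfty_norm `[T0, T] (fun t => (h^-1 *: (uh h t - u t) - du t)%R) <= e%:E)%E.
  move=> e0.
  have [d d0 dP] := difference_quotient_cvg P_skew P_graph T c0 hc sQ hdQ f_H1 ca
    hu hdu cw e0.
  near=> h; have [us uc] : strong_solution j P (A + h *: dA) (B + h *: dB)
      (fun t => Q t + h *: dQ t) f (uh h) /\ causal (uh h) by near: h.
  have hd : `|h| <= d by near: h; exact: (dnbhs0_le d0).
  have hdel : `|h| <= del by near: h; exact: (dnbhs0_le del0).
  have h0 : h != 0 by near: h; exact: nbhs_dnbhs_neq.
  have [_ good] := pert h hdel.
  have [v' hv] := strong_of_solution_at P_skew P_graph c0 good f_H1 ca us uc.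
  apply: Linfty_norm_le => [|t /=]; first exact: ltW.
  rewrite in_itv/= => /andP[_ tT].
  exact: (dP h _ v' h0 hd good hv t tT).
have Lge0 h : (0 <= Linfty_norm `[T0, T] (fun t => (h^-1 *: (uh h t - u t) - du t)%R))%E.
  exact: Lnorm_ge0.
apply/fine_cvgP; split.
  near=> h; rewrite ge0_fin_numE//; apply: (@le_lt_trans _ _ 1%:E); last exact: ltry.
  by near: h; exact: key.
apply/cvgrPdist_le => e e0; near=> h.
rewrite sub0r normrN ger0_norm /=; last exact: fine_ge0.
have le : (Linfty_norm `[T0, T] (fun t => (h^-1 *: (uh h t - u t) - du t)%R) <= e%:E)%E.
  by near: h; exact: key.
rewrite -lee_fin fineK// ge0_fin_numE//; exact: le_lt_trans le (ltry e).
Unshelve. all: by end_near. Qed.
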